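(* Suppose that $\mathcal{M}$ is a closed $\mathcal{C}^2$-embedded submanifold of $\mathbb{X}$, that the sequences $\{x^k\}_{k\in\mathbb{N}}$ and $\{\rho_k\}_{k\in\mathbb{N}}$ generated by Algorithm 1 are bounded, and that the index set $\mathcal{S}$ of successful iterations is infinite. If the potential function $\Xi_{\overline c}$ satisfies the KL property on the set $\mathcal{W}^*$ of cluster points of $\{w^k\}_{k\in\mathbb{N}}$, then $\sum_{k=0}^\infty\|x^{k+1}-x^k\|<\infty$, so the sequence $\{x^k\}_{k\in\mathbb{N}}$ converges to a stationary point of (P).
   Context: **Problem.** $\mathbb{X},\mathbb{Y}$ are finite-dimensional real Euclidean spaces (inner product $\langle\cdot,\cdot\rangle$, induced norm $\|\cdot\|$); $\mathbb{Z}:=\mathbb{X}\times\mathbb{Y}$ with $\|(z_1;z_2)\|:=(\|z_1\|^2+\|z_2\|^2)^{1/2}$. $\mathcal{M}\subset\mathbb{X}$ is a closed embedded submanifold, with tangent and normal spaces $T_x\mathcal{M},N_x\mathcal{M}$ and tangent bundle $T\mathcal{M}=\{(x,v):x\in\mathcal{M},v\in T_x\mathcal{M}\}$; $K\subset\mathbb{Y}$ is closed and convex. $\mathcal{P}_C$ is the Euclidean projection onto $C$; $\delta_C$ the indicator function; $\mathcal{N}_K$ the normal cone; $\partial$ the limiting subdifferential; $\nabla g(x)$ the adjoint of $g'(x)$; $h^*$ the convex conjugate. $|||\cdot|||$ is a fixed norm on $\mathbb{Y}$ and $\mathrm{dist}(y,K):=\inf_{u\in K}|||y-u|||$; $c_u\ge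 c_l>0$ satisfy $c_l\|\cdot\|\le|||\cdot|||\le c_u\|\cdot\|$. Problem (P): minimize $\Theta(x):=f(x)+\vartheta(x)-h(x)$ over $x\in g^{-1}(K)\cap\mathcal{M}$. Standing assumptions: $f,\vartheta,h:\mathbb{X}\to\mathbb{R}$, $g:\mathbb{X}\to\mathbb{Y}$; $f$ is differentiable with locally Lipschitz gradient and $g$ is differentiable with locally Lipschitz Jacobian on an open convex set $\mathcal{O}\supset\mathcal{M}$; $\vartheta,h$ are convex; $g^{-1}(K)\cap\mathcal{M}\ne\emptyset$. Penalty function: $\Theta_\rho(x):=\Theta(x)+\rho\,\mathrm{dist}(g(x),K)$. **Stationary point of (P):** $x\in\mathcal{M}\cap g^{-1}(K)$ such that $0\in\nabla f(x)+\partial\vartheta(x)+\partial(-h)(x)+\nabla g(x)\xi+N_x\mathcal{M}$ for some $\xi\in\mathcal{N}_K(g(x))$. **Subproblem data at iteration $k$.** For $x^k\in\mathcal{M}$, $\zeta^k\in\partial(-h)(x^k)$, $\rho_k,\beta_k>0$: $\ell_k(v):=\langle\nabla f(x^k)+\zeta^k,v\rangle+f(x^k)-h(x^k)$; $G(x,v):=(x+v;\,g(x)+g'(x)v)$, with $\nabla_vG(x,v)(\xi_1;\xi_2)=\xi_1+\nabla g(x)\xi_2$; $\psi_\rho(z):=\vartheta(z_1)+\rho\,\mathrm{dist}(z_2,K)$; $\widehat\Theta_{\rho_k}(x^k+v;x^k):=\ell_k(v)+\psi_{\rho_k}(G(x^k,v))+\frac{\beta_k}{2}\|v\|^2$. For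 a triple $(v^k,z^k,\xi^k)\in T_{x^k}\mathcal{M}\times\mathbb{Z}\times\partial\psi_{\rho_k}(z^k)$ let $p^k:=\mathcal{P}_{T_{x^k}\mathcal{M}}(\nabla\ell_k(v^k)+\beta_kv^k+\nabla_vG(x^k,v^k)\xi^k)$ and consider (I1) $\max\{\|G(x^k,v^k)-z^k\|,\|p^k\|,\|\beta_kv^k\|\}\le\varepsilon_k$; (D) $\widehat\Theta_{\rho_k}(x^k+v^k;x^k)<\Theta_{\rho_k}(x^k)$; (I2) $\|G(x^k,v^k)-z^k\|\le a_k\|v^k\|^2$ and $\|p^k\|\le b_k\|v^k\|$. **Algorithm 1.** Input: a retraction $R$ on $\mathcal{M}$ (a smooth $R:T\mathcal{M}\to\mathcal{M}$ with $R_x:=R(x,\cdot)$, $R_x(0)=x$, $R_x'(0)=\mathrm{id}$), $\rho_0>0$, $0<\beta_{\min}<\beta_0$, $a_{\max},b_{\max}>0$, $\tau>1$, $\varepsilon_0>0$, $\varsigma\in(0,1)$, $0<\eta_1<\eta_2<1$, $\overline\gamma>0$, $0<\sigma_2<1<\sigma_1$, $x^0\in\mathcal{M}$. For $k=0,1,2,\dots$: Step 3: choose $\zeta^k\in\partial(-h)(x^k)$. Step 4: choose $a_k\in(0,a_{\max}]$, $b_k\in(0,b_{\max}]$ and find a triple $(v^k,z^k,\xi^k)\in T_{x^k}\mathcal{M}\times\mathbb{Z}\times\partial\psi_{\rho_k}(z^k)$ satisfying either (I1) or both (D) and (I2). If (I1) holds go to Step 5, else to Step 6. Step 5: if $\max\{\varepsilon_k,\mathrm{dist}(z_2^k,K)\}=0$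 stop. Otherwise $x^{k+1}:=x^k$, $\beta_{k+1}:=\beta_k$, $\varepsilon_{k+1}:=\varsigma\varepsilon_k$, $\rho_{k+1}:=\rho_k$ if $\mathrm{dist}(z_2^k,K)\le\varepsilon_k$ and $\rho_{k+1}:=\tau\rho_k$ otherwise; next iteration. Step 6: if $\max\{\|v^k\|,\mathrm{dist}(z_2^k,K)\}=0$ stop. Otherwise let $\mathrm{ared}_k:=\Theta_{\rho_k}(x^k)-\Theta_{\rho_k}(R_{x^k}(v^k))$, $\mathrm{pred}_k:=\Theta_{\rho_k}(x^k)-\widehat\Theta_{\rho_k}(x^k+v^k;x^k)$, $r_k:=\mathrm{ared}_k/\mathrm{pred}_k$. If $r_k<\eta_1$ or $\mathrm{pred}_k<\overline\gamma\|v^k\|^2$: $x^{k+1}:=x^k$, $\beta_{k+1}:=\sigma_1\beta_k$, $\rho_{k+1}:=\rho_k$; next iteration. Otherwise (successful iteration) $x^{k+1}:=R_{x^k}(v^k)$, $\beta_{k+1}:=\beta_k$ if $r_k<\eta_2$ and $\beta_{k+1}:=\max\{\sigma_2\beta_k,\beta_{\min}\}$ otherwise. Step 7: $\rho_{k+1}:=\tau\rho_k$ if $\max\{\rho_k,[\mathrm{dist}(z_2^k,K)]^{-1}\}<\beta_k^{-1}\|v^k\|^{-1}$, and $\rho_{k+1}:=\rho_k$ otherwise. ($\varepsilon_k$ changes only in Step 5.) $\mathcal{S}$ denotes the set of successful iterations. $\overline\rho$ is the eventual constant value of $\{\rho_k\}$. **Constants.** $\lceil a\rceil_+:=\max\{0,\lceil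 a\rceil\}$. $M>0$ satisfies $\|R_{x^k}(v^k)-(x^k+v^k)\|\le M\|v^k\|^2$ for all $k$. $\mathcal{X}_1\supset\bigcup_k([x^k+v^k,R_{x^k}(v^k)]\cup\mathcal{U}_k)$, $\mathcal{X}_2\supset\bigcup_k[x^k+v^k,R_{x^k}(v^k)]$, $\mathcal{X}_3\supset\bigcup_k[x^k,x^k+v^k]$ are compact convex sets, $\mathcal{U}_k$ an open neighborhood of $[x^k+v^k,z_1^k]$ (such $M$, sets exist). $L_\vartheta$ is a Lipschitz constant of $\vartheta$ on $\mathcal{X}_1$; $L_f,L_h,L_g$ of $f,h,g$ on $\mathcal{X}_1\cap\mathcal{X}_2$; $L_{\nabla f},L_{\nabla g}$ of $\nabla f,\nabla g$ on $\mathcal{X}_3$. $L:=\frac12(L_{\nabla f}+c_u\overline\rho L_{\nabla g})+(L_f+c_u\overline\rho L_g+L_\vartheta+L_h)M$. $N:=\max\{N_1,N_2\}$ with $N_1:=\Big\lceil\frac{\log[2(b_{\max}+2a_{\max}(L_\vartheta^2+c_u^2\overline\rho^2)^{1/2}+\overline\gamma)]-\log\beta_{\min}}{\log\sigma_1}\Big\rceil_++1$, $N_2:=\Big\lceil\frac{\log[2(1-\eta_1)(b_{\max}+2a_{\max}(L_\vartheta^2+c_u^2\overline\rho^2)^{1/2})+2L]-\log[(1-\eta_1)\beta_{\min}]}{\log\sigma_1}\Big\rceil_++1$; $\overline\beta:=\beta_{\min}\sigma_1^N$; $\overline c:=L+2a_{\max}(L_\vartheta^2+c_u^2\overline\rho^2)^{1/2}+\overline\beta/2$.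 **Potential function.** Let $\{e_i\}_{i=1}^p$, $\{d_i\}_{i=1}^q$ be orthonormal bases of $\mathbb{X},\mathbb{Y}$; $\mathcal{G}\widehat x:=\sum_i\widehat x_ie_i$ for $\widehat x\in\mathbb{R}^p$, $\mathcal{F}\widehat y:=\sum_i\widehat y_id_i$ for $\widehat y\in\mathbb{R}^q$; $Q^k\in\mathbb{R}^{q\times p}$ is the matrix with $g'(x^k)v=\mathcal{F}Q^k\mathcal{G}^*v$. Let $H(x,v,Q):=(x+v;\,g(x)+\mathcal{F}Q\mathcal{G}^*v)\in\mathbb{Z}$. For $w=(x,v,Q,\xi,z,\zeta,y)\in\mathbb{W}:=\mathbb{X}\times\mathbb{X}\times\mathbb{R}^{q\times p}\times\mathbb{Z}\times\mathbb{Z}\times\mathbb{X}\times\mathbb{X}$, $$\Xi_{\overline c}(w):=f(x)+\langle x,\zeta\rangle+h^*(-\zeta)+\langle y,v\rangle+\psi_{\overline\rho}(z)+\langle\xi,H(x,v,Q)-z\rangle+\delta_{T\mathcal{M}}(x,v)+\overline c\|v\|^2,$$ and $w^k:=(x^k,v^k,Q^k,\xi^k,z^k,\zeta^k,y^k)$ with $y^k:=\nabla f(x^k)+\zeta^k$. **KL property** of $\Phi:\mathbb{W}\to(-\infty,\infty]$ on a set: at each point $\overline w$ of the set there are $\eta\in(0,\infty]$, a neighborhood $U$ of $\overline w$ and a continuous concave $\varphi:[0,\eta)\to[0,\infty)$ with $\varphi(0)=0$, $\varphi$ $\mathcal{C}^1$ on $(0,\eta)$, $\varphi'>0$, such that $\varphi'(\Phi(w)-\Phi(\overline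 w))\,\mathrm{dist}(0,\partial\Phi(w))\ge1$ for all $w\in U$ with $\Phi(\overline w)<\Phi(w)<\Phi(\overline w)+\eta$. *)

(* Defs.v *)
From mathcomp Require Import all_boot all_order all_algebra.
From mathcomp Require Import all_classical all_reals all_analysis.

Set Implicit Arguments.
Unset Strict Implicit.
Unset Printing Implicit Defensive.

Import Order.TTheory GRing.Theory Num.Theory.
Import numFieldNormedType.Exports.

Local Open Scope ring_scope.
Local Open Scope classical_set_scope.

(* Euclidean structure: [X] is a normed module together with an inner product
   [ip] whose induced norm is the norm of [X], and an orthonormal basis
   witnesses finite dimension. On product spaces the norm of the library is the
   sup norm, so the Euclidean norm there is always written [enorm ip]; both
   norms induce the same topology. *)

Section Euclidean.
Context {R : realType}.

Definition enorm (E : lmodType R) (ip : E -> E -> R) (u : E) : R :=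
  Num.sqrt (ip u u).

Definition orthonormal_basis (E : lmodType R) (ip : E -> E -> R) (n : nat)
    (e : 'I_n -> E) : Prop :=
  (forall i j, ip (e i) (e j) = (i == j)%:R) /\
  (forall u, exists c : 'I_n -> R, u = \sum_i c i *: e i).

Definition ip_prod (E F : lmodType R) (ipE : E -> E -> R) (ipF : F -> F -> R)
  (u w : E * F) : R := ipE u.1 w.1 + ipF u.2 w.2.

Definition ip_frobenius (m n : nat) (A B : 'M[R]_(m, n)) : R := \tr (A *m B^T).

(* The synthesis map G : R^n -> E of an orthonormal basis and its adjoint. *)
Definition synthesis (E : lmodType R) (n : nat) (e : 'I_n -> E)
  (c : 'cV[R]_n) : E := \sum_i c i 0 *: e i.

Definition analysis_map (E : lmodType R) (ip : E -> E -> R) (n : nat)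
  (e : 'I_n -> E) (u : E) : 'cV[R]_n := \col_i ip u (e i).

(* Riesz representation; the vector is unique, and it exists for every linear
   map in finite dimension. *)
Definition gradient (E : normedModType R) (ip : E -> E -> R) (f : E -> R)
    (x : E) : E :=
  xget 0 [set u | forall v, ip u v = 'd (f : E -> R^o) x v].

Definition adjoint (E F : lmodType R) (ipE : E -> E -> R) (ipF : F -> F -> R)
    (A : E -> F) (y : F) : E :=
  xget 0 [set u | forall v, ipE u v = ipF y (A v)].

Definition projection (E : normedModType R) (C : set E) (x : E) : E :=
  xget 0 [set p | C p /\ forall c, C c -> `|x - p| <= `|x - c|].

Definition segment (E : lmodType R) (a b : E) : set E :=
  [set u | exists t : R, 0 <= t <= 1 /\ u = (1 - t) *: a + t *: b].

Definition is_norm (E : lmodType R) (N : E -> R) : Prop :=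
  [/\ forall u, 0 <= N u,
      forall u, N u = 0 -> u = 0,
      forall (a : R) u, N (a *: u) = `|a| * N u
    & forall u w, N (u + w) <= N u + N w].

(* Lipschitz continuity of an operator-valued map in the operator norm. *)
Definition op_lipschitz_on (E F G : normedModType R) (L : R) (A : set E)
    (J : E -> F -> G) : Prop :=
  forall x y u, A x -> A y -> `|J x u - J y u| <= L * `|x - y| * `|u|.

End Euclidean.

Section VariationalAnalysis.
Context {R : realType}.

(* Frechet (regular) and limiting (Mordukhovich) subdifferentials, empty at
   points where the function is not finite. *)
Definition regular_subdiff (E : normedModType R) (ip : E -> E -> R)
    (Phi : E -> \bar R) (w : E) : set E :=
  [set u | Phi w \is a fin_num /\
    forall eps : R, 0 < eps -> \forall w' \near w,
      (Phi w + (ip u (w' - w) - eps * enorm ip (w' - w))%:E <= Phi w')%E].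

Definition limiting_subdiff (E : normedModType R) (ip : E -> E -> R)
    (Phi : E -> \bar R) (w : E) : set E :=
  [set u | Phi w \is a fin_num /\
    exists (w_ : nat -> E) (u_ : nat -> E),
      [/\ w_ @ \oo --> w,
          (fun n => Phi (w_ n)) @ \oo --> Phi w,
          u_ @ \oo --> u
        & forall n, regular_subdiff ip Phi (w_ n) (u_ n)]].

Definition subdiff (E : normedModType R) (ip : E -> E -> R) (f : E -> R) :
    E -> set E :=
  limiting_subdiff ip (fun x => (f x)%:E).

Definition normal_cone (E : normedModType R) (ip : E -> E -> R) (K : set E)
    (y : E) : set E :=
  [set xi | K y /\ forall y', K y' -> ip xi (y' - y) <= 0].

Definition conjugate (E : normedModType R) (ip : E -> E -> R) (h : E -> R)
    (y : E) : \bar R :=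
  ereal_sup [set (ip y x - h x)%:E | x in [set: E]].

Definition indicator_fun (E : Type) (C : set E) (x : E) : \bar R :=
  if x \in C then 0%E else +oo%E.

Definition tdist (E : lmodType R) (N : E -> R) (K : set E) (y : E) : R :=
  inf [set N (y - u) | u in K].

(* dist(0, dPhi(w)); it is +oo when the subdifferential is empty. *)
Definition dist0_subdiff (E : normedModType R) (ip : E -> E -> R)
    (Phi : E -> \bar R) (w : E) : \bar R :=
  ereal_inf [set (enorm ip u)%:E | u in limiting_subdiff ip Phi w].

Definition desingularizing (eta : \bar R) (phi : R -> R) : Prop :=
  let D := [set s : R | 0 <= s /\ (s%:E < eta)%E] in
  [/\ forall s, D s -> 0 <= phi s,
      {within D, continuous phi},
      (forall s t lambda : R, D s -> D t -> 0 <= lambda <= 1 ->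
        (1 - lambda) * phi s + lambda * phi t
          <= phi ((1 - lambda) * s + lambda * t)),
      phi 0 = 0
    & forall s, 0 < s -> (s%:E < eta)%E ->
        [/\ derivable phi s 1, {for s, continuous (phi^`())}
          & 0 < phi^`() s]].

Definition KL_property_at (E : normedModType R) (ip : E -> E -> R)
    (Phi : E -> \bar R) (wbar : E) : Prop :=
  exists (eta : \bar R) (U : set E) (phi : R -> R),
    [/\ (0 < eta)%E, nbhs wbar U, desingularizing eta phi
      & forall w, U w -> (Phi wbar < Phi w)%E -> (Phi w < Phi wbar + eta)%E ->
          (1%:E <= (derive1 phi (fine (Phi w - Phi wbar)))%:E
                     * dist0_subdiff ip Phi w)%E].

Definition KL_property (E : normedModType R) (ip : E -> E -> R)
    (Phi : E -> \bar R) (S : set E) : Prop :=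
  forall wbar, S wbar -> KL_property_at ip Phi wbar.

End VariationalAnalysis.

Section Manifolds.
Context {R : realType}.

(* In finite dimension, F is C^(k+1) on the open set U iff it is differentiable
   on U and all its directional differentials x |-> F'(x) v are C^k on U. *)
Fixpoint Ck (k : nat) (V W : normedModType R) (U : set V) (F : V -> W) : Prop :=
  match k with
  | 0 => forall x, U x -> {for x, continuous F}
  | k'.+1 => (forall x, U x -> differentiable F x) /\
             (forall v : V, Ck k' U (fun x => 'd F x v))
  end.

Definition linear_subspace (E : lmodType R) (S : set E) : Prop :=
  S 0 /\ forall (a : R) u v, S u -> S v -> S (a *: u + v).

(* Slice charts: around each of its points, M is carried by a C^k
   diffeomorphism between open sets of E onto a piece of a fixed linear
   subspace S (whose dimension is that of M). *)
Definition embedded_submanifold (k : nat) (E : normedModType R) (M : set E) :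
    Prop :=
  exists2 S : set E, linear_subspace S &
    forall x, M x -> exists (U V : set E) (Phi Psi : E -> E),
      [/\ open U /\ U x, open V, Ck k U Phi, Ck k V Psi &
        [/\ forall y, U y -> V (Phi y) /\ Psi (Phi y) = y,
            forall z, V z -> U (Psi z) /\ Phi (Psi z) = z
          & forall y, U y -> (M y <-> S (Phi y))]].

(* Velocities at x of C^1 curves lying in M. *)
Definition tangent_space (E : normedModType R) (M : set E) (x : E) : set E :=
  [set v | exists c : R -> E,
    [/\ c 0 = x,
        \forall t \near (0 : R),
          [/\ M (c t), derivable c t 1 & {for t, continuous (c^`())}]
      & c^`() 0 = v]].

Definition normal_vectors (E : normedModType R) (ip : E -> E -> R) (M : set E)
    (x : E) : set E :=
  [set u | forall v, tangent_space M x v -> ip u v = 0].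

Definition tangent_bundle (E : normedModType R) (M : set E) : set (E * E) :=
  [set xv | M xv.1 /\ tangent_space M xv.1 xv.2].

(* The tangent bundle of a C^2 submanifold is of class C^1, so smoothness of a
   retraction on it is C^1-smoothness, expressed by local C^1 extensions. *)
Definition retraction (E : normedModType R) (M : set E) (Rt : E -> E -> E) :
    Prop :=
  [/\ forall x v, tangent_bundle M (x, v) -> M (Rt x v),
      forall w, tangent_bundle M w -> exists (U : set (E * E)) (F : E * E -> E),
        [/\ open U, U w, Ck 1 U F
          & forall w', U w' -> tangent_bundle M w' -> F w' = Rt w'.1 w'.2],
      forall x, M x -> Rt x 0 = x
    & forall x, M x -> forall eps : R, 0 < eps -> \forall v \near (0 : E),
        tangent_space M x v -> `|Rt x v - Rt x 0 - v| <= eps * `|v|].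

End Manifolds.

Record problem (R : realType) (X Y : normedModType R) := Problem {
  pM : set X;
  pK : set Y;
  pf : X -> R;
  pvt : X -> R; (* vartheta *)
  ph : X -> R;
  pg : X -> Y;
  ptn : Y -> R (* the norm |||.||| *)
}.

Record parameters (R : realType) (X : normedModType R) := AlgParameters {
  retr : X -> X -> X;
  betamin : R;
  amax : R;
  bmax : R;
  tau : R;
  varsigma : R;
  eta1 : R;
  eta2 : R;
  gammabar : R;
  sigma1 : R;
  sigma2 : R
}.

(* The inputs rho_0, beta_0, eps_0, x^0 are the values at 0 of the sequences. *)
Record iterates (R : realType) (X Y : normedModType R) := Iterates {
  ix : nat -> X;
  ibeta : nat -> R;
  ieps : nat -> R;
  irho : nat -> R;
  izeta : nat -> X;
  ia : nat -> R;
  ib : nat -> R;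
  iv : nat -> X;
  iz : nat -> X * Y;
  ixi : nat -> X * Y
}.

Record constants (R : realType) := Constants {
  cu : R;
  rhobar : R;
  Mretr : R;
  L_vt : R;
  L_f : R;
  L_h : R;
  L_g : R;
  L_gradf : R;
  L_gradg : R
}.

Section ProblemP.
Context {R : realType} {X Y : normedModType R}.
Context (ipX : X -> X -> R) (ipY : Y -> Y -> R) (P : problem X Y).

Local Notation M := (pM P).
Local Notation K := (pK P).
Local Notation f := (pf P).
Local Notation vt := (pvt P).
Local Notation h := (ph P).
Local Notation g := (pg P).
Local Notation dist := (tdist (ptn P) (pK P)).

Definition ipZ : X * Y -> X * Y -> R := ip_prod ipX ipY.

(* The operator written nabla g(x). *)
Definition adjJ (x : X) : Y -> X := adjoint ipX ipY ('d g x).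

(* The smoothness class of the submanifold is not part of this predicate. *)
Definition standing_assumptions : Prop :=
  [/\ closed M,
      closed K /\ convex_set K,
      is_norm (ptn P),
      exists O : set X,
        [/\ open O, convex_set O, M `<=` O
          , (forall x, O x -> differentiable (f : X -> R^o) x) /\
            (forall x, O x -> exists (U : set X) (L : R),
              nbhs x U /\ L.-lipschitz_(O `&` U) (gradient ipX f))
          & (forall x, O x -> differentiable g x) /\
            (forall x, O x -> exists (U : set X) (L : R),
              nbhs x U /\ op_lipschitz_on L (O `&` U) (fun y => 'd g y))]
    & [/\ @convex_function R X setT vt,
          @convex_function R X setT h
        & exists x, K (g x) /\ M x]].

Definition Theta (x : X) : R := f x + vt x - h x.

Definition Theta_pen (rho : R) (x : X) : R := Theta x + rho * dist (g x).

Definition stationary (x : X) : Prop :=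
  [/\ M x, K (g x)
    & exists xi, normal_cone ipY K (g x) xi /\
      exists s t n : X,
        [/\ subdiff ipX vt x s, subdiff ipX (fun u => - h u) x t,
            normal_vectors ipX M x n
          & 0 = gradient ipX f x + s + t + adjJ x xi + n]].

Definition psi (rho : R) (z : X * Y) : R := vt z.1 + rho * dist z.2.

Definition Gmap (x v : X) : X * Y := (x + v, g x + 'd g x v).

(* nabla_v G(x, v), which does not depend on v. *)
Definition adjG (x : X) (xi : X * Y) : X := xi.1 + adjJ x xi.2.

Definition ell (x zeta v : X) : R :=
  ipX (gradient ipX f x + zeta) v + f x - h x.

(* The model value \widehat\Theta_rho(x + v; x). *)
Definition Theta_hat (rho beta : R) (x zeta v : X) : R :=
  ell x zeta v + psi rho (Gmap x v) + beta / 2 * `|v| ^+ 2.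

Section Algorithm.
Context (A : parameters X) (it : iterates X Y).

Local Notation x := (ix it).
Local Notation beta := (ibeta it).
Local Notation eps := (ieps it).
Local Notation rho := (irho it).
Local Notation zeta := (izeta it).
Local Notation v := (iv it).
Local Notation z := (iz it).
Local Notation xi := (ixi it).

Definition pvec (k : nat) : X :=
  projection (tangent_space M (x k))
    (gradient ipX (ell (x k) (zeta k)) (v k) + beta k *: v k
       + adjG (x k) (xi k)).

Definition cond_I1 (k : nat) : Prop :=
  Num.max (enorm ipZ (Gmap (x k) (v k) - z k))
    (Num.max `|pvec k| `|beta k *: v k|) <= eps k.

Definition cond_D (k : nat) : Prop :=
  Theta_hat (rho k) (beta k) (x k) (zeta k) (v k) < Theta_pen (rho k) (x k).

Definition cond_I2 (k : nat) : Prop :=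
  enorm ipZ (Gmap (x k) (v k) - z k) <= ia it k * `|v k| ^+ 2 /\
  `|pvec k| <= ib it k * `|v k|.

Definition aredk (k : nat) : R :=
  Theta_pen (rho k) (x k) - Theta_pen (rho k) (retr A (x k) (v k)).

Definition predk (k : nat) : R :=
  Theta_pen (rho k) (x k)
    - Theta_hat (rho k) (beta k) (x k) (zeta k) (v k).

Definition acc_ratio (k : nat) : R := aredk k / predk k.

Definition rejected (k : nat) : Prop :=
  acc_ratio k < eta1 A \/ predk k < gammabar A * `|v k| ^+ 2.

Definition successful (k : nat) : Prop := ~ cond_I1 k /\ ~ rejected k.

(* Inverses are taken in \bar R, where 0^-1 = +oo. *)
Definition rho_test (k : nat) : Prop :=
  (Order.max (rho k)%:E (dist (z k).2)%:E^-1 < (beta k)%:E^-1 * (`|v k|)%:E^-1)%E.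

Definition step5 (k : nat) : Prop :=
  [/\ Num.max (eps k) (dist (z k).2) <> 0,
      x k.+1 = x k, beta k.+1 = beta k, eps k.+1 = varsigma A * eps k
    & rho k.+1 = if dist (z k).2 <= eps k then rho k else tau A * rho k].

Definition step67 (k : nat) : Prop :=
  [/\ Num.max `|v k| (dist (z k).2) <> 0,
      eps k.+1 = eps k,
      rejected k ->
        [/\ x k.+1 = x k, beta k.+1 = sigma1 A * beta k & rho k.+1 = rho k]
    & ~ rejected k ->
        [/\ x k.+1 = retr A (x k) (v k),
            beta k.+1 = (if acc_ratio k < eta2 A then beta k
                         else Num.max (sigma2 A * beta k) (betamin A))
          & rho k.+1 = if `[< rho_test k >] then tau A * rho k else rho k]].

Definition valid_input : Prop :=
  [/\ retraction M (retr A) /\ M (x 0%N),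
      0 < rho 0%N /\ 0 < betamin A < beta 0%N,
      [/\ 0 < amax A, 0 < bmax A, 1 < tau A & 0 < eps 0%N],
      0 < varsigma A < 1 /\ [/\ 0 < eta1 A, eta1 A < eta2 A & eta2 A < 1]
    & 0 < gammabar A /\ [/\ 0 < sigma2 A, sigma2 A < 1 & 1 < sigma1 A]].

(* An infinite run, i.e. one that never meets a stopping test. *)
Definition generated : Prop :=
  valid_input /\
  forall k,
    [/\ subdiff ipX (fun u => - h u) (x k) (zeta k),
        0 < ia it k <= amax A /\ 0 < ib it k <= bmax A,
        [/\ tangent_space M (x k) (v k),
            subdiff ipZ (psi (rho k)) (z k) (xi k)
          & cond_I1 k \/ (cond_D k /\ cond_I2 k)],
        cond_I1 k -> step5 k
      & ~ cond_I1 k -> step67 k].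

Section Constants.
Context (C : constants R).

(* A Lipschitz constant of nabla f or nabla g on X3 presupposes that f and g
   are differentiable at the points of X3. *)
Definition valid_constants : Prop :=
  [/\ (exists2 cl : R, 0 < cl <= cu C &
         forall y : Y, cl * `|y| <= ptn P y <= cu C * `|y|),
      (exists k0, forall k, (k0 <= k)%N -> rho k = rhobar C),
      (0 < Mretr C /\ forall k,
         `|retr A (x k) (v k) - (x k + v k)| <= Mretr C * `|v k| ^+ 2)
    & exists (X1 X2 X3 : set X) (U : nat -> set X),
       [/\ [/\ compact X1, compact X2 & compact X3],
           [/\ convex_set X1, convex_set X2 & convex_set X3],
           forall k,
             [/\ open (U k), segment (x k + v k) (z k).1 `<=` U k,
                 segment (x k + v k) (retr A (x k) (v k)) `|` U k `<=` X1,
                 segment (x k + v k) (retr A (x k) (v k)) `<=` X2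
               & segment (x k) (x k + v k) `<=` X3],
           [/\ 0 <= L_vt C /\ (L_vt C).-lipschitz_X1 (vt : X -> R^o),
               0 <= L_f C /\ (L_f C).-lipschitz_(X1 `&` X2) (f : X -> R^o),
               0 <= L_h C /\ (L_h C).-lipschitz_(X1 `&` X2) (h : X -> R^o)
             & 0 <= L_g C /\ (L_g C).-lipschitz_(X1 `&` X2) g]
         & [/\ 0 <= L_gradf C /\ 0 <= L_gradg C,
               forall u, X3 u -> differentiable (f : X -> R^o) u
                                 /\ differentiable g u,
               (L_gradf C).-lipschitz_X3 (gradient ipX f)
             & op_lipschitz_on (L_gradg C) X3 adjJ]]].

Definition Lconst : R :=
  2^-1 * (L_gradf C + cu C * rhobar C * L_gradg C)
  + (L_f C + cu C * rhobar C * L_g C + L_vt C + L_h C) * Mretr C.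

Definition ceil_pos (a : R) : nat := absz (Num.max 0 (Num.ceil a)).

(* The Lipschitz constant of psi_rhobar. *)
Definition Lpsi : R := Num.sqrt (L_vt C ^+ 2 + cu C ^+ 2 * rhobar C ^+ 2).

Definition N1 : nat :=
  (ceil_pos ((ln (2 * (bmax A + 2 * amax A * Lpsi + gammabar A))
              - ln (betamin A)) / ln (sigma1 A))).+1.

Definition N2 : nat :=
  (ceil_pos ((ln (2 * (1 - eta1 A) * (bmax A + 2 * amax A * Lpsi) + 2 * Lconst)
              - ln ((1 - eta1 A) * betamin A)) / ln (sigma1 A))).+1.

Definition betabar : R := betamin A * sigma1 A ^+ maxn N1 N2.

Definition cbar : R := Lconst + 2 * amax A * Lpsi + betabar / 2.

Section Potential.
Context (p q : nat) (e : 'I_p -> X) (d : 'I_q -> Y).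

Definition spaceW : normedModType R :=
  (X * X * 'M[R]_(q, p) * (X * Y) * (X * Y) * X * X)%type.

Definition ipW : spaceW -> spaceW -> R :=
  ip_prod (ip_prod (ip_prod (ip_prod (ip_prod (ip_prod ipX ipX)
    (@ip_frobenius R q p)) ipZ) ipZ) ipX) ipX.

Definition Hmap (x v : X) (Q : 'M[R]_(q, p)) : X * Y :=
  (x + v, g x + synthesis d (Q *m analysis_map ipX e v)).

Definition Xi (c : R) (w : spaceW) : \bar R :=
  let: (x, v, Q, xi, z, zeta, y) := w in
  ((f x + ipX x zeta)%:E + conjugate ipX h (- zeta)%R
   + (ipX y v + psi (rhobar C) z + ipZ xi (Hmap x v Q - z))%:E
   + indicator_fun (tangent_bundle M) (x, v) + (c * `|v| ^+ 2)%:E)%E.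

Definition wseq (Q : nat -> 'M[R]_(q, p)) (k : nat) : spaceW :=
  (x k, v k, Q k, xi k, z k, zeta k, gradient ipX f (x k) + zeta k).

End Potential.
End Constants.
End Algorithm.
End ProblemP.

(* Main.v *)
Require Import Defs.
From HB Require Import structures.
From mathcomp Require Import all_boot all_order all_algebra.
From mathcomp Require Import all_classical all_reals all_analysis.
From mathcomp Require Import ring lra.

Set Implicit Arguments.
Unset Strict Implicit.
Unset Printing Implicit Defensive.

Import Order.TTheory GRing.Theory Num.Theory.
Import numFieldNormedType.Exports.

Local Open Scope ring_scope.
Local Open Scope classical_set_scope.

(** Let [rhob] be the final penalty parameter and let the penalty value at [k]
    be [Theta_pen P rhob (x k)]. Once the parameter has settled, this value
    never increases, and a successful iteration lowers it by a multiple of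
    [`|v k| ^+ 2] ([penalty_decrease]). The iterates being bounded, it converges
    to some [Ts], so [v] tends to [0] along the successful iterations; the
    proximal parameters [beta k] stay bounded, because a large one rules
    out rejection ([beta_bounded]).

    The Kurdyka-Lojasiewicz inequality is applied to the potential, which a
    successful iteration [k] sandwiches ([potential_ge], [potential_le]): its
    value at [w k] lies between the penalty value at [k.+1] and the penalty
    value at [k] plus [cbar * `|v k| ^+ 2]. It has a subgradient of size
    [O(`|v k|)] at [w k] ([ultra_subgradient_bound]). That is the delicate point:
    the vector [grad f + zeta + adjG xi] has a small tangential part, by the
    inexactness test, but a large normal part [nu], which occurs in two
    components of the subgradient and has to be cancelled by a normal vector of
    the tangent bundle. The manifold being of class C^2, the tangent bundle is
    locally cut out by a map of class C^1, and differentiating it gives, for every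
    normal [nu], a normal vector [(B, nu)] of the bundle with
    [B] of size [`|nu| * `|v|]; and [(nu, 0)] is normal as well
    ([tangent_bundle_normal]). The combination [- (nu + B, nu)] cancels [nu]
    twice and leaves [B].

    If [k'] and [k] are consecutive successful iterations, [phi] is the
    desingularizing function and [a := eta1 * gammabar], then concavity of [phi]
    at the potential value of [k'], which dominates the penalty value of [k],
    gives [a * `|v k| ^+ 2 <= `|v k'| * (phi_k - phi_(k+1))], where [phi_k] is [phi]
    at the penalty value of [k] minus [Ts] and constants are absorbed in [phi].
    Hence [2 * `|v k| <= `|v k'| + (phi_k - phi_(k+1)) / a] ([step_recursion]),
    and summation gives finite length ([finite_length]).

    The constants and the functions [phi] depend on the cluster point. They are
    made uniform through ultrafilters: a property of sets of indices that is
    stable under finite unions, and holds for some member of each ultrafilter of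
    successful indices, holds for a set that contains all late successful indices
    ([ultrafilter_ideal]). The same ultrafilters replace the extraction of
    subsequences wherever a bounded sequence needs a limit.

    Feasibility of the limit comes from the penalty update: since the parameter
    stays constant, its test fails at late successful iterations, which forces
    the constraint violation below [beta k * `|v k|] ([violation_le]). The
    optimality conditions of the subproblems then pass to the limit
    ([limit_stationary]). *)

(** * Inner products *)

(** A predicate on bare functions, so that it applies to the products [ip_prod]
    and to the Frobenius product as well. *)
Definition inner_product (R : realType) (E : lmodType R) (ip : E -> E -> R) :=
  [/\ forall a u v w, ip (a *: u + v) w = a * ip u w + ip v w,
      forall u v, ip u v = ip v u
    & forall u, u != 0 -> 0 < ip u u].

Section InnerProduct.
Context {R : realType} {E : lmodType R} {ip : E -> E -> R}.
Hypothesis hip : inner_product ip.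

Lemma ipC u v : ip u v = ip v u.
Proof. by case: hip => _ h _; exact: h. Qed.

Lemma ipDl u v w : ip (u + v) w = ip u w + ip v w.
Proof. by case: hip => h _ _; rewrite -{1}[u]scale1r h mul1r. Qed.

Lemma ip0l w : ip 0 w = 0.
Proof.
by apply: (@addIr _ (ip 0 w)); rewrite -ipDl !add0r.
Qed.

Lemma ipZl a u w : ip (a *: u) w = a * ip u w.
Proof. by case: hip => h _ _; rewrite -[a *: u]addr0 h ip0l addr0. Qed.

Lemma ipNl u w : ip (- u) w = - ip u w.
Proof. by rewrite -scaleN1r ipZl mulN1r. Qed.

Lemma ipBl u v w : ip (u - v) w = ip u w - ip v w.
Proof. by rewrite ipDl ipNl. Qed.

Lemma ipDr u v w : ip u (v + w) = ip u v + ip u w.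
Proof. by rewrite ipC ipDl !(ipC u). Qed.

Lemma ip0r w : ip w 0 = 0.
Proof. by rewrite ipC ip0l. Qed.

Lemma ipZr a u w : ip u (a *: w) = a * ip u w.
Proof. by rewrite ipC ipZl ipC. Qed.

Lemma ipNr u w : ip u (- w) = - ip u w.
Proof. by rewrite ipC ipNl ipC. Qed.

Lemma ipBr u v w : ip u (v - w) = ip u v - ip u w.
Proof. by rewrite ipDr ipNr. Qed.

Lemma ip_suml (I : Type) (r : seq I) (P : pred I) (F : I -> E) w :
  ip (\sum_(i <- r | P i) F i) w = \sum_(i <- r | P i) ip (F i) w.
Proof.
elim/big_rec2: _ => [|i y x _ <-]; first exact: ip0l.
by rewrite ipDl.
Qed.

Lemma ip_sumr (I : Type) (r : seq I) (P : pred I) (F : I -> E) w :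
  ip w (\sum_(i <- r | P i) F i) = \sum_(i <- r | P i) ip w (F i).
Proof. by rewrite ipC ip_suml; apply: eq_bigr => i _; rewrite ipC. Qed.

Lemma ip_ge0 u : 0 <= ip u u.
Proof.
have [->|u0] := eqVneq u 0; first by rewrite ip0l.
by case: hip => _ _ /(_ _ u0) /ltW.
Qed.

Lemma ip_eq0 u : ip u u = 0 -> u = 0.
Proof.
move=> uu; apply: contrapT => /eqP u0.
by case: hip => _ _ /(_ _ u0); rewrite uu ltxx.
Qed.

Lemma enorm_ge0 u : 0 <= enorm ip u.
Proof. exact: sqrtr_ge0. Qed.

Lemma enorm_sqr u : enorm ip u ^+ 2 = ip u u.
Proof. by rewrite sqr_sqrtr // ip_ge0. Qed.

Lemma enorm0 : enorm ip 0 = 0.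
Proof. by rewrite /enorm ip0l sqrtr0. Qed.

Lemma enormZ a u : enorm ip (a *: u) = `|a| * enorm ip u.
Proof.
by rewrite /enorm ipZl ipZr mulrA -expr2 sqrtrM ?sqr_ge0 // sqrtr_sqr.
Qed.

Lemma enormN u : enorm ip (- u) = enorm ip u.
Proof. by rewrite /enorm ipNl ipNr opprK. Qed.

Lemma ip_sqrD u v : ip (u + v) (u + v) = ip u u + 2 * ip u v + ip v v.
Proof. by rewrite ipDl !ipDr (ipC v u); ring. Qed.

Lemma cauchy_schwarz u v : ip u v <= enorm ip u * enorm ip v.
Proof.
have [->|v0] := eqVneq v 0; first by rewrite ip0r enorm0 mulr0.
have vv : 0 < ip v v by case: hip => _ _; exact.
have [h|h] := lerP (ip u v) 0.
  by rewrite (le_trans h) // mulr_ge0 // enorm_ge0.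
rewrite -(@ler_pXn2r _ 2) ?nnegrE ?mulr_ge0 ?enorm_ge0 ?(ltW h) //.
rewrite exprMn !enorm_sqr.
have := ip_ge0 (ip v v *: u - ip u v *: v).
rewrite !(ipBl, ipBr, ipZl, ipZr) (ipC v u) => H.
rewrite -subr_ge0 -(pmulr_rge0 _ vv).
by move: H; congr (0 <= _); ring.
Qed.

Lemma cauchy_schwarz_norm u v : `|ip u v| <= enorm ip u * enorm ip v.
Proof.
rewrite ler_norml cauchy_schwarz andbT lerNl -ipNl -enormN.
exact: cauchy_schwarz.
Qed.

Lemma eq_from_ip u u' : (forall v, ip u v = ip u' v) -> u = u'.
Proof.
move=> h; apply/eqP; rewrite -subr_eq0; apply/eqP/ip_eq0.
by rewrite ipBl h subrr.
Qed.

End InnerProduct.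

Lemma dot_inner_product (R : realType) (E : lmodType R)
  (ip : {dot E for idfun}) : inner_product ip.
Proof.
split.
- by move=> a u v w; rewrite linearDl linearZl_LR.
- by move=> u v; rewrite hermC /= expr0 mul1r.
- by move=> u u0; exact: neq0_dnorm_gt0.
Qed.

Section ProductInner.
Context {R : realType} {E F : lmodType R}.
Context {ipE : E -> E -> R} {ipF : F -> F -> R}.
Hypotheses (hE : inner_product ipE) (hF : inner_product ipF).

Lemma ip_prod_inner : inner_product (ip_prod ipE ipF).
Proof.
split.
- move=> a u v w; rewrite /ip_prod /= (ipDl hE) (ipDl hF) (ipZl hE) (ipZl hF).
  ring.
- by move=> u v; rewrite /ip_prod (ipC hE) (ipC hF).
- move=> [u v] uv0; rewrite /ip_prod /=.
  have [u0|u0] := eqVneq u 0.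
    have [v0|v0] := eqVneq v 0; first by rewrite u0 v0 eqxx in uv0.
    by rewrite ltr_wpDl ?(ip_ge0 hE) //; case: hF => _ _; exact.
  by rewrite ltr_wpDr ?(ip_ge0 hF) //; case: hE => _ _; exact.
Qed.

Lemma enorm_fst (u : E * F) : enorm ipE u.1 <= enorm (ip_prod ipE ipF) u.
Proof. by rewrite ler_wsqrtr // /ip_prod lerDl (ip_ge0 hF). Qed.

Lemma enorm_snd (u : E * F) : enorm ipF u.2 <= enorm (ip_prod ipE ipF) u.
Proof. by rewrite ler_wsqrtr // /ip_prod lerDr (ip_ge0 hE). Qed.

Lemma enorm_prod_le (u : E * F) :
  enorm (ip_prod ipE ipF) u <= enorm ipE u.1 + enorm ipF u.2.
Proof.
rewrite -(@ler_pXn2r _ 2) ?nnegrE ?addr_ge0 ?enorm_ge0 //.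
rewrite (enorm_sqr ip_prod_inner) /ip_prod sqrrD (enorm_sqr hE) (enorm_sqr hF).
rewrite lerD2r lerDl mulrn_wge0 // mulr_ge0 // enorm_ge0 //.
Qed.

End ProductInner.

Lemma ip_frobeniusE (R : realType) m n (A B : 'M[R]_(m, n)) :
  ip_frobenius A B = \sum_i \sum_j A i j * B i j.
Proof.
rewrite /ip_frobenius /mxtrace; apply: eq_bigr => i _.
by rewrite mxE; apply: eq_bigr => j _; rewrite mxE.
Qed.

Lemma ip_frobenius_inner (R : realType) m n :
  inner_product (@ip_frobenius R m n).
Proof.
split.
- move=> a u v w; rewrite !ip_frobeniusE mulr_sumr -big_split /=.
  apply: eq_bigr => i _; rewrite mulr_sumr -big_split /=.
  by apply: eq_bigr => j _; rewrite !mxE; ring.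
- move=> u v; rewrite !ip_frobeniusE; apply: eq_bigr => i _.
  by apply: eq_bigr => j _; rewrite mulrC.
- move=> u u0; rewrite ip_frobeniusE lt_neqAle eq_sym.
  have h i : 0 <= \sum_j u i j * u i j.
    by apply: sumr_ge0 => j _; rewrite -expr2 sqr_ge0.
  rewrite sumr_ge0 // andbT; apply: contra u0 => /eqP u00.
  apply/eqP/matrixP => i j; rewrite mxE.
  have /eqP := u00; rewrite psumr_eq0 // => /allP /(_ i (mem_index_enum _)) /=.
  rewrite psumr_eq0 => [/allP /(_ j (mem_index_enum _)) /=|k _].
    by rewrite mulf_eq0 orbb => /eqP.
  by rewrite -expr2 sqr_ge0.
Qed.

(** * Ultrafilters and finite dimension *)

(** A compactness principle: if no member of [F] were in the ideal [I], the
    members of [F] and the complements of the members of [I] would generate a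
    proper filter, and an ultrafilter above it could not meet [I]. It turns
    estimates along each ultrafilter, with constants depending on it, into one
    estimate valid on a member of [F]. *)
Lemma ultrafilter_ideal (T : Type) (F : set_system T) (I : set (set T)) :
  ProperFilter F ->
  (forall A B, I A -> I B -> I (A `|` B)) ->
  (forall G, UltraFilter G -> F `<=` G -> exists2 A, G A & I A) ->
  exists2 A, F A & I A.
Proof.
move=> FF IU Iultra; apply: contrapT => noA.
have [A0 IA0] : exists A, I A.
  have [G [UG FG]] := ultraFilterLemma FF.
  by have [A _ IA] := Iultra G UG FG; exists A.
pose H := filter_from [set AB : set T * set T | F AB.1 /\ I AB.2]
  (fun AB => AB.1 `\` AB.2).
have PH : ProperFilter H.
  apply: filter_from_proper.
    apply: filter_from_filter; first by exists (setT, A0); split => //; exact: filterT.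
    move=> [A B] [A' B'] [/= FA IB] [/= FA' IB'].
    exists (A `&` A', B `|` B'); first by split; [exact: filterI|exact: IU].
    by move=> x /= [[Ax A'x] /not_orP[nB nB']].
  move=> [A B] [/= FA IB]; apply: contrapT => AB0; apply: noA.
  exists B => //; apply: filterS FA => x Ax.
  by apply: contrapT => nB; apply: AB0; exists x.
have [G [UG HG]] := ultraFilterLemma PH.
have FG : F `<=` G.
  by move=> A FA; apply: HG; exists (A, A0) => // x [].
have [A GA IA] := Iultra G UG FG.
have GAC : G (~` A) by apply: HG; exists (setT, A) => [|x []//]; split => //; exact: filterT.
apply: (@filter_not_empty _ G).
by rewrite -(setICr A); exact: filterI.
Qed.

(** A proper filter [H] above the image is recovered from the traces of the
    preimages of its members on [G], which generate a proper filter above [G]. *)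
Lemma ultra_image (T U : Type) (G : set_system T) (u : T -> U) :
  UltraFilter G -> UltraFilter (u @ G).
Proof.
move=> UG; split; first exact: fmap_proper_filter.
move=> H PH GH; apply/seteqP; split => // A HA.
rewrite /fmap /=.
pose K := filter_from [set AB : set T * set U | G AB.1 /\ H AB.2]
  (fun AB => AB.1 `&` (u @^-1` AB.2)).
have PK : ProperFilter K.
  apply: filter_from_proper.
    apply: filter_from_filter; first by exists (setT, setT); split; exact: filterT.
    move=> [A1 B] [A' B'] [/= FA IB] [/= FA' IB'].
    exists (A1 `&` A', B `&` B'); first by split; exact: filterI.
    by move=> x /= [[Ax A'x] [? ?]].
  move=> [A1 B] [/= GA HB].
  have : H (u @` A1).
    by apply: GH; rewrite /fmap /=; apply: filterS GA => x Ax; exists x.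
  move=> /(filterI HB)/filter_ex [y [By [x Ax xy]]].
  by exists x; split => //=; rewrite xy.
have GK : G `<=` K.
  by move=> B GB; exists (B, setT); [split => //; exact: filterT|move=> x []].
have -> : G = K by apply/esym; apply: (@max_filter _ G).
by exists (setT, A); [split => //; exact: filterT|move=> x []].
Qed.

Lemma ultra_bounded_cvgR (R : realType) (T : Type) (G : set_system T)
  (u : T -> R) (B : R) :
  UltraFilter G -> (\forall k \near G, `|u k| <= B) -> exists l : R, u @ G --> l.
Proof.
move=> UG uB; have := @segment_compact R (- B) B; rewrite compact_ultra /=.
have UuG := ultra_image u UG.
move=> /(_ (u @ G) UuG) [|l [_ ul]]; last by exists l.
by rewrite /fmap /=; apply: filterS uB => k; rewrite ler_norml /= in_itv.
Qed.

(** [cvg_pair] for limits that are points instead of filters. *)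
Lemma cvg_pair_points (T : Type) (F : set_system T) (FF : Filter F)
  (E1 E2 : topologicalType) (u : T -> E1) (v : T -> E2) (a : E1) (b : E2) :
  u @ F --> a -> v @ F --> b -> (fun k => (u k, v k)) @ F --> (a, b).
Proof. exact: cvg_pair. Qed.

Definition euclidean (R : realType) (E : normedModType R) (ip : E -> E -> R)
    (n : nat) (e : 'I_n -> E) :=
  [/\ inner_product ip, forall u, `|u| = enorm ip u & orthonormal_basis ip e].

Section FiniteDimension.
Context {R : realType} {E : normedModType R} {ip : E -> E -> R}.
Context {n : nat} {e : 'I_n -> E}.
Hypothesis hE : euclidean ip e.

Let hip : inner_product ip. Proof. by case: hE. Qed.

Lemma euclid_norm u : `|u| = enorm ip u. Proof. by case: hE. Qed.

Lemma norm_sqr_ip u : `|u| ^+ 2 = ip u u.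
Proof. by rewrite euclid_norm (enorm_sqr hip). Qed.

Lemma ip_le_norm u v : ip u v <= `|u| * `|v|.
Proof. by rewrite !euclid_norm; exact: cauchy_schwarz. Qed.

Lemma normr_ip u v : `|ip u v| <= `|u| * `|v|.
Proof. by rewrite !euclid_norm; exact: cauchy_schwarz_norm. Qed.

Lemma basis_expansion u : u = \sum_i ip u (e i) *: e i.
Proof.
case: hE => _ _ [on /(_ u) [c uE]].
rewrite {1}uE; apply: eq_bigr => i _; congr (_ *: _).
rewrite uE (ip_suml hip) (bigD1 i) //= (ipZl hip) on eqxx mulr1 big1 ?addr0 //.
by move=> j ji; rewrite (ipZl hip) on (negPf ji) mulr0.
Qed.

Lemma basis_norm i : `|e i| = 1.
Proof.
by case: hE => _ -> [on _]; rewrite /enorm on eqxx sqrtr1.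
Qed.

Lemma ip_basis_le u i : `|ip u (e i)| <= `|u|.
Proof. by rewrite (le_trans (normr_ip _ _)) // basis_norm mulr1. Qed.

Lemma ip_dist_le a b u v : `|ip u v - ip a b| <= `|u - a| * `|v| + `|a| * `|v - b|.
Proof.
have -> : ip u v - ip a b = ip (u - a) v + ip a (v - b).
  by rewrite (ipBl hip) (ipBr hip); ring.
by rewrite (le_trans (ler_normD _ _)) // lerD // normr_ip.
Qed.

Lemma cvg_ip (T : Type) (F : set_system T) (FF : Filter F) (u v : T -> E) a b :
  u @ F --> a -> v @ F --> b -> (fun k => ip (u k) (v k)) @ F --> ip a b.
Proof.
move=> ua vb.
have v1 : (fun k => `|v k|) @ F --> `|b| by apply: cvg_norm.
have u0 : (fun k => `|u k - a|) @ F --> (0 : R).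
  by rewrite -(@normr0 R E) -(subrr a); apply: cvg_norm; apply: cvgB ua _; exact: cvg_cst.
have v0 : (fun k => `|v k - b|) @ F --> (0 : R).
  by rewrite -(@normr0 R E) -(subrr b); apply: cvg_norm; apply: cvgB vb _; exact: cvg_cst.
have h : (fun k => `|u k - a| * `|v k| + `|a| * `|v k - b|) @ F --> (0 : R).
  rewrite -[X in _ --> X](_ : 0 * `|b| + `|a| * 0 = 0); last by rewrite mul0r mulr0 addr0.
  apply: cvgD; first exact: cvgM.
  by apply: cvgM => //; exact: cvg_cst.
apply/cvgrPdist_le => eps eps0.
move/cvgrPdist_le : h => /(_ _ eps0); apply: filterS => k.
rewrite sub0r normrN => h; rewrite distrC (le_trans (ip_dist_le _ _ _ _)) //.
by rewrite (le_trans _ h) // ler_norm.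
Qed.

Lemma cvg_coordinates (T : Type) (F : set_system T) (FF : Filter F) (u : T -> E)
  (c : 'I_n -> R) : (forall i, (fun k => ip (u k) (e i)) @ F --> c i) ->
  u @ F --> \sum_i c i *: e i.
Proof.
move=> hc.
rewrite (_ : u = (fun k => \sum_i ip (u k) (e i) *: e i)); last first.
  by apply/funext => k; exact: basis_expansion.
apply: cvg_big => [|i _]; first exact: add_continuous.
by apply: cvgZ; [exact: hc|exact: cvg_cst].
Qed.

Lemma ultra_bounded_cvg (T : Type) (G : set_system T) (u : T -> E) (B : R) :
  UltraFilter G -> (\forall k \near G, `|u k| <= B) -> exists l : E, u @ G --> l.
Proof.
move=> UG uB.
have h i : exists l : R, (fun k => ip (u k) (e i)) @ G --> l.
  apply: (@ultra_bounded_cvgR _ _ _ _ B) => //; apply: filterS uB => k.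
  exact/le_trans/ip_basis_le.
pose c i := projT1 (cid (h i)).
have hc i : (fun k => ip (u k) (e i)) @ G --> c i by exact: (projT2 (cid (h i))).
by exists (\sum_i c i *: e i); exact: cvg_coordinates.
Qed.

Lemma riesz (f : E -> R) : (forall a u v, f (a *: u + v) = a * f u + f v) ->
  exists u, forall v, ip u v = f v.
Proof.
move=> fl.
have f0 : f 0 = 0.
  by have := fl 1 0 0; rewrite scale1r addr0 mul1r => /eqP; rewrite -subr_eq0 opprD addrA subrr sub0r oppr_eq0 => /eqP.
exists (\sum_i f (e i) *: e i) => v.
rewrite {2}(basis_expansion v) (ip_suml hip).
have -> : forall (r : seq 'I_n), f (\sum_(i <- r) ip v (e i) *: e i) = \sum_(i <- r) ip v (e i) * f (e i).
  by elim=> [|i r IH]; rewrite ?big_nil // !big_cons fl IH.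
by apply: eq_bigr => i _; rewrite (ipZl hip) mulrC (ipC hip).
Qed.

Lemma gradientP (f : E -> R) (x v : E) :
  ip (gradient ip f x) v = 'd (f : E -> R^o) x v.
Proof.
have [|u hu] := @riesz ('d (f : E -> R^o) x).
  by move=> a u w; rewrite linearP.
rewrite /gradient.
exact: (@xgetPex _ 0 [set u | forall v, ip u v = 'd (f : E -> R^o) x v]
  (ex_intro _ u hu)).
Qed.

Lemma linear_bounded_basis (F : normedModType R) (A : {linear E -> F}) u :
  `|A u| <= (\sum_i `|A (e i)|) * `|u|.
Proof.
rewrite {1}(basis_expansion u) linear_sum.
rewrite (le_trans (ler_norm_sum _ _ _)) // mulr_suml ler_sum // => i _.
by rewrite linearZ normrZ mulrC ler_wpM2l // ip_basis_le.
Qed.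

Lemma cvg_linear (F : normedModType R) (A : {linear E -> F}) : continuous A.
Proof.
apply/linear_bounded_continuous.
apply/linear_boundedP.
near=> r => u; rewrite (le_trans (linear_bounded_basis _ _)) //.
by rewrite ler_wpM2r //; near: r; exact: nbhs_pinfty_ge.
Unshelve. all: by end_near. Qed.

Lemma parseval u v : ip u v = \sum_i ip u (e i) * ip v (e i).
Proof.
rewrite {1}(basis_expansion u) (ip_suml hip).
by apply: eq_bigr => i _; rewrite (ipZl hip) (ipC hip v).
Qed.

(** The identity of size [m] factors through [R^n] as [O *m O^T]. *)
Lemma orthonormal_family_size m (f : 'I_m -> E) :
  (forall i j, ip (f i) (f j) = (i == j)%:R) -> (m <= n)%N.
Proof.
move=> on.
pose O : 'M[R]_(m, n) := \matrix_(i, j) ip (f i) (e j).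
have OO : O *m O^T = 1%:M.
  apply/matrixP => i j; rewrite !mxE -on parseval.
  by apply: eq_bigr => k _; rewrite !mxE.
rewrite -(mxrank1 R m) -OO.
exact: leq_trans (mxrankM_maxl _ _) (rank_leq_col _).
Qed.

Lemma subspace_sum (S : set E) (I : Type) (r : seq I) (c : I -> R) (f : I -> E) :
  linear_subspace S -> (forall i, S (f i)) -> S (\sum_(i <- r) c i *: f i).
Proof.
move=> [S0 Sl] Sf; elim: r => [|i r IH]; first by rewrite big_nil.
by rewrite big_cons; exact: Sl.
Qed.

(** An orthonormal family in [S] has at most [n] members, so there is a maximal
    one; it spans [S], since a residual could be normalized and appended. *)
Lemma orthogonal_decomposition (S : set E) (x : E) : linear_subspace S ->
  exists t, S t /\ forall s, S s -> ip (x - t) s = 0.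
Proof.
move=> hS.
pose P m := exists f : 'I_m -> E, (forall i, S (f i)) /\
  forall i j, ip (f i) (f j) = (i == j)%:R.
have P0 : exists m, `[< P m >].
  exists 0%N; apply/asboolP; exists (fun=> 0); split => [|i]; last by case: i.
  by case.
have Pn m : `[< P m >] -> (m <= n)%N.
  by move=> /asboolP[f [_ on]]; exact: orthonormal_family_size on.
case: (ex_maxnP P0 Pn) => m /asboolP[f [Sf on]] maxm.
have ip_proj (y : E) j : ip (y - \sum_i ip y (f i) *: f i) (f j) = 0.
  rewrite (ipBl hip) (ip_suml hip) (bigD1 j) //= (ipZl hip) on eqxx mulr1.
  rewrite big1 ?addr0 ?subrr // => i ij.
  by rewrite (ipZl hip) on (negPf ij) mulr0.
have span s : S s -> s = \sum_i ip s (f i) *: f i.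
  move=> Ss; apply/eqP; rewrite -subr_eq0; apply: contrapT => /negP r0.
  set r := s - _ in r0.
  have Sr : S r.
    by rewrite /r addrC -scaleN1r; apply: (proj2 hS) => //; exact: subspace_sum.
  have r0' : `|r| != 0 by rewrite normr_eq0.
  have : (m.+1 <= m)%N; last by rewrite ltnn.
  apply/maxm/asboolP.
  exists (fun i => if unlift ord_max i is Some j then f j else `|r|^-1 *: r); split.
    move=> i; case: unliftP => [j _|_] //.
    by rewrite -[X in S X]addr0; apply: (proj2 hS) => //; case: hS.
  move=> i j; case: unliftP => [i' ->|->]; case: unliftP => [j' ->|->].
  - by rewrite on (inj_eq (@lift_inj _ _)).
  - rewrite (ipZr hip) (ipC hip) ip_proj mulr0 eq_sym (negPf (neq_lift _ _)) //.
  - by rewrite (ipZl hip) ip_proj mulr0 (negPf (neq_lift _ _)).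
  - rewrite (ipZr hip) (ipZl hip) -norm_sqr_ip eqxx expr2.
    by rewrite mulrA -invfM mulVf // mulf_neq0.
exists (\sum_i ip x (f i) *: f i); split; first exact: subspace_sum.
move=> s /span ->; rewrite (ip_sumr hip) big1 // => j _.
by rewrite (ipZr hip) ip_proj mulr0.
Qed.

Lemma projectionP (S : set E) (x : E) : linear_subspace S ->
  S (projection S x) /\ forall s, S s -> ip (x - projection S x) s = 0.
Proof.
move=> hS; have [t [St ot]] := orthogonal_decomposition x hS.
have pyth c : S c -> `|x - c| ^+ 2 = `|x - t| ^+ 2 + `|t - c| ^+ 2.
  move=> Sc; rewrite !norm_sqr_ip.
  have Stc : S (t - c) by rewrite addrC -scaleN1r; exact: (proj2 hS).
  have -> : x - c = (x - t) + (t - c) by rewrite addrA subrK.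
  by rewrite (ip_sqrD hip) (ot _ Stc) mulr0 addr0.
suff -> : projection S x = t by [].
set p := projection S x.
have [Sp hp] : S p /\ forall c, S c -> `|x - p| <= `|x - c|.
  apply: (@xgetPex _ 0 [set p | S p /\ forall c, S c -> `|x - p| <= `|x - c|]).
  exists t; split => // c Sc; rewrite -(@ler_pXn2r _ 2) ?nnegrE // (pyth c Sc).
  by rewrite lerDl sqr_ge0.
have := hp t St; rewrite -(@ler_pXn2r _ 2) ?nnegrE // (pyth p) // gerDl => h.
have : `|t - p| ^+ 2 == 0 by rewrite eq_le h sqr_ge0.
by rewrite expf_eq0 /= normr_eq0 subr_eq0 => /eqP ->.
Qed.

Lemma projection_ip (S : set E) (x s : E) : linear_subspace S -> S s ->
  ip (projection S x) s = ip x s.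
Proof.
move=> hS Ss; have [_ /(_ s Ss)] := projectionP x hS.
by rewrite (ipBl hip) => /eqP; rewrite subr_eq0 eq_sym => /eqP.
Qed.

End FiniteDimension.

Section Adjoint.
Context {R : realType} {E F : normedModType R}.
Context {ipE : E -> E -> R} {ipF : F -> F -> R} {n : nat} {e : 'I_n -> E}.
Hypotheses (hE : euclidean ipE e) (hF : inner_product ipF).

Lemma adjointP (A : {linear E -> F}) y v :
  ipE (adjoint ipE ipF A y) v = ipF y (A v).
Proof.
have [|u hu] := @riesz _ _ _ _ _ hE (fun v => ipF y (A v)).
  by move=> a u w; rewrite linearP (ipDr hF) (ipZr hF).
rewrite /adjoint.
exact: (@xgetPex _ 0 [set u | forall v, ipE u v = ipF y (A v)]
  (ex_intro _ u hu)).
Qed.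

End Adjoint.

(** * Convex functions and subgradients *)

Lemma cvg_to_le (R : realFieldType) (T : Type) (F : set_system T)
  (FF : ProperFilter F) (f g : T -> R) (a b : R) :
  f @ F --> a -> g @ F --> b -> (\forall k \near F, f k <= g k) -> a <= b.
Proof.
move=> fa gb fg; rewrite -subr_ge0.
apply: (@cvgr_to_ge _ F _ _ (fun k => g k - f k)); first exact: cvgB.
by apply: filterS fg => k; rewrite subr_ge0.
Qed.

Lemma le_of_le_mul_eps (R : realFieldType) (a b c : R) : 0 <= c ->
  (forall eps, 0 < eps -> a <= b + eps * c) -> a <= b.
Proof.
move=> c0 h; rewrite leNgt; apply/negP => ba.
have /h : 0 < (a - b) / (c + 1) / 2 by rewrite !divr_gt0 ?subr_gt0 ?ltr_wpDl.
rewrite -lerBlDl mulrAC ler_pdivlMr // mulrAC ler_pdivlMr ?ltr_wpDl //.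
have : 0 < a - b by rewrite subr_gt0.
have : 0 <= (a - b) * c by rewrite mulr_ge0 // subr_ge0 ltW.
nra.
Qed.

Definition convexf (R : realType) (E : lmodType R) (f : E -> R) :=
  forall (t : R) x y, 0 <= t -> t <= 1 ->
    f (t *: x + (1 - t) *: y) <= t * f x + (1 - t) * f y.

Lemma convex_functionP (R : realType) (E : lmodType R) (f : E -> R) :
  @convex_function R E setT f -> convexf f.
Proof.
move=> cf t x y t0 t1.
by have := cf (Itv01 t0 t1) x y; rewrite !inE => /(_ I I).
Qed.

Lemma convex_setP (R : realType) (E : lmodType R) (A : set E) :
  convex_set A -> forall (t : R) x y, 0 <= t -> t <= 1 -> A x -> A y ->
    A (t *: x + (1 - t) *: y).
Proof.
move=> cA t x y t0 t1 /mem_set Ax /mem_set Ay; apply/set_mem.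
exact: (cA x y (Itv01 t0 t1)).
Qed.

Lemma half_double (R : realType) (E : lmodType R) (x : E) : 2^-1 *: (x + x) = x.
Proof.
by rewrite -[x in x + x]scale1r -scalerDl scalerA mulVf ?scale1r // pnatr_eq0.
Qed.

Lemma convex_comb_shift (R : realType) (E : lmodType R) (t : R) (x a : E) :
  t *: (x + a) + (1 - t) *: x = x + t *: a.
Proof. by rewrite scalerDr addrAC -scalerDl (addrC t) subrK scale1r. Qed.

Lemma near_segment (R : realType) (E : normedModType R) (w d : E) (Q : set E) :
  (\forall w' \near w, Q w') -> exists t : R, [/\ 0 < t, t <= 1, Q (w + t *: d) & Q (w - t *: d)].
Proof.
move=> /nbhs_ballP[r /= r0 rQ].
have t0 : 0 < r / (r + `|d| + 1) by rewrite divr_gt0 // !ltr_wpDr.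
have dr : 0 < r + `|d| + 1 by rewrite !ltr_wpDr.
exists (r / (r + `|d| + 1)); split => //.
- by rewrite ler_pdivrMr // mul1r -addrA lerDl addr_ge0.
- apply: rQ; rewrite -ball_normE /= opprD addrA subrr sub0r normrN normrZ gtr0_norm //.
  rewrite mulrAC ltr_pdivrMr // ltr_pM2l //; have := normr_ge0 d; lra.
- apply: rQ; rewrite -ball_normE /= opprB addrC subrK normrZ gtr0_norm //.
  rewrite mulrAC ltr_pdivrMr // ltr_pM2l //; have := normr_ge0 d; lra.
Qed.

Section Subgradients.
Context {R : realType} {E : normedModType R} {ip : E -> E -> R}.
Hypothesis hip : inner_product ip.

Lemma regular_subdiff_EFin (f : E -> R) w u :
  regular_subdiff ip (fun x => (f x)%:E) w u <->
  forall eps : R, 0 < eps -> \forall w' \near w,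
    f w + (ip u (w' - w) - eps * enorm ip (w' - w)) <= f w'.
Proof.
split => [[_ h] eps eps0|h].
  by have := h _ eps0; apply: filterS => w'; rewrite lee_fin.
by split => // eps eps0; have := h _ eps0; apply: filterS => w'; rewrite lee_fin.
Qed.

Lemma convex_regular_subgradient (f : E -> R) w u : convexf f ->
  regular_subdiff ip (fun x => (f x)%:E) w u ->
  forall y, f w + ip u (y - w) <= f y.
Proof.
move=> cf /regular_subdiff_EFin h y.
apply: (@le_of_le_mul_eps _ _ _ (enorm ip (y - w))); first exact: enorm_ge0.
move=> eps eps0; have [t [t0 t1 + _]] := near_segment (y - w) (h eps eps0).
rewrite (addrAC w) subrr add0r (ipZr hip) (enormZ hip) gtr0_norm // => hw.
have := cf t (w + (y - w)) w (ltW t0) t1; rewrite convex_comb_shift (addrC w (y - w)) subrK.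
move=> H.
have : 0 <= t * (f y + eps * enorm ip (y - w) - (f w + ip u (y - w))) by lra.
by rewrite pmulr_rge0 // subr_ge0.
Qed.

(** The subgradient bounds [h] from above near [w], on both sides; convexity
    at the midpoint [w] of [w - t d] and [w + t d] turns the bound at [w - t d]
    into a lower bound at [w + t d], which convexity extends to all of the ray. *)
Lemma concave_regular_subgradient (h : E -> R) w u : convexf h ->
  regular_subdiff ip (fun x => (- h x)%:E) w u ->
  forall y, h w - ip u (y - w) <= h y.
Proof.
move=> ch /regular_subdiff_EFin H y.
apply: (@le_of_le_mul_eps _ _ _ (enorm ip (y - w))); first exact: enorm_ge0.
move=> eps eps0; have [t [t0 t1 _]] := near_segment (y - w) (H eps eps0).
rewrite (addrAC w) subrr add0r (ipNr hip) (enormN hip).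
rewrite (ipZr hip) (enormZ hip) gtr0_norm //.
move=> hw.
have h2 := ch 2^-1 (w - t *: (y - w)) (w + t *: (y - w)) ltac:(lra) ltac:(lra).
have := ch t (w + (y - w)) w (ltW t0) t1.
rewrite convex_comb_shift (addrC w (y - w)) subrK.
move: h2; have -> : 2^-1 *: (w - t *: (y - w)) + (1 - 2^-1) *: (w + t *: (y - w)) = w.
  have -> : (1 - 2^-1 : R) = 2^-1 by lra.
  by rewrite -scalerDr addrACA addNr addr0 half_double.
move=> h2 h3.
have : 0 <= t * (h y + eps * enorm ip (y - w) - (h w - ip u (y - w))) by lra.
by rewrite pmulr_rge0 // subr_ge0.
Qed.

Lemma convex_subgradient_subdiff (f : E -> R) w u :
  (forall y, f w + ip u (y - w) <= f y) -> subdiff ip f w u.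
Proof.
move=> h; split => //; exists (fun=> w), (fun=> u); split; try exact: cvg_cst.
move=> _; apply/regular_subdiff_EFin => eps eps0.
apply: nearW => y; apply: le_trans (h y).
by rewrite lerD2l gerBl mulr_ge0 // ?enorm_ge0 // ltW.
Qed.

Hypothesis ip_cvg : forall (u v : nat -> E) a b, u @ \oo --> a ->
  v @ \oo --> b -> (fun k => ip (u k) (v k)) @ \oo --> ip a b.

Lemma convex_subdiff_ineq (f : E -> R) w u : convexf f -> subdiff ip f w u ->
  forall y, f w + ip u (y - w) <= f y.
Proof.
move=> cf [_ [w_ [u_ [ww fw uu hr]]]] y.
apply: (@cvg_to_le _ _ \oo _
  (fun k => f (w_ k) + ip (u_ k) (y - w_ k)) (fun=> f y)).
- apply: cvgD; first by have /fine_cvgP[_] := fw.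
  by apply: ip_cvg => //; apply: cvgB => //; exact: cvg_cst.
- exact: cvg_cst.
- by apply: nearW => k; exact: convex_regular_subgradient.
Qed.

Lemma concave_subdiff_ineq (h : E -> R) w u : convexf h ->
  subdiff ip (fun x => - h x) w u -> forall y, h w - ip u (y - w) <= h y.
Proof.
move=> ch [_ [w_ [u_ [ww fw uu hr]]]] y.
apply: (@cvg_to_le _ _ \oo _
  (fun k => h (w_ k) - ip (u_ k) (y - w_ k)) (fun=> h y)).
- apply: cvgB.
    have /fine_cvgP[_ /cvgN] := fw; rewrite opprK /=.
    by rewrite -[X in _ -> _ --> X](opprK (h w)).
  by apply: ip_cvg => //; apply: cvgB => //; exact: cvg_cst.
- exact: cvg_cst.
- by apply: nearW => k; exact: concave_regular_subgradient.
Qed.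

(** The limit is reached by a diagonal sequence of regular subgradients, where
    continuity of [f] supplies the convergence of the values. *)
Lemma subdiff_closed (T : Type) (G : set_system T) (PG : ProperFilter G)
  (f : E -> R) (x u : T -> E) (xb ub : E) :
  {for xb, continuous f} -> x @ G --> xb -> u @ G --> ub ->
  (\forall k \near G, subdiff ip f (x k) (u k)) -> subdiff ip f xb ub.
Proof.
move=> fc xx uu hs.
have ex n : exists p : E * E, [/\ regular_subdiff ip (fun x => (f x)%:E) p.1 p.2,
    `|xb - p.1| < n.+1%:R^-1 & `|ub - p.2| < n.+1%:R^-1].
  have n0 : (0 : R) < n.+1%:R^-1 / 2 by rewrite divr_gt0 // invr_gt0.
  have /cvgrPdist_lt/(_ _ n0) h1 := xx.
  have /cvgrPdist_lt/(_ _ n0) h2 := uu.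
  have [k [[k1 k2] [_ [w_ [u_ [ww _ uu' hr]]]]]] :=
    filter_ex (filterI (filterI h1 h2) hs).
  have /cvgrPdist_lt/(_ _ n0) h3 := ww.
  have /cvgrPdist_lt/(_ _ n0) h4 := uu'.
  have [j [j3 j4]] := filter_ex (filterI h3 h4).
  exists (w_ j, u_ j); split => //=.
    have -> : xb - w_ j = (xb - x k) + (x k - w_ j) by rewrite addrA subrK.
    by rewrite (le_lt_trans (ler_normD _ _)) // (splitr n.+1%:R^-1) ltrD.
  have -> : ub - u_ j = (ub - u k) + (u k - u_ j) by rewrite addrA subrK.
  by rewrite (le_lt_trans (ler_normD _ _)) // (splitr n.+1%:R^-1) ltrD.
pose p n := projT1 (cid (ex n)).
have hp n : [/\ regular_subdiff ip (fun x => (f x)%:E) (p n).1 (p n).2,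
    `|xb - (p n).1| < n.+1%:R^-1 & `|ub - (p n).2| < n.+1%:R^-1].
  exact: (projT2 (cid (ex n))).
have c1 : (fun n => (p n).1) @ \oo --> xb.
  apply/cvgrPdist_lt => eps eps0; have := near_infty_natSinv_lt (PosNum eps0).
  by apply: filterS => n /= hn; have [_ h _] := hp n; exact: lt_trans hn.
have c2 : (fun n => (p n).2) @ \oo --> ub.
  apply/cvgrPdist_lt => eps eps0; have := near_infty_natSinv_lt (PosNum eps0).
  by apply: filterS => n /= hn; have [_ _ h] := hp n; exact: lt_trans hn.
split => //; exists (fun n => (p n).1), (fun n => (p n).2); split => //.
  apply: cvg_EFin; first exact: nearW.
  exact: (cvg_comp (fun n => (p n).1) f c1 fc).
by move=> n; have [] := hp n.
Qed.

End Subgradients.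

Section ConvexContinuous.
Context {R : realType} {E : normedModType R} {ip : E -> E -> R}.
Context {n : nat} {e : 'I_n -> E}.
Hypothesis hE : euclidean ip e.
Variable h : E -> R.
Hypothesis ch : convexf h.

Lemma convexf_mid x y : h (2^-1 *: (x + y)) <= 2^-1 * (h x + h y).
Proof.
have := ch x y (t := 2^-1) ltac:(lra) ltac:(lra).
have -> : (1 - 2^-1 : R) = 2^-1 by lra.
by rewrite -scalerDr -mulrDr.
Qed.

(** Induction on the coordinates: halving writes [x + u] as the mean of a point
    on a line through [x] and of a point with one coordinate less, at the price
    of doubling the radius. *)
Lemma convexf_bounded_above (x : E) (r : R) :
  exists B, forall u, `|u| <= r -> h (x + u) <= B.
Proof.
suff [B hB] : exists B, forall c : 'I_n -> R, (forall i, `|c i| <= r) ->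
    h (x + \sum_(i <- enum 'I_n) c i *: e i) <= B.
  exists B => u ur; rewrite (basis_expansion hE u) -big_enum /=.
  by apply: hB => i; exact: le_trans (ip_basis_le hE u i) ur.
elim: (enum _) x r => [|i s IH] x r.
  by exists (h x) => c _; rewrite big_nil addr0.
have [B hB] := IH x (2 * r).
have [B1 hB1] : exists B1, forall c, `|c| <= r -> h (x + (2 * c) *: e i) <= B1.
  have [r0|r0] := leP r 0.
    exists (h x) => c /le_trans/(_ r0); rewrite normr_le0 => /eqP ->.
    by rewrite mulr0 scale0r addr0.
  exists (Num.max (h (x + (2 * r) *: e i)) (h (x - (2 * r) *: e i))) => c cr.
  pose t := (c / r + 1) / 2.
  have crr : `|c / r| <= 1.
    by rewrite normrM normfV (gtr0_norm r0) ler_pdivrMr // mul1r.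
  have [cr1 cr2] : -1 <= c / r /\ c / r <= 1.
    by move: crr; rewrite ler_norml => /andP.
  have t0 : 0 <= t by rewrite /t; lra.
  have t1 : t <= 1 by rewrite /t; lra.
  have := ch (x + (2 * r) *: e i) (x - (2 * r) *: e i) t0 t1.
  have -> : t *: (x + (2 * r) *: e i) + (1 - t) *: (x - (2 * r) *: e i) = x + (2 * c) *: e i.
    rewrite !scalerDr scalerN addrACA -scalerBl -scalerDl (addrC t) subrK.
    by rewrite scale1r scalerA; congr (_ + _ *: _); rewrite /t; field; rewrite gt_eqF.
  move/le_trans; apply.
  set m := Num.max _ _.
  have m1 : h (x + (2 * r) *: e i) <= m by rewrite le_max lexx.
  have m2 : h (x - (2 * r) *: e i) <= m by rewrite le_max lexx orbT.
  nra.
exists (2^-1 * (B1 + B)) => c hc; rewrite big_cons.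
have -> : x + (c i *: e i + \sum_(j <- s) c j *: e j) =
  2^-1 *: ((x + (2 * c i) *: e i) + (x + \sum_(j <- s) (2 * c j) *: e j)).
  rewrite addrACA scalerDr half_double.
  congr (_ + _); rewrite scalerDr scalerA mulrA mulVf ?pnatr_eq0 // mul1r; congr (_ + _).
  rewrite scaler_sumr; apply: eq_bigr => j _.
  by rewrite scalerA mulrA mulVf ?pnatr_eq0 // mul1r.
rewrite (le_trans (convexf_mid _ _)) // ler_wpM2l ?invr_ge0 // lerD //.
  exact: hB1.
apply: hB => j; rewrite normrM ger0_norm // ler_wpM2l //.
Qed.

(** A bound [B] above near [x] gives [h (x + w) - h x <= `|w| * (B - h x)] by
    convexity on a ray, and the same bound at [x - w] gives the reverse
    inequality, since [x] is the midpoint of [x - w] and [x + w]. *)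
Lemma convexf_continuous : continuous h.
Proof.
move=> x; have [B hB] := convexf_bounded_above x 1.
have hxB : h x <= B by rewrite -[x]addr0 hB // normr0.
have key w : `|w| <= 1 -> `|h x - h (x + w)| <= `|w| * (B - h x).
  move=> w1; have [->|w0] := eqVneq w 0.
    by rewrite addr0 subrr !normr0 mul0r.
  have nw : 0 < `|w| by rewrite normr_gt0.
  pose d := `|w|^-1 *: w.
  have wd : w = `|w| *: d by rewrite /d scalerA mulfV ?scale1r // normr_eq0.
  have nd : `|d| <= 1 by rewrite /d normrZ normfV normr_id mulVf // normr_eq0.
  have up s : `|s| <= 1 -> h (x + `|w| *: s) <= h x + `|w| * (B - h x).
    move=> s1; have := ch (x + s) x (ltW nw) w1.
    rewrite convex_comb_shift.
    move/le_trans; apply; have := hB s s1; nra.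
  have h1 := up d nd; rewrite -wd in h1.
  have h2 := up (- d); rewrite normrN scalerN -wd in h2; have {}h2 := h2 nd.
  have h3 := convexf_mid (x + w) (x - w).
  have E0 : 2^-1 *: (x + w + (x - w)) = x.
    by rewrite addrACA subrr addr0 half_double.
  rewrite E0 in h3.
  rewrite ler_norml; apply/andP; split; lra.
apply/cvgrPdist_le => eps eps0.
have B0 : 0 < B - h x + 1 by rewrite ltr_wpDl // subr_ge0.
have d0 : 0 < Num.min 1 (eps / (B - h x + 1)) by rewrite lt_min ltr01 divr_gt0.
near=> y.
have yx : `|x - y| < Num.min 1 (eps / (B - h x + 1)).
  by near: y; apply: cvgr_dist_lt.
have := key (y - x); rewrite (addrC x) subrK (distrC y); move: yx; rewrite lt_min => /andP[y1 y2].
move=> /(_ (ltW y1)) /le_trans; apply.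
move: y2; rewrite ltr_pdivlMr // => y2.
have := normr_ge0 (x - y); nra.
Unshelve. all: by end_near. Qed.

End ConvexContinuous.

(** * Distance to a convex set *)

Section Distance.
Context {R : realType} {E : normedModType R} {N : E -> R} {K : set E}.
Hypotheses (hN : is_norm N) (K0 : K !=set0).
Local Notation dist := (tdist N K).

Let lb (y : E) : lbound [set N (y - u) | u in K] 0.
Proof. by move=> _ [u _ <-]; case: hN. Qed.

Let nonempty_dists (y : E) : [set N (y - u) | u in K] !=set0.
Proof. by case: K0 => u Ku; exists (N (y - u)), u. Qed.

Lemma tdist_ge0 y : 0 <= dist y.
Proof. by apply: lb_le_inf; [exact: nonempty_dists|exact: lb]. Qed.

Lemma tdist_le y u : K u -> dist y <= N (y - u).
Proof. by move=> Ku; apply: ge_inf; [exists 0; exact: lb|exists u]. Qed.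

Lemma tdist_approx y eps : 0 < eps -> exists2 u, K u & N (y - u) < dist y + eps.
Proof.
move=> eps0; have [|_ [u Ku <-] h] := @inf_adherent R [set N (y - u) | u in K] _ eps0.
  by split; [exact: nonempty_dists|exists 0; exact: lb].
by exists u.
Qed.

Lemma tdist_eq0 y : K y -> dist y = 0.
Proof.
move=> Ky; apply/eqP; rewrite eq_le tdist_ge0 andbT (le_trans (tdist_le y Ky)) //.
case: hN => _ _ h _; rewrite subrr -(scale0r (0 : E)) h normr0 mul0r //.
Qed.

Lemma tdist_lip y y' : dist y - dist y' <= N (y - y').
Proof.
apply: (@le_of_le_mul_eps _ _ _ 1) => // eps eps0.
have [u Ku h] := tdist_approx y' eps0.
have := tdist_le y Ku; case: hN => _ _ _ tri.
have := tri (y - y') (y' - u); rewrite addrA subrK; lra.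
Qed.

Lemma tdist_convex : convex_set K -> convexf dist.
Proof.
move=> cK t x y t0 t1; apply: (@le_of_le_mul_eps _ _ _ 1) => // eps eps0.
have [u Ku hu] := tdist_approx x eps0; have [v Kv hv] := tdist_approx y eps0.
have := tdist_le (t *: x + (1 - t) *: y) (convex_setP cK t0 t1 Ku Kv).
case: hN => _ _ hom tri.
have := tri (t *: (x - u)) ((1 - t) *: (y - v)); rewrite !hom !ger0_norm ?subr_ge0 //.
rewrite opprD addrACA -!scalerBr; nra.
Qed.

Lemma tdist_eq0_mem y (c : R) : 0 < c -> (forall y, c * `|y| <= N y) ->
  closed K -> dist y = 0 -> K y.
Proof.
move=> c0 hc Kc d0; apply: Kc => B /nbhs_ballP[r /= r0 rB].
have cr0 : 0 < c * r by rewrite mulr_gt0.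
have [u Ku hu] := tdist_approx y cr0.
exists u; split => //; apply: rB; rewrite -ball_normE /=.
by rewrite -(ltr_pM2l c0) (le_lt_trans (hc _)) // (lt_le_trans hu) // d0 add0r.
Qed.

End Distance.

(** * Submanifolds given by slice charts *)

Lemma diff_remainder (R : realType) (V W : normedModType R) (f : V -> W) (x : V) :
  differentiable f x -> forall eps : R, 0 < eps ->
  \forall y \near x, `|f y - f x - 'd f x (y - x)| <= eps * `|y - x|.
Proof.
move=> df eps eps0.
have h : \forall h \near (0 : V),
    `|(f \o shift x - (cst (f x) + 'd f x)) h| <= eps * `|h|.
  by have /eqaddoP/(_ _ eps0) := diff_locally df.
rewrite (near_shift x 0) in h; apply: filterS h => y /=.
rewrite sub0r /= !fctE /= => h.
by move: h; rewrite subrK opprD addrA.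
Qed.

Lemma diff_near_id (R : realType) (V : normedModType R) (f : V -> V) (x v : V) :
  differentiable f x -> (\forall y \near x, f y = y) -> 'd f x v = v.
Proof.
move=> df fid; rewrite -deriveE // (@near_eq_derive _ _ _ f id) //.
exact: derive_id.
Qed.

Lemma diff_inverse (R : realType) (V W : normedModType R) (f : V -> W)
  (g : W -> V) (x v : V) : differentiable f x -> differentiable g (f x) ->
  (\forall y \near x, g (f y) = y) -> 'd g (f x) ('d f x v) = v.
Proof.
move=> df dg gf.
rewrite -[LHS]/((('d g (f x)) \o ('d f x)) v) -(diff_comp df dg).
by apply: diff_near_id gf; exact: differentiable_comp.
Qed.

Section Submanifold.
Context {R : realType} {E : normedModType R} {ip : E -> E -> R}.
Context {n : nat} {e : 'I_n -> E}.
Hypothesis hE : euclidean ip e.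
Let hip : inner_product ip. Proof. by case: hE. Qed.

(** The residual [l - p] of the projection is orthogonal to [S], hence to the
    limit [l]. *)
Lemma subspace_closed (S : set E) (T : Type) (F : set_system T)
  (PF : ProperFilter F) (u : T -> E) (l : E) : linear_subspace S ->
  u @ F --> l -> (\forall k \near F, S (u k)) -> S l.
Proof.
move=> hS ul Su; have [Sp hp] := projectionP hE l hS.
set p := projection S l in Sp hp.
suff -> : l = p by [].
apply/eqP; rewrite -subr_eq0; apply/eqP/(ip_eq0 hip).
rewrite {2}/GRing.add /= (ipBr hip) (hp p Sp) subr0.
apply/eqP; rewrite eq_le; apply/andP; split.
  apply: (@cvgr_to_le _ F _ _ (fun k => ip (l - p) (u k))).
    by apply: (cvg_ip hE) => //; exact: cvg_cst.
  by apply: filterS Su => k /hp ->.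
apply: (@cvgr_to_ge _ F _ _ (fun k => ip (l - p) (u k))).
  by apply: (cvg_ip hE) => //; exact: cvg_cst.
by apply: filterS Su => k /hp ->.
Qed.

Record slice_chart (M S U V : set E) (Phi Psi : E -> E) : Prop := SliceChart {
  chart_subspace : linear_subspace S;
  chart_openU : open U;
  chart_openV : open V;
  chart_CkPhi : Ck 2 U Phi;
  chart_CkPsi : Ck 2 V Psi;
  chart_PhiK : forall y, U y -> V (Phi y) /\ Psi (Phi y) = y;
  chart_PsiK : forall z, V z -> U (Psi z) /\ Phi (Psi z) = z;
  chart_M : forall y, U y -> (M y <-> S (Phi y))
}.

Section Chart.
Context {M S U V : set E} {Phi Psi : E -> E}.
Hypothesis hc : slice_chart M S U V Phi Psi.

Let dPhi y : U y -> differentiable Phi y.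
Proof. by case: (chart_CkPhi hc) => + _; exact. Qed.
Let dPsi z : V z -> differentiable Psi z.
Proof. by case: (chart_CkPsi hc) => + _; exact. Qed.

Lemma chart_dPhiK y v : U y -> 'd Psi (Phi y) ('d Phi y v) = v.
Proof.
move=> Uy; have [VPy _] := chart_PhiK hc Uy.
apply: diff_inverse; [exact: dPhi|exact: dPsi|].
have := open_nbhs_nbhs (conj (chart_openU hc) Uy).
by apply: filterS => z Uz; have [] := chart_PhiK hc Uz.
Qed.

(** In the chart, the difference quotients of a curve in [M] lie in the closed
    subspace [S]. *)
Lemma tangent_chart_sub y v : U y -> tangent_space M y v -> S ('d Phi y v).
Proof.
move=> Uy [c [c0 hcn c0v]].
have [Mc0 dc0 _] := nbhs_singleton hcn.
have dc : differentiable c 0 by exact/derivable1_diffP.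
have dPc0 : differentiable Phi (c 0) by rewrite c0; exact: dPhi.
have dPc : differentiable (Phi \o c) 0 by exact: differentiable_comp.
have dv : 'd (Phi \o c) 0 1 = 'd Phi y v.
  by rewrite diff_comp //= -derive1E' // c0v c0.
have : (fun h : R => h^-1 *: ((Phi \o c) (h + 0) - (Phi \o c) 0)) @ 0^' --> 'd Phi y v.
  rewrite -dv -derive1E' //; have /derivable1_diffP := dPc.
  have Eh : (fun h : R => h^-1 *: (((Phi \o c) \o shift 0) (h *: 1) - (Phi \o c) 0)) =
            (fun h : R => h^-1 *: ((Phi \o c) (h + 0) - (Phi \o c) 0)).
    by apply/funext => h; rewrite /= [_ *: 1]mulr1.
  by rewrite /derivable Eh.
move=> hlim.
apply: (@subspace_closed S _ (0^' : set_system R) _ _ _ (chart_subspace hc) hlim).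
have hU : \forall t \near (0 : R), U (c t).
  have cc : {for 0, continuous c} by exact: differentiable_continuous.
  by apply: cc; rewrite c0; exact: open_nbhs_nbhs (conj (chart_openU hc) Uy).
have : \forall t \near (0 : R), U (c t) /\ M (c t).
  by near=> t; split; [near: t|have [] : [/\ M (c t), derivable c t 1 & {for t, continuous (c^`())}] by near: t].
move=> hUM.
have : (0^' : set_system R) [set t | U (c t) /\ M (c t)] by rewrite /dnbhs /within /=; apply: filterS hUM.
apply: filterS => t [Ut Mt].
have Sct : S (Phi (c t)) by exact/(chart_M hc Ut).
have Sc0 : S (Phi (c 0)) by rewrite c0; apply/(chart_M hc Uy); rewrite -c0.
have [S0 Sl] := chart_subspace hc.
rewrite addr0 -[X in S X]addr0 /=; apply: (Sl) => //.
by rewrite addrC -scaleN1r; exact: Sl.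
Unshelve. all: by end_near. Qed.

(** The curve [t |-> Psi (Phi y + t w)] lies in [M] and has the given velocity. *)
Lemma tangent_chart_sup y w : U y -> M y -> S w ->
  tangent_space M y ('d Psi (Phi y) w).
Proof.
move=> Uy My Sw; have [VPy PPy] := chart_PhiK hc Uy.
have [S0 Sl] := chart_subspace hc.
have SPy : S (Phi y) by exact/(chart_M hc Uy).
pose l (t : R) := Phi y + t *: w.
have dl t : differentiable l t.
  exact: differentiableD.
have dl1 t : 'd l t 1 = w.
  rewrite -derive1E' // /derive1; apply/cvg_lim => //; apply: cvg_near_cst.
  near=> h; rewrite /l opprD addrACA subrr add0r -scalerBl addrK scalerA.
  by rewrite mulVf ?scale1r //; near: h; exact: nbhs_dnbhs_neq.
have Vl : \forall t \near (0 : R), V (l t).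
  have lc : {for 0, continuous l} by exact: differentiable_continuous.
  apply: lc; rewrite /l scale0r addr0.
  exact: open_nbhs_nbhs (conj (chart_openV hc) VPy).
have dc t : V (l t) -> differentiable (Psi \o l) t.
  by move=> Vt; apply: differentiable_comp => //; exact: dPsi.
have c't t : V (l t) -> (Psi \o l)^`() t = 'd Psi (l t) w.
  by move=> Vt; rewrite (derive1E' (dc t Vt)) (diff_comp (dl t) (dPsi Vt)) /= dl1.
exists (Psi \o l); split.
- by rewrite /l /= scale0r addr0.
- have := nbhs_interior Vl; apply: filterS => t Vit.
  have Vt : V (l t) by exact: (nbhs_singleton Vit).
  have [Uc Pc] := chart_PsiK hc Vt.
  split.
  + apply/(chart_M hc Uc) => /=; rewrite Pc /l addrC.
    exact: Sl.
  + exact/derivable1_diffP/dc.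
  + have cont : {for t, continuous (fun t => 'd Psi (l t) w)}.
      apply: (@continuous_comp _ _ _ l (fun z => 'd Psi z w)).
        exact: differentiable_continuous.
      have [_ /(_ w) [+ _]] := chart_CkPsi hc.
      by move=> /(_ _ Vt) /differentiable_continuous.
    rewrite /prop_for /continuous_at (c't t Vt); apply: cvg_trans cont.
    by apply: near_eq_cvg; apply: filterS Vit => s Vs; rewrite c't.
- by rewrite c't /l scale0r addr0.
Unshelve. all: by end_near. Qed.

Lemma tangent_chartP y v : U y -> M y ->
  tangent_space M y v <-> S ('d Phi y v).
Proof.
move=> Uy My; split; first exact: tangent_chart_sub.
by move=> Sv; rewrite -(chart_dPhiK v Uy); exact: tangent_chart_sup.
Qed.

End Chart.

Lemma slice_chart_at (M : set E) x : embedded_submanifold 2 M -> M x ->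
  exists S U V Phi Psi, slice_chart M S U V Phi Psi /\ U x.
Proof.
move=> [S hS /[apply]] [U [V [Phi [Psi [[? ?] ? ? ? [? ? ?]]]]]].
by exists S, U, V, Phi, Psi.
Qed.

Lemma tangent_subspace (M : set E) x : embedded_submanifold 2 M -> M x ->
  linear_subspace (tangent_space M x).
Proof.
move=> hM Mx; have [S [U [V [Phi [Psi [hc Ux]]]]]] := slice_chart_at hM Mx.
have [S0 Sl] := chart_subspace hc.
split; first by apply/(tangent_chartP hc _ Ux Mx); rewrite linear0.
move=> a u v /(tangent_chartP hc _ Ux Mx) Su /(tangent_chartP hc _ Ux Mx) Sv.
by apply/(tangent_chartP hc _ Ux Mx); rewrite linearP; exact: Sl.
Qed.

(** Tangent vectors extend continuously to nearby base points, through
    [dPsi (Phi y)]; hence the normal bundle is closed. *)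
Lemma normal_vectors_closed (M : set E) (T : Type) (G : set_system T)
  (PG : ProperFilter G) (x s tau : T -> E) xb sb :
  embedded_submanifold 2 M -> M xb -> x @ G --> xb -> s @ G --> sb ->
  tau @ G --> 0 ->
  (\forall k \near G, M (x k) /\
     forall v, tangent_space M (x k) v -> ip (s k) v = ip (tau k) v) ->
  normal_vectors ip M xb sb.
Proof.
move=> hM Mxb xx ss tt hs v Tv.
have [S [U [V [Phi [Psi [hc Ux]]]]]] := slice_chart_at hM Mxb.
pose w := 'd Phi xb v; pose vk k := 'd Psi (Phi (x k)) w.
have Sw : S w by exact: (tangent_chart_sub hc Ux Tv).
have Uxk : \forall k \near G, U (x k).
  by apply: xx; exact: open_nbhs_nbhs (conj (chart_openU hc) Ux).
have vv : vk @ G --> v.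
  rewrite -[v](chart_dPhiK hc v Ux) -/w.
  have cP : {for xb, continuous Phi}.
    by apply: differentiable_continuous; case: (chart_CkPhi hc) => + _; exact.
  have cd : {for Phi xb, continuous (fun z => 'd Psi z w)}.
    have [_ /(_ w) [+ _]] := chart_CkPsi hc.
    have [VP _] := chart_PhiK hc Ux.
    by move=> /(_ _ VP) /differentiable_continuous.
  apply: (cvg_comp (Phi \o x) (fun z => 'd Psi z w)); last exact: cd.
  exact: (cvg_comp x Phi xx cP).
have l1 : (fun k => ip (s k) (vk k)) @ G --> ip sb v by exact: (cvg_ip hE).
have l2 : (fun k => ip (tau k) (vk k)) @ G --> ip 0 v by exact: (cvg_ip hE).
rewrite (ip0l hip) in l2.
have eq : \forall k \near G, ip (s k) (vk k) = ip (tau k) (vk k).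
  near=> k; have [Mk hk] : M (x k) /\
     forall v, tangent_space M (x k) v -> ip (s k) v = ip (tau k) v by near: k.
  by apply: hk; apply: (tangent_chart_sup hc) => //; near: k.
apply/le_anti/andP; split; [apply: (cvg_to_le PG l1 l2)|apply: (cvg_to_le PG l2 l1)].
  by apply: filterS eq => k ->.
by apply: filterS eq => k ->.
Unshelve. all: by end_near. Qed.

(** Differentiating [lambda (dPhi x' v') = 0] along the tangent bundle, where
    [lambda w = ip nu (dPsi (Phi x) w)] vanishes on the model subspace, produces
    the normal vector [(B, nu)]; the base component [B] carries one derivative
    of [dPhi] applied to [v], whence the factor [`|v|]. *)
Lemma tangent_bundle_normal (M : set E) xb : embedded_submanifold 2 M -> M xb ->
  exists C : R, 0 <= C /\ \forall x \near xb, M x ->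
    forall v nu, tangent_space M x v -> normal_vectors ip M x nu ->
    (forall eps, 0 < eps -> \forall x' \near x, M x' ->
       `|ip nu (x' - x)| <= eps * `|x' - x|) /\
    exists B, `|B| <= C * `|nu| * `|v| /\
      forall eps, 0 < eps -> \forall xv \near (x, v), tangent_bundle M xv ->
        `|ip B (xv.1 - x) + ip nu (xv.2 - v)|
          <= eps * (`|xv.1 - x| + `|xv.2 - v|).
Proof.
move=> hM Mxb.
have [S [U [V [Phi [Psi [hc Uxb]]]]]] := slice_chart_at hM Mxb.
have [dPhi ddPhi] := chart_CkPhi hc; have [dPsi ddPsi] := chart_CkPsi hc.
(* The [D j] are the columns of the Jacobian of [Phi]; [Lam] bounds that of [Psi]
   and [Gam] the second derivative of [Phi]. *)
pose D (j : 'I_n) y := 'd Phi y (e j).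
pose Lam x := \sum_i `|'d Psi (Phi x) (e i)|.
pose Gam x := \sum_j \sum_i `|'d (D j) x (e i)|.
have Lam0 x : 0 <= Lam x by exact: sumr_ge0.
have Gam0 x : 0 <= Gam x by apply: sumr_ge0 => j _; exact: sumr_ge0.
have cLam : {for xb, continuous Lam}.
  apply: cvg_big => [|i _]; first exact: add_continuous.
  apply: cvg_norm.
  apply: (@cvg_comp _ _ _ Phi (fun z => 'd Psi z (e i)) _ (nbhs (Phi xb))).
    exact: differentiable_continuous (dPhi _ Uxb).
  have [VP _] := chart_PhiK hc Uxb.
  by have [+ _] := ddPsi (e i) => /(_ _ VP) /differentiable_continuous.
have cGam : {for xb, continuous Gam}.
  apply: cvg_big => [|j _]; first exact: add_continuous.
  apply: cvg_big => [|i _]; first exact: add_continuous.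
  by apply: cvg_norm; have [_ /(_ (e i)) /(_ _ Uxb)] := ddPhi (e j).
have cLG : (fun x => Lam x * Gam x) @ xb --> Lam xb * Gam xb by exact: cvgM.
exists (Lam xb * Gam xb + 1); split; first by rewrite addr_ge0 // mulr_ge0.
have Unear : \forall x \near xb, U x.
  exact: open_nbhs_nbhs (conj (chart_openU hc) Uxb).
have bnd : \forall x \near xb, Lam x * Gam x <= Lam xb * Gam xb + 1.
  have /cvgrPdist_le/(_ 1 ltr01) := cLG; apply: filterS => x.
  by rewrite distrC => /(le_trans (ler_norm _)); lra.
near=> x.
have Ux : U x by near: x.
have hbx : Lam x * Gam x <= Lam xb * Gam xb + 1 by near: x.
move=> Mx v nu Tv Nnu.
pose lam w := ip nu ('d Psi (Phi x) w).
have lamD a u w : lam (a *: u + w) = a * lam u + lam w.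
  by rewrite /lam linearP (ipDr hip) (ipZr hip).
have lamZ a u : lam (a *: u) = a * lam u by rewrite /lam linearZ (ipZr hip).
have lamB u w : lam (u - w) = lam u - lam w by rewrite /lam linearB (ipBr hip).
have lam_sum (I : finType) (F : I -> E) : lam (\sum_i F i) = \sum_i lam (F i).
  by rewrite /lam linear_sum (ip_sumr hip).
have lamS w : S w -> lam w = 0.
  by move=> Sw; rewrite /lam; apply: Nnu; exact: (tangent_chart_sup hc).
have lam_dPhi w : lam ('d Phi x w) = ip nu w by rewrite /lam (chart_dPhiK hc).
have lam_le w : `|lam w| <= `|nu| * Lam x * `|w|.
  rewrite /lam (le_trans (normr_ip hE _ _)) // -mulrA ler_wpM2l //.
  exact: (linear_bounded_basis hE).
have [S0 Sl] := chart_subspace hc.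
have SB u w : S u -> S w -> S (u - w).
  by move=> Su Sw; rewrite addrC -scaleN1r; exact: Sl.
pose c := `|nu| * Lam x.
have c0 : 0 <= c by rewrite mulr_ge0.
split.
  move=> eps eps0.
  have e'0 : 0 < eps / (c + 1) by rewrite divr_gt0 // ltr_wpDl.
  have Ux' : \forall x' \near x, U x'.
    exact: open_nbhs_nbhs (conj (chart_openU hc) Ux).
  near=> x' => Mx'.
  have Ux'' : U x' by near: x'.
  have h : `|Phi x' - Phi x - 'd Phi x (x' - x)| <= eps / (c + 1) * `|x' - x|.
    by near: x'; exact: diff_remainder (dPhi _ Ux) _ e'0.
  have SP : lam (Phi x' - Phi x) = 0.
    by apply/lamS/SB; [apply/(chart_M hc Ux'')|apply/(chart_M hc Ux)].
  have -> : ip nu (x' - x) = - lam (Phi x' - Phi x - 'd Phi x (x' - x)).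
    by rewrite lamB SP lam_dPhi sub0r opprK.
  rewrite normrN (le_trans (lam_le _)) //.
  rewrite (le_trans (ler_wpM2l c0 h)) // mulrA ler_wpM2r //.
  rewrite mulrCA ler_piMr ?(ltW eps0) // ler_pdivrMr ?ltr_wpDl // mul1r.
  by rewrite lerDl.
pose coef j := ip v (e j).
pose fB w := \sum_j coef j * lam ('d (D j) x w).
have [B hB] : exists B, forall w, ip B w = fB w.
  apply: (riesz hE) => a u w; rewrite /fB mulr_sumr -big_split /=.
  by apply: eq_bigr => j _; rewrite linearP lamD; ring.
exists B; split.
  have hfB w : fB w <= `|nu| * `|v| * (Lam x * Gam x) * `|w|.
    rewrite (le_trans (ler_norm _)) // (le_trans (ler_norm_sum _ _ _)) //.
    have -> : `|nu| * `|v| * (Lam x * Gam x) * `|w| =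
       \sum_j `|v| * (`|nu| * Lam x * ((\sum_i `|'d (D j) x (e i)|) * `|w|)).
      rewrite -!mulr_sumr -mulr_suml -/(Gam x); ring.
    apply: ler_sum => j _; rewrite normrM ler_pM // ?(ip_basis_le hE) //.
    rewrite (le_trans (lam_le _)) // ler_wpM2l //.
    exact: (linear_bounded_basis hE).
  have [->|B0] := eqVneq B 0; first by rewrite normr0 !mulr_ge0 // addr_ge0 // mulr_ge0.
  have nB : 0 < `|B| by rewrite normr_gt0.
  rewrite -(ler_pM2r nB) -expr2 (norm_sqr_ip hE) hB (le_trans (hfB _)) //.
  rewrite ler_wpM2r // -!mulrA (mulrC _ (`|nu| * _)) mulrA ler_wpM2l //.
move=> eps eps0.
(* [K] dominates the coefficients [c * n * `|v|] and [c * n] of the two error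
   terms of the product rule below. *)
pose K := c * n%:R * (`|v| + 1) + 1.
have K0 : 0 < K by rewrite ltr_wpDl // !mulr_ge0 // addr_ge0.
have e'0 : 0 < eps / K by rewrite divr_gt0.
have near1 : \forall x' \near x, [/\ U x',
    forall j, `|D j x' - D j x - 'd (D j) x (x' - x)| <= eps / K * `|x' - x|
  & forall j, `|D j x' - D j x| <= eps / K].
  have Ux' : \forall x' \near x, U x'.
    exact: open_nbhs_nbhs (conj (chart_openU hc) Ux).
  have h1 : \forall x' \near x, forall j,
      `|D j x' - D j x - 'd (D j) x (x' - x)| <= eps / K * `|x' - x|.
    apply: filter_forall => j; apply: diff_remainder => //.
    by have [/(_ _ Ux)] := ddPhi (e j).
  have h2 : \forall x' \near x, forall j, `|D j x' - D j x| <= eps / K.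
    apply: filter_forall => j.
    have [/(_ _ Ux) /differentiable_continuous + _] := ddPhi (e j).
    by move=> /cvgrPdist_le/(_ _ e'0); apply: filterS => x'; rewrite distrC.
  by near=> x'; split; near: x'.
have near2 : \forall xv \near (x, v), [/\ U xv.1,
    forall j, `|D j xv.1 - D j x - 'd (D j) x (xv.1 - x)| <= eps / K * `|xv.1 - x|
  & forall j, `|D j xv.1 - D j x| <= eps / K].
  by exists ([set x' | [/\ U x',
    forall j, `|D j x' - D j x - 'd (D j) x (x' - x)| <= eps / K * `|x' - x|
    & forall j, `|D j x' - D j x| <= eps / K]], setT);
    [split => //; exact: filterT|move=> [x' v'] []].
apply: filterS near2 => -[x' v'] /= [Ux' h1 h2] [/= Mx' Tv'].
have dPhiE y w : 'd Phi y w = \sum_j ip w (e j) *: D j y.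
  rewrite {1}(basis_expansion hE w) linear_sum.
  by apply: eq_bigr => j _; rewrite linearZ.
have z1 : lam ('d Phi x' v' - 'd Phi x v) = 0.
  by apply/lamS/SB; exact: (tangent_chart_sub hc).
have key : ip B (x' - x) + ip nu (v' - v) =
  - (\sum_j coef j * lam (D j x' - D j x - 'd (D j) x (x' - x))
   + \sum_j ip (v' - v) (e j) * lam (D j x' - D j x)).
  rewrite hB /fB -lam_dPhi; apply/eqP; rewrite -subr_eq0 opprK; apply/eqP.
  rewrite -[RHS]z1 !dPhiE !lamB !lam_sum.
  rewrite addrACA -big_split -!sumrB -!big_split /=; apply: eq_bigr => j _.
  rewrite !(lamB, lamZ) (ipBl hip) /coef; ring.
rewrite key normrN (le_trans (ler_normD _ _)) //.
have b1 : `|\sum_j coef j * lam (D j x' - D j x - 'd (D j) x (x' - x))|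
    <= c * n%:R * `|v| * (eps / K) * `|x' - x|.
  have -> : c * n%:R * `|v| * (eps / K) * `|x' - x| =
     \sum_(j < n) `|v| * (c * (eps / K * `|x' - x|)).
    rewrite sumr_const card_ord -mulr_natr; ring.
  rewrite (le_trans (ler_norm_sum _ _ _)) // ler_sum // => j _.
  rewrite normrM ler_pM // ?(ip_basis_le hE) //.
  by rewrite (le_trans (lam_le _)) // ler_wpM2l.
have b2 : `|\sum_j ip (v' - v) (e j) * lam (D j x' - D j x)|
    <= c * n%:R * (eps / K) * `|v' - v|.
  have -> : c * n%:R * (eps / K) * `|v' - v| =
     \sum_(j < n) `|v' - v| * (c * (eps / K)).
    rewrite sumr_const card_ord -mulr_natr; ring.
  rewrite (le_trans (ler_norm_sum _ _ _)) // ler_sum // => j _.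
  rewrite normrM ler_pM // ?(ip_basis_le hE) //.
  by rewrite (le_trans (lam_le _)) // ler_wpM2l.
have cn0 : 0 <= c * n%:R by rewrite mulr_ge0.
have k1 : c * n%:R * `|v| * (eps / K) <= eps.
  rewrite mulrCA ler_piMr ?(ltW eps0) // ler_pdivrMr // mul1r /K.
  have := normr_ge0 v; nra.
have k2 : c * n%:R * (eps / K) <= eps.
  rewrite mulrCA ler_piMr ?(ltW eps0) // ler_pdivrMr // mul1r /K.
  have := normr_ge0 v; nra.
rewrite mulrDr lerD //.
  by rewrite (le_trans b1) // ler_wpM2r.
by rewrite (le_trans b2) // ler_wpM2r.
Unshelve. all: by end_near. Qed.

End Submanifold.

(** * Descent estimates along an inexact step *)

(** The mean value theorem for [phi] minus its tangent and the parabola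
    [c / 2 * t ^ 2]. *)
Lemma quadratic_upper_bound (R : realType) (phi dphi : R -> R) (c : R) :
  (forall t : R, 0 <= t -> t <= 1 -> is_derive t 1 phi (dphi t)) ->
  (forall t : R, 0 <= t -> t <= 1 -> dphi t - dphi 0 <= c * t) ->
  phi 1 - phi 0 - dphi 0 <= c / 2.
Proof.
move=> dp hc.
pose s t := phi t - dphi 0 * t - c / 2 * (t * t).
pose ds t := dphi t - dphi 0 - c * t.
have der (t : R) : 0 <= t -> t <= 1 -> is_derive t 1 s (ds t).
  move=> t0 t1; have Dp := dp t t0 t1.
  have -> : s = phi - (dphi 0 *: id) - (c / 2) *: (id * id) by apply/funext.
  apply: is_derive_eq.
  rewrite /ds /=.
  by rewrite /GRing.scale /=; field.
have [||t /[!in_itv]/= /andP[t0 t1]] := @MVT _ s ds 0 1 ltr01.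
- by move=> t /[!in_itv]/= /andP[t0 t1]; apply: der; exact: ltW.
- apply: derivable_within_continuous => t /[!in_itv]/= /andP[t0 t1].
  by have [] := der t t0 t1.
rewrite /s /ds => hs; have := hc t (ltW t0) (ltW t1); lra.
Qed.

Lemma cauchy_schwarz2 (R : realType) (a b c d : R) :
  a * c + b * d <= Num.sqrt (a ^+ 2 + b ^+ 2) * Num.sqrt (c ^+ 2 + d ^+ 2).
Proof.
rewrite -sqrtrM ?addr_ge0 ?sqr_ge0 //.
have [h|h] := leP (a * c + b * d) 0; first by rewrite (le_trans h) // sqrtr_ge0.
rewrite -[leLHS]ger0_norm ?(ltW h) // -sqrtr_sqr ler_wsqrtr //.
have := sqr_ge0 (a * d - b * c); nra.
Qed.

Lemma is_derive_line (R : realType) (V W : normedModType R) (f : V -> W)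
  (x v : V) (t : R) : differentiable f (x + t *: v) ->
  is_derive t 1 (fun s : R => f (x + s *: v)) ('d f (x + t *: v) v).
Proof.
move=> df.
pose l (s : R) := x + s *: v.
have dl : differentiable l t by exact: differentiableD.
have dl1 : 'd l t 1 = v.
  rewrite -derive1E' // /derive1; apply/cvg_lim => //; apply: cvg_near_cst.
  near=> h; rewrite /l opprD addrACA subrr add0r -scalerBl addrK scalerA.
  by rewrite mulVf ?scale1r //; near: h; exact: nbhs_dnbhs_neq.
have dfl : differentiable (f \o l) t by exact: differentiable_comp.
have -> : (fun s : R => f (x + s *: v)) = f \o l by [].
have -> : 'd f (x + t *: v) v = 'd (f \o l) t 1.
  by rewrite (diff_comp dl df) /= dl1.
by rewrite -deriveE //; apply/derivableP/derivable1_diffP.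
Unshelve. all: by end_near. Qed.

Section LinearForms.
Context {R : realType} {E : normedModType R} {ip : E -> E -> R}.
Context {n : nat} {e : 'I_n -> E}.
Hypothesis hE : euclidean ip e.
Let hip : inner_product ip. Proof. by case: hE. Qed.

Lemma diff_ip (F : normedModType R) (a : E) (g : F -> E) (x : F) :
  differentiable g x ->
  differentiable (fun y => ip a (g y) : R^o) x /\
  forall v, 'd (fun y => ip a (g y) : R^o) x v = ip a ('d g x v).
Proof.
move=> dg.
have lin : linear (fun v => ip a v : R^o).
  by move=> k u v; rewrite (ipDr hip) (ipZr hip).
pose L : {linear E -> R^o} := HB.pack (fun v => ip a v : R^o)
  (GRing.isLinear.Build _ _ _ _ _ lin).
have cL : continuous L by exact: (cvg_linear hE).
have dL : differentiable L (g x) by exact: linear_differentiable.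
have -> : (fun y => ip a (g y) : R^o) = L \o g by [].
split; first exact: differentiable_comp.
move=> v; have -> : 'd (L \o g) x v = 'd L (g x) ('d g x v).
  by rewrite (diff_comp dg dL).
by rewrite diff_lin.
Qed.

Lemma gradient_affine (a : E) (c : R) v :
  gradient ip (fun v => ip a v + c) v = a.
Proof.
apply: (eq_from_ip hip) => w; rewrite (gradientP hE).
have [dl dE] := @diff_ip E a id v ltac:(done).
have -> : (fun v => ip a v + c) = (fun v => ip a v : R^o) + cst c by [].
by rewrite diffD //= diff_cst /= addr0 dE diff_near_id //; exact: nearW.
Qed.

Lemma descent (f : E -> R) (x v : E) (L : R) :
  (forall t : R, 0 <= t -> t <= 1 -> differentiable (f : E -> R^o) (x + t *: v)) ->
  (forall t : R, 0 <= t -> t <= 1 ->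
    `|gradient ip f (x + t *: v) - gradient ip f x| <= L * (t * `|v|)) ->
  f (x + v) - f x - ip (gradient ip f x) v <= L / 2 * `|v| ^+ 2.
Proof.
move=> df hL.
have := @quadratic_upper_bound R (fun t => f (x + t *: v))
  (fun t => ip (gradient ip f (x + t *: v)) v) (L * `|v| ^+ 2).
rewrite scale1r scale0r addr0 mulrAC; apply.
  move=> t t0 t1; rewrite (gradientP hE).
  exact: (@is_derive_line _ E R^o f x v t (df t t0 t1)).
move=> t t0 t1; rewrite -(ipBl hip) (le_trans (ip_le_norm hE _ _)) //.
have := hL t t0 t1; have := normr_ge0 v => v0 h.
rewrite (le_trans (ler_wpM2r v0 h)) //.
by rewrite le_eqVlt; apply/orP; left; apply/eqP; ring.
Qed.

End LinearForms.

(** The Lipschitz bound is on the adjoint of the Jacobian, so the remainder [r]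
    is measured by pairing it with itself, which reduces to the scalar case
    [t |-> <r, g (x + t v)>]. *)
Lemma jacobian_remainder (R : realType) (E F : normedModType R)
  (ipE : E -> E -> R) (ipF : F -> F -> R) (n m : nat) (e : 'I_n -> E)
  (d : 'I_m -> F) (hE : euclidean ipE e) (hF : euclidean ipF d)
  (g : E -> F) (x v : E) (L : R) : 0 <= L ->
  (forall t : R, 0 <= t -> t <= 1 -> differentiable g (x + t *: v)) ->
  (forall t : R, 0 <= t -> t <= 1 -> forall u,
    `|adjoint ipE ipF ('d g (x + t *: v)) u - adjoint ipE ipF ('d g x) u|
       <= L * (t * `|v|) * `|u|) ->
  `|g (x + v) - g x - 'd g x v| <= L / 2 * `|v| ^+ 2.
Proof.
move=> L0 dg hL.
have [hip hipF] : inner_product ipE /\ inner_product ipF.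
  by split; [case: hE|case: hF].
set r := g (x + v) - g x - 'd g x v.
have [->|r0] := eqVneq r 0; first by rewrite normr0 mulr_ge0 // ?divr_ge0 // sqr_ge0.
have nr : 0 < `|r| by rewrite normr_gt0.
rewrite -(ler_pM2r nr) -expr2 (norm_sqr_ip hF) {2}/r !(ipBr hipF).
have := @quadratic_upper_bound R (fun t => ipF r (g (x + t *: v)))
  (fun t => ipE (adjoint ipE ipF ('d g (x + t *: v)) r) v) (L * `|v| ^+ 2 * `|r|).
rewrite scale1r scale0r addr0 -(adjointP hE hipF ('d g x)) => H.
rewrite (le_trans (H _ _)) //; last by rewrite mulrAC [L / 2 * _]mulrAC.
  move=> t t0 t1; rewrite (adjointP hE hipF).
  have [dc <-] := diff_ip hF r (dg t t0 t1).
  exact: (@is_derive_line _ E R^o (fun y => ipF r (g y)) x v t dc).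
move=> t t0 t1; rewrite -(ipBl hip) (le_trans (ip_le_norm hE _ _)) //.
have := hL t t0 t1 r; have := normr_ge0 v => v0 h.
rewrite (le_trans (ler_wpM2r v0 h)) //.
by rewrite le_eqVlt; apply/orP; left; apply/eqP; ring.
Qed.

(** * The data of the problem *)

Section Problem.
Context {R : realType} {X Y : normedModType R}.
Context {ipX : X -> X -> R} {ipY : Y -> Y -> R}.
Context {p q : nat} {e : 'I_p -> X} {d : 'I_q -> Y}.
Hypotheses (heX : euclidean ipX e) (heY : euclidean ipY d).
Context {P : problem X Y}.
Hypothesis hP : standing_assumptions ipX P.

Local Notation M := (pM P).
Local Notation K := (pK P).
Local Notation f := (pf P).
Local Notation vt := (pvt P).
Local Notation h := (ph P).
Local Notation g := (pg P).
Local Notation dist := (tdist (ptn P) (pK P)).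
Local Notation ipZ := (ipZ ipX ipY).
Local Notation adjJ := (adjJ ipX ipY P).

Lemma innerX : inner_product ipX. Proof. by case: heX. Qed.
Lemma innerY : inner_product ipY. Proof. by case: heY. Qed.
Lemma innerZ : inner_product ipZ.
Proof. exact: ip_prod_inner innerX innerY. Qed.

Lemma norm_fst_le (z : X * Y) : `|z.1| <= enorm ipZ z.
Proof. by rewrite (euclid_norm heX); exact: enorm_fst innerY z. Qed.

Lemma norm_snd_le (z : X * Y) : `|z.2| <= enorm ipZ z.
Proof. by rewrite (euclid_norm heY); exact: enorm_snd innerX z. Qed.

Lemma enormZ_sqrt (z : X * Y) : enorm ipZ z = Num.sqrt (`|z.1| ^+ 2 + `|z.2| ^+ 2).
Proof. by rewrite (norm_sqr_ip heX) (norm_sqr_ip heY). Qed.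

Lemma cvg_ipZ (T : Type) (F : set_system T) (FF : Filter F) (u v : T -> X * Y)
  (a b : X * Y) :
  u @ F --> a -> v @ F --> b -> (fun k => ipZ (u k) (v k)) @ F --> ipZ a b.
Proof.
move=> ua vb.
have ua1 : (fun k => (u k).1) @ F --> a.1 by apply: (cvg_comp u fst ua); exact: cvg_fst.
have ua2 : (fun k => (u k).2) @ F --> a.2 by apply: (cvg_comp u snd ua); exact: cvg_snd.
have vb1 : (fun k => (v k).1) @ F --> b.1 by apply: (cvg_comp v fst vb); exact: cvg_fst.
have vb2 : (fun k => (v k).2) @ F --> b.2 by apply: (cvg_comp v snd vb); exact: cvg_snd.
by apply: cvgD; [exact: (cvg_ip heX)|exact: (cvg_ip heY)].
Qed.

Lemma adjJP x y v : ipX (adjJ x y) v = ipY y ('d g x v).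
Proof. exact: adjointP heX innerY _ _ _. Qed.

Lemma adjGP x xi v : ipX (adjG ipX ipY P x xi) v = ipX xi.1 v + ipY xi.2 ('d g x v).
Proof. by rewrite /adjG (ipDl innerX) adjJP. Qed.

Lemma ptn_norm : is_norm (ptn P). Proof. by case: hP. Qed.
Lemma K_nonempty : K !=set0.
Proof. by case: hP => _ _ _ _ [_ _ [x [Kgx _]]]; exists (g x). Qed.
Lemma K_convex : convex_set K. Proof. by case: hP => _ [_ ?]. Qed.
Lemma vt_convex : convexf vt.
Proof. by case: hP => _ _ _ _ [/convex_functionP]. Qed.
Lemma h_convex : convexf h.
Proof. by case: hP => _ _ _ _ [_ /convex_functionP]. Qed.

Lemma dist_ge0 y : 0 <= dist y.
Proof. exact: tdist_ge0 ptn_norm K_nonempty y. Qed.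

Lemma psi_convex rho : 0 <= rho -> convexf (psi P rho).
Proof.
move=> rho0 t z w t0 t1; rewrite /psi /=.
have h1 := vt_convex z.1 w.1 t0 t1.
have h2 := tdist_convex ptn_norm K_nonempty K_convex z.2 w.2 t0 t1.
have := ler_wpM2l rho0 h2; lra.
Qed.

Lemma psi_subgradient rho z xi : 0 <= rho -> subdiff ipZ (psi P rho) z xi ->
  forall w, psi P rho z + ipZ xi (w - z) <= psi P rho w.
Proof.
move=> rho0; apply: (convex_subdiff_ineq innerZ).
  by move=> u v a b; exact: cvg_ipZ.
exact: psi_convex.
Qed.

Lemma zeta_subgradient x zeta : subdiff ipX (fun u => - h u) x zeta ->
  forall y, h x - ipX zeta (y - x) <= h y.
Proof.
apply: (concave_subdiff_ineq innerX); last exact: h_convex.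
by move=> u v a b; exact: (cvg_ip heX).
Qed.

Lemma gradient_ell x zeta v :
  gradient ipX (ell ipX P x zeta) v = gradient ipX f x + zeta.
Proof.
rewrite /ell -[RHS](gradient_affine heX _ (f x - h x) v); congr (gradient _ _ _).
by apply/funext => u; rewrite addrA.
Qed.

End Problem.

(** * Subgradients of the potential *)

(** The norm of a product space is the sup norm, so the continuity of the
    Euclidean norm of the space [W] is built factor by factor. *)
Definition enorm_cont (R : realType) (E : normedModType R) (ip : E -> E -> R) :=
  forall w : E, enorm ip (w' - w) @[w' --> w] --> (0 : R).

Lemma enorm_cont_euclid (R : realType) (E : normedModType R) (ip : E -> E -> R)
  n (e : 'I_n -> E) : euclidean ip e -> enorm_cont ip.
Proof.
move=> hE w; rewrite -(@normr0 R E) -(subrr w).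
rewrite (_ : (fun w' => _) = fun w' => `|w' - w|); last first.
  by apply/funext => w'; rewrite (euclid_norm hE).
by apply: cvg_norm; apply: cvgB; [exact: cvg_id|exact: cvg_cst].
Qed.

Lemma enorm_cont_frobenius (R : realType) m n : enorm_cont (@ip_frobenius R m n).
Proof.
move=> Q; rewrite -(@sqrtr0 R).
apply: (cvg_comp (fun Q' => ip_frobenius (Q' - Q) (Q' - Q)) Num.sqrt);
  last exact: sqrt_continuous.
have -> : (0 : R) = \sum_(i < m) \sum_(j < n) (Q i j - Q i j) * (Q i j - Q i j).
  by rewrite big1 // => i _; rewrite big1 // => j _; rewrite subrr mulr0.
rewrite (_ : (fun Q' => _) = fun Q' : 'M[R]_(m, n) =>
  \sum_i \sum_j (Q' i j - Q i j) * (Q' i j - Q i j)); last first.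
  apply/funext => Q'; rewrite ip_frobeniusE; apply: eq_bigr => i _.
  by apply: eq_bigr => j _; rewrite !mxE.
have gen (T : Type) (F : set_system T) (FF : Filter F) (u : T -> 'M[R]_(m, n)) :
    (forall i j, (fun t => u t i j) @ F --> Q i j) ->
    (fun t => \sum_i \sum_j (u t i j - Q i j) * (u t i j - Q i j)) @ F -->
    \sum_(i < m) \sum_(j < n) (Q i j - Q i j) * (Q i j - Q i j).
  move=> hu.
  apply: cvg_big => [|i _]; first exact: add_continuous.
  apply: cvg_big => [|j _]; first exact: add_continuous.
  have c : (fun t => u t i j - Q i j) @ F --> Q i j - Q i j.
    by apply: cvgB; [exact: hu|exact: cvg_cst].
  exact: cvgM.
by apply: (gen _ (nbhs Q) _ id) => i j; exact: coord_continuous.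
Qed.

Lemma enorm_cont_prod (R : realType) (E F : normedModType R)
  (ipE : E -> E -> R) (ipF : F -> F -> R) :
  inner_product ipE -> inner_product ipF -> enorm_cont ipE -> enorm_cont ipF ->
  enorm_cont (ip_prod ipE ipF).
Proof.
move=> hE hF cE cF w.
apply: (@squeeze_cvgr _ _ _ _ (fun=> 0)
  (fun w' => enorm ipE (w'.1 - w.1) + enorm ipF (w'.2 - w.2))).
- apply: nearW => w'; rewrite enorm_ge0 /=.
  exact: enorm_prod_le hE hF (w' - w).
- exact: cvg_cst.
- rewrite -[X in _ --> X](addr0 (0 : R)); apply: cvgD.
    by apply: (cvg_comp fst (fun u => enorm ipE (u - w.1))); [exact: cvg_fst|exact: cE].
  by apply: (cvg_comp snd (fun u => enorm ipF (u - w.2))); [exact: cvg_snd|exact: cF].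
Qed.

Lemma near_fst (E F : topologicalType) (w : E * F) (B : set E) :
  nbhs w.1 B -> \forall w' \near w, B w'.1.
Proof. by move=> nB; exact: (cvg_fst nB). Qed.

Section Potential.
Context {R : realType} {X Y : normedModType R}.
Context {ipX : X -> X -> R} {ipY : Y -> Y -> R}.
Context {p q : nat} {e : 'I_p -> X} {d : 'I_q -> Y}.
Hypotheses (heX : euclidean ipX e) (heY : euclidean ipY d).
Context {P : problem X Y}.
Context {C : constants R}.

Local Notation M := (pM P).
Local Notation f := (pf P).
Local Notation h := (ph P).
Local Notation g := (pg P).
Local Notation ipZ := (ipZ ipX ipY).
Local Notation ipW := (ipW ipX ipY (p := p) (q := q)).
Local Notation frob := (@ip_frobenius R q p).
Local Notation act Q v := (synthesis d (Q *m analysis_map ipX e v)).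
Local Notation outer y v := (analysis_map ipY d y *m (analysis_map ipX e v)^T).
Local Notation Hm := (Hmap ipX P e d).
Local Notation Xi := (Xi ipX ipY P C e d).

Let ipXi := innerX heX.
Let ipYi := innerY heY.
Let ipZi := innerZ heX heY.
Let frobi : inner_product frob := ip_frobenius_inner R q p.

Lemma ip_act y (Q : 'M[R]_(q, p)) v : ipY y (act Q v) = frob (outer y v) Q.
Proof.
rewrite ip_frobeniusE /synthesis (ip_sumr ipYi); apply: eq_bigr => i _.
rewrite (ipZr ipYi) mxE mulr_suml; apply: eq_bigr => j _.
by rewrite !mxE big_ord1 !mxE; ring.
Qed.

Lemma enorm_outer y v : enorm frob (outer y v) = `|y| * `|v|.
Proof.
rewrite -[RHS]ger0_norm ?mulr_ge0 // -sqrtr_sqr exprMn; congr Num.sqrt.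
rewrite (norm_sqr_ip heX) (norm_sqr_ip heY) ip_frobeniusE.
rewrite (parseval heX) (parseval heY) mulr_suml; apply: eq_bigr => i _.
rewrite mulr_sumr; apply: eq_bigr => j _.
by rewrite !mxE big_ord1 !mxE; ring.
Qed.

Lemma ip_act_le y Q v : `|ipY y (act Q v)| <= `|y| * `|v| * enorm frob Q.
Proof.
by rewrite ip_act (le_trans (cauchy_schwarz_norm frobi _ _)) // enorm_outer.
Qed.

Lemma act_linearl (a : R) Q Q' v : act (a *: Q + Q') v = a *: act Q v + act Q' v.
Proof.
rewrite /synthesis scaler_sumr -big_split /=; apply: eq_bigr => i _.
by rewrite mulmxDl -scalemxAl !mxE scalerDl scalerA.
Qed.

Lemma act_linearr Q (a : R) v v' : act Q (a *: v + v') = a *: act Q v + act Q v'.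
Proof.
have -> : analysis_map ipX e (a *: v + v')
   = a *: analysis_map ipX e v + analysis_map ipX e v'.
  by apply/matrixP => i j; rewrite !mxE (ipDl ipXi) (ipZl ipXi).
rewrite /synthesis scaler_sumr -big_split /=; apply: eq_bigr => i _.
by rewrite mulmxDr -scalemxAr !mxE scalerDl scalerA.
Qed.

Lemma actDl Q Q' v : act (Q + Q') v = act Q v + act Q' v.
Proof. by rewrite -[Q]scale1r act_linearl !scale1r. Qed.

Lemma actDr Q v v' : act Q (v + v') = act Q v + act Q v'.
Proof. by rewrite -[v]scale1r act_linearr !scale1r. Qed.

Lemma conjugate_ge zeta u : ((ipX zeta u - h u)%:E <= conjugate ipX h zeta)%E.
Proof. by apply: ereal_sup_ubound; exists u. Qed.

(** Equality in the Fenchel-Young inequality. *)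
Lemma conjugate_subgradient x zeta : (forall y, h x - ipX zeta (y - x) <= h y) ->
  conjugate ipX h (- zeta) = (ipX (- zeta) x - h x)%:E.
Proof.
move=> hz; apply/eqP; rewrite eq_le conjugate_ge andbT.
apply: ge_ereal_sup => _ [u _ <-]; rewrite lee_fin.
by have := hz u; rewrite (ipBr ipXi) !(ipNl ipXi); lra.
Qed.

Lemma Xi_value c x v Q xi z zeta y : M x -> tangent_space M x v ->
  (forall u, h x - ipX zeta (u - x) <= h u) ->
  Xi c (x, v, Q, xi, z, zeta, y) =
  (f x - h x + ipX y v + psi P (rhobar C) z + ipZ xi (Hm x v Q - z)
   + c * `|v| ^+ 2)%:E.
Proof.
move=> Mx Tv hz; rewrite /Defs.Xi (conjugate_subgradient hz) /indicator_fun mem_set //.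
rewrite adde0 -!EFinD; congr EFin.
by rewrite (ipNl ipXi) (ipC ipXi zeta); ring.
Qed.

Lemma Xi_infty c x v Q xi z zeta y : ~ tangent_bundle M (x, v) ->
  Xi c (x, v, Q, xi, z, zeta, y) = +oo%E.
Proof.
move=> nT; rewrite /Defs.Xi /indicator_fun memNset //.
have := conjugate_ge (- zeta) 0.
by case: (conjugate ipX h (- zeta)).
Qed.

(** The conjugate is bounded below by one of the affine functions it is the
    supremum of; with [u := x] the bound is tight at a subgradient. *)
Lemma Xi_lower c x v Q xi z zeta y u : tangent_bundle M (x, v) ->
  ((f x + ipX x zeta + (ipX (- zeta) u - h u)
   + (ipX y v + psi P (rhobar C) z + ipZ xi (Hm x v Q - z)) + c * `|v| ^+ 2)%:E
   <= Xi c (x, v, Q, xi, z, zeta, y))%E.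
Proof.
move=> T; rewrite /Defs.Xi /indicator_fun mem_set // adde0 !EFinD.
by rewrite !leeD // conjugate_ge.
Qed.

Lemma enorm_cont_ipW : @enorm_cont R (@spaceW R X Y p q) ipW.
Proof.
have cX : enorm_cont ipX := enorm_cont_euclid heX.
have cY : enorm_cont ipY := enorm_cont_euclid heY.
have cZ : @enorm_cont R (X * Y)%type ipZ by exact: enorm_cont_prod.
have cQ : enorm_cont frob := @enorm_cont_frobenius R q p.
have i1 := ip_prod_inner ipXi ipXi.
have c1 := enorm_cont_prod ipXi ipXi cX cX.
have i2 := ip_prod_inner i1 frobi.
have c2 := enorm_cont_prod i1 frobi c1 cQ.
have i3 := ip_prod_inner i2 ipZi.
have c3 := enorm_cont_prod i2 ipZi c2 cZ.
have i4 := ip_prod_inner i3 ipZi.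
have c4 := enorm_cont_prod i3 ipZi c3 cZ.
have i5 := ip_prod_inner i4 ipXi.
have c5 := enorm_cont_prod i4 ipXi c4 cX.
exact: (enorm_cont_prod i5 ipXi c5 cX).
Qed.

Lemma enormWE (a b : X) (k : 'M[R]_(q, p)) (s w : X * Y) (t r : X) :
  enorm ipW (a, b, k, s, w, t, r) =
  Num.sqrt (ipX a a + ipX b b + frob k k + ipZ s s + ipZ w w + ipX t t + ipX r r).
Proof. by []. Qed.

Lemma enormW_components (a b : X) (k : 'M[R]_(q, p)) (s w : X * Y) (t r : X) :
  let N := enorm ipW (a, b, k, s, w, t, r) in
  [/\ `|a| <= N, `|b| <= N, enorm frob k <= N & enorm ipZ s <= N] /\
  [/\ enorm ipZ w <= N, `|t| <= N & `|r| <= N].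
Proof.
rewrite enormWE (euclid_norm heX a) (euclid_norm heX b) (euclid_norm heX t).
rewrite (euclid_norm heX r).
have := ip_ge0 ipXi a; have := ip_ge0 ipXi b; have := ip_ge0 ipXi t.
have := ip_ge0 ipXi r; have := ip_ge0 frobi k; have := ip_ge0 ipZi s.
have := ip_ge0 ipZi w => ? ? ? ? ? ? ?.
by rewrite /enorm; do !split; rewrite ler_wsqrtr //; lra.
Qed.

Lemma sqrtrD_le (u v : R) : 0 <= u -> 0 <= v ->
  Num.sqrt (u + v) <= Num.sqrt u + Num.sqrt v.
Proof.
move=> u0 v0; rewrite -(@ler_pXn2r _ 2) ?nnegrE ?addr_ge0 ?sqrtr_ge0 //.
by rewrite sqrrD !sqr_sqrtr ?addr_ge0 // lerD2r lerDl mulrn_wge0 // mulr_ge0 ?sqrtr_ge0.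
Qed.

Lemma enormW_le (a b : X) (k : 'M[R]_(q, p)) (s w : X * Y) (t r : X) :
  enorm ipW (a, b, k, s, w, t, r) <=
  `|a| + `|b| + enorm frob k + enorm ipZ s + enorm ipZ w + `|t| + `|r|.
Proof.
rewrite enormWE (euclid_norm heX a) (euclid_norm heX b) (euclid_norm heX t).
rewrite (euclid_norm heX r) /enorm.
do 6 ?[rewrite (le_trans (sqrtrD_le _ _)) ?lerD // ?addr_ge0 //].
all: first [exact: (ip_ge0 ipXi)|exact: (ip_ge0 ipYi)|exact: (ip_ge0 frobi)].
Qed.

(** The increment of the coupling term, [<xi + s, H(x', v', Q') - z'>] minus
    [<xi, H(x, v, Q) - z>], is its differential up to products of increments and
    the Taylor remainder [rg] of [g]. *)
Lemma coupling_increment (x a v b : X) (Q k : 'M[R]_(q, p)) (xi s z w : X * Y) :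
  (forall u, 'd g x u = act Q u) ->
  let rg := g (x + a) - g x - 'd g x a in
  ipZ (xi + s) (Hm (x + a) (v + b) (Q + k) - (z + w)) - ipZ xi (Hm x v Q - z)
  = ipX (adjG ipX ipY P x xi) a + ipX (adjG ipX ipY P x xi) b
    + frob (outer xi.2 v) k + ipZ s (Hm x v Q - z) - ipZ xi w
    + (ipY xi.2 rg + ipY xi.2 (act k b)
       + (ipX s.1 a + ipX s.1 b - ipX s.1 w.1)
       + (ipY s.2 ('d g x a) + ipY s.2 rg + ipY s.2 ('d g x b)
          + ipY s.2 (act k v) + ipY s.2 (act k b) - ipY s.2 w.2)).
Proof.
move=> dgQ rg.
rewrite !(adjGP heX heY) -ip_act.
have gE : g (x + a) = g x + 'd g x a + rg by rewrite /rg -(addrA (g (x + a))) -opprD [RHS]addrC subrK.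
rewrite /Defs.ipZ /ip_prod /Hmap /= gE !actDl !actDr -!dgQ.
rewrite !(ipDl ipXi, ipDr ipXi, ipDl ipYi, ipDr ipYi, ipNr ipXi, ipNr ipYi).
ring.
Qed.

Lemma ip_ge_mul (E : normedModType R) (ip : E -> E -> R) m (b : 'I_m -> E)
  (hE : euclidean ip b) u1 u2 (c1 c2 : R) :
  `|u1| <= c1 -> `|u2| <= c2 -> - (c1 * c2) <= ip u1 u2 <= c1 * c2.
Proof.
move=> h1 h2; rewrite -ler_norml (le_trans (normr_ip hE _ _)) //.
by rewrite ler_pM.
Qed.

(** Here [N] is the size of the increment: each Taylor remainder, and the defect
    of normality of [(nx, nv)], costs [e1 * N], and each product of two
    increments costs [N * N]. *)
Lemma Xi_increment_lower c x v Q xi z zeta y nx nv a b k s w t r (Cg e1 N : R) :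
  M x -> tangent_space M x v ->
  (forall u, h x - ipX zeta (u - x) <= h u) ->
  (forall u, 'd g x u = act Q u) ->
  (forall z', psi P (rhobar C) z + ipZ xi (z' - z) <= psi P (rhobar C) z') ->
  0 <= Cg -> (forall u, `|'d g x u| <= Cg * `|u|) ->
  0 <= e1 -> e1 <= 1 -> N = enorm ipW (a, b, k, s, w, t, r) -> N <= 1 ->
  tangent_bundle M (x + a, v + b) ->
  `|f (x + a) - f x - ('d (f : X -> R^o) x a : R)| <= e1 * `|a| ->
  `|g (x + a) - g x - 'd g x a| <= e1 * `|a| ->
  ipX nx a + ipX nv b <= e1 * (`|a| + `|b|) ->
  (Xi c (x, v, Q, xi, z, zeta, y) +
   (ipW (gradient ipX f x + zeta + adjG ipX ipY P x xi + nx,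
         y + adjG ipX ipY P x xi + (2 * c) *: v + nv,
         outer xi.2 v, Hm x v Q - z, 0, 0, v) (a, b, k, s, w, t, r)
    - ((3 + `|xi.2|) * e1 * N
       + (8 + 2 * Cg + `|v| + `|c| + `|xi.2|) * (N * N)))%:E
   <= Xi c ((x + a)%R, (v + b)%R, (Q + k)%R, (xi + s)%R, (z + w)%R,
            (zeta + t)%R, (y + r)%R))%E.
Proof.
move=> Mx Tv hz dgQ hpsi Cg0 dgle e10 e11 NE N1 T hf hg hn.
have [[Na Nb Nk Ns] [Nw Nt Nr]] := enormW_components a b k s w t r.
rewrite -NE in Na Nb Nk Ns Nw Nt Nr.
have N0 : 0 <= N by rewrite NE enorm_ge0.
apply: le_trans (Xi_lower _ _ _ _ _ _ x T).
rewrite Xi_value // lee_fin.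
have -> : ipW (gradient ipX f x + zeta + adjG ipX ipY P x xi + nx,
         y + adjG ipX ipY P x xi + (2 * c) *: v + nv,
         outer xi.2 v, Hm x v Q - z, 0, 0, v) (a, b, k, s, w, t, r)
  = ipX (gradient ipX f x + zeta + adjG ipX ipY P x xi + nx) a
   + ipX (y + adjG ipX ipY P x xi + (2 * c) *: v + nv) b
   + frob (outer xi.2 v) k + ipZ (Hm x v Q - z) s + ipZ 0 w + ipX 0 t + ipX v r by [].
rewrite (ipC ipZi _ s) (ip0l ipXi) (ip0l ipZi).
have CI := coupling_increment a v b k xi s z w dgQ.
set rg := g (x + a) - g x - 'd g x a in hg *; rewrite /= -/rg in CI; move: CI.
have rgN : `|rg| <= e1 * N by rewrite (le_trans hg) // ler_wpM2l.
have rgN' : `|rg| <= N by rewrite (le_trans rgN) // ler_piMl.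
have s1N : `|s.1| <= N := le_trans (norm_fst_le heX heY s) Ns.
have s2N : `|s.2| <= N := le_trans (norm_snd_le heX heY s) Ns.
have w1N : `|w.1| <= N := le_trans (norm_fst_le heX heY w) Nw.
have w2N : `|w.2| <= N := le_trans (norm_snd_le heX heY w) Nw.
have daN : `|'d g x a| <= Cg * N by rewrite (le_trans (dgle _)) // ler_wpM2l.
have dbN : `|'d g x b| <= Cg * N by rewrite (le_trans (dgle _)) // ler_wpM2l.
have NN0 : 0 <= N * N by exact: mulr_ge0.
have actb (u : Y) (c0 : R) (b0 : X) (c1 : R) : `|u| <= c0 -> `|b0| <= c1 ->
    - (c0 * c1 * N) <= ipY u (act k b0).
  move=> u0 b1; rewrite lerNl (le_trans (ler_norm _)) // normrN.
  by rewrite (le_trans (ip_act_le _ _ _)) // !ler_pM // ?mulr_ge0 // enorm_ge0.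
have /andP[F1 _] := ip_ge_mul heX Na Nt.
have /andP[F2 _] := ip_ge_mul heX Nr Nb.
have F3 := hpsi (z + w).
rewrite (addrAC z) subrr add0r in F3.
have /andP[G1 _] := ip_ge_mul heY (lexx `|xi.2|) rgN.
have G2 := actb xi.2 _ b _ (lexx _) Nb.
have /andP[G3 _] := ip_ge_mul heX s1N Na.
have /andP[G4 _] := ip_ge_mul heX s1N Nb.
have /andP[_ G5] := ip_ge_mul heX s1N w1N.
have /andP[G6 _] := ip_ge_mul heY s2N daN.
have /andP[G7 _] := ip_ge_mul heY s2N rgN'.
have /andP[G8 _] := ip_ge_mul heY s2N dbN.
have G9 := actb s.2 _ v _ s2N (lexx _).
have G10 := actb s.2 _ b _ s2N Nb.
have G10' : N * N * N <= N * N by rewrite ler_piMr.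
have /andP[_ G11] := ip_ge_mul heY s2N w2N.
have F4 : - (`|c| * (N * N)) <= c * `|b| ^+ 2.
  rewrite lerNl (le_trans (ler_norm _)) // normrN normrM normrX normr_id.
  by rewrite ler_wpM2l // expr2 ler_pM.
have F5 : - (e1 * N) <= f (x + a) - f x - ipX (gradient ipX f x) a.
  rewrite (gradientP heX) lerNl (le_trans (ler_norm _)) // normrN.
  by rewrite (le_trans hf) // ler_wpM2l.
have F6 : ipX nx a + ipX nv b <= e1 * (N + N).
  by rewrite (le_trans hn) // ler_wpM2l // lerD.
have -> : `|v + b| ^+ 2 = `|v| ^+ 2 + 2 * ipX v b + `|b| ^+ 2.
  by rewrite !(norm_sqr_ip heX) (ip_sqrD ipXi).
rewrite !(ipDl ipXi, ipDr ipXi, ipNl ipXi, ipZl ipXi) (ipC ipXi x zeta) (ipC ipXi x t).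
rewrite (ipC ipXi a zeta) (ipC ipXi r v).
move: (ipZ (xi + s) _) (ipZ xi (_ - z)) (ipZ s (_ - z)) (ipZ xi w) F3 => c1 c2 c3 c4 F3.
move: (ipY xi.2 rg) (ipY xi.2 (act k b)) (ipY s.2 ('d g x a)) (ipY s.2 rg)
  (ipY s.2 ('d g x b)) (ipY s.2 (act k v)) (ipY s.2 (act k b)) (ipY s.2 w.2)
  G1 G2 G6 G7 G8 G9 G10 G11 => y1 y2 y3 y4 y5 y6 y7 y8 G1 G2 G6 G7 G8 G9 G10 G11.
move: (frob _ k) => fk.
move: (ipX (adjG ipX ipY P x xi) a) (ipX (adjG ipX ipY P x xi) b) => ja jb.
lra.
Qed.

(** All nonsmooth pieces of the potential depend on separate variables, so a
    subgradient is assembled from the gradient of the smooth part, the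
    subgradients [xi] of [psi] at [z] and [-x] of [h^*(- .)] at [zeta], and a
    normal vector [(nx, nv)] of the tangent bundle. *)
Lemma Xi_regular_subgradient c x v Q xi z zeta y nx nv :
  M x -> tangent_space M x v ->
  (forall u, h x - ipX zeta (u - x) <= h u) ->
  differentiable (f : X -> R^o) x -> differentiable g x ->
  (forall u, 'd g x u = act Q u) ->
  (forall z', psi P (rhobar C) z + ipZ xi (z' - z) <= psi P (rhobar C) z') ->
  (forall eps : R, 0 < eps -> \forall xv \near (x, v), tangent_bundle M xv ->
     ipX nx (xv.1 - x) + ipX nv (xv.2 - v)
       <= eps * (`|xv.1 - x| + `|xv.2 - v|)) ->
  regular_subdiff ipW (Xi c) (x, v, Q, xi, z, zeta, y)
    (gradient ipX f x + zeta + adjG ipX ipY P x xi + nx,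
     y + adjG ipX ipY P x xi + (2 * c) *: v + nv,
     outer xi.2 v, Hm x v Q - z, 0, 0, v).
Proof.
move=> Mx Tv hz df dg dgQ hpsi hn.
split; first by rewrite Xi_value.
move=> ep ep0.
pose Cg : R := \sum_i `|'d g x (e i)|.
have Cg0 : 0 <= Cg by exact: sumr_ge0.
have dgle u : `|'d g x u| <= Cg * `|u| by exact: (linear_bounded_basis heX).
(* For increments of size [N] the error is [K1 * e1 * N + K2 * N ^+ 2], at most
   [ep * N] once [e1] and [N] are small. *)
pose K1 : R := 3 + `|xi.2|.
have K10 : 0 < K1 by rewrite ltr_wpDr.
pose K2 : R := 8 + 2 * Cg + `|v| + `|c| + `|xi.2|.
have K20 : 0 < K2 by rewrite !ltr_wpDr // mulr_ge0.
pose e1 : R := Num.min 1 (ep / 2 / K1).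
have e10 : 0 < e1 by rewrite lt_min ltr01 !divr_gt0.
have e1a : e1 <= 1 by rewrite ge_min lexx.
have e1b : K1 * e1 <= ep / 2 by rewrite mulrC -ler_pdivlMr // ge_min lexx orbT.
pose d1 : R := Num.min 1 (ep / 2 / K2).
have d10 : 0 < d1 by rewrite lt_min ltr01 !divr_gt0.
have d1a : d1 <= 1 by rewrite ge_min lexx.
have d1b : K2 * d1 <= ep / 2 by rewrite mulrC -ler_pdivlMr // ge_min lexx orbT.
set w0 := (x, v, Q, xi, z, zeta, y).
have nN : \forall w' \near (w0 : spaceW p q), enorm ipW (w' - w0) <= d1.
  have /cvgrPdist_le/(_ _ d10) := enorm_cont_ipW w0; apply: filterS => w'.
  by rewrite sub0r normrN; apply: le_trans; exact: ler_norm.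
have n5 (B : set (X * X)) : nbhs (x, v) B ->
    \forall w' \near (w0 : spaceW p q), B w'.1.1.1.1.1.
  move=> nB; apply: (@near_fst _ _ w0 (fun u => B u.1.1.1.1)).
  apply: (@near_fst _ _ w0.1 (fun u => B u.1.1.1)).
  apply: (@near_fst _ _ w0.1.1 (fun u => B u.1.1)).
  apply: (@near_fst _ _ w0.1.1.1 (fun u => B u.1)).
  exact: (@near_fst _ _ w0.1.1.1.1 B).
pose B : set (X * X) := [set xv | [/\ tangent_bundle M xv ->
     ipX nx (xv.1 - x) + ipX nv (xv.2 - v) <= e1 * (`|xv.1 - x| + `|xv.2 - v|),
   `|f xv.1 - f x - ('d (f : X -> R^o) x (xv.1 - x) : R)| <= e1 * `|xv.1 - x|
 & `|g xv.1 - g x - 'd g x (xv.1 - x)| <= e1 * `|xv.1 - x| ] ].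
have nB : nbhs (x, v) B.
  have b1 := hn _ e10.
  have b2 := @near_fst _ _ (x, v) _ (diff_remainder df e10).
  have b3 := @near_fst _ _ (x, v) _ (diff_remainder dg e10).
  by move: b1 b2 b3; apply: filterS3 => xv ? ? ?; split.
move: nN (n5 B nB); apply: filterS2 => -[[[[[[x' v'] Q'] xi'] z'] zeta'] y'] hN [hT hf hg].
rewrite /= in hT hf hg.
have [T|nT'] := pselect (tangent_bundle M (x', v')); last first.
  by rewrite (Xi_infty _ _ _ _ _ _ nT') leey.
have tE (V : zmodType) (u u' : V) : u' = u + (u' - u) by rewrite addrC subrK.
have Ed : ((x', v', Q', xi', z', zeta', y') : spaceW p q) - w0
  = (x' - x, v' - v, Q' - Q, xi' - xi, z' - z, zeta' - zeta, y' - y) by [].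
rewrite Ed in hN *.
rewrite (tE _ x x') (tE _ v v') in T; rewrite (tE _ x x') in hf hg.
have := @Xi_increment_lower c x v Q xi z zeta y nx nv (x' - x) (v' - v) (Q' - Q)
  (xi' - xi) (z' - z) (zeta' - zeta) (y' - y) Cg e1 _ Mx Tv hz dgQ hpsi Cg0 dgle
  (ltW e10) e1a erefl (le_trans hN d1a) T.
rewrite -!tE in T hf hg *.
move=> /(_ hf hg (hT T)); apply: le_trans; rewrite leeD2l // lee_fin lerD2l lerN2.
move: hN; set N := enorm _ _ => hN.
have N0 : 0 <= N by exact: enorm_ge0.
have h1 := ler_wpM2r N0 e1b.
have h2 : K2 * (N * N) <= ep / 2 * N.
  rewrite mulrA ler_wpM2r // (le_trans _ d1b) // ler_wpM2l // ltW //.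
move: h1 h2; rewrite /K1 /K2; lra.
Qed.

End Potential.

(** * Desingularizing functions *)

Section Desingularizing.
Context {R : realType}.

(** Concavity, through the difference quotients at [r] from the left. *)
Lemma desingularizing_tangent (eta : \bar R) (phi : R -> R) (r t : R) :
  desingularizing eta phi -> 0 < t -> t <= r -> (r%:E < eta)%E ->
  derive1 phi r * (r - t) <= phi r - phi t.
Proof.
move=> [_ _ conc _ dphi] t0 tr rh.
have r0 : 0 < r by exact: lt_le_trans tr.
have [dr _ _] := dphi r r0 rh.
have Dt : [set s : R | 0 <= s /\ (s%:E < eta)%E] t.
  by split; [exact: ltW|apply: le_lt_trans rh; rewrite lee_fin].
have Dr : [set s : R | 0 <= s /\ (s%:E < eta)%E] r by split => //; exact: ltW.
have [->|tr'] := eqVneq t r; first by rewrite !subrr mulr0.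
have rt0 : 0 < r - t by rewrite subr_gt0 lt_neqAle tr' tr.
have Eh : (fun l : R => l^-1 *: ((phi \o shift r) (l *: 1) - phi r))
    = (fun l : R => l^-1 *: (phi (l + r) - phi r)).
  by apply/funext => l; rewrite /= [_ *: 1]mulr1.
have lim : (fun l : R => l^-1 *: (phi (l + r) - phi r)) @ 0^' --> derive1 phi r.
  by move: dr; rewrite /derivable Eh.
have {}lim : (fun l : R => l^-1 *: (phi (l + r) - phi r)) @ 0^'- --> derive1 phi r.
  move=> B /lim; rewrite /= /nbhs /= /dnbhs /at_left /within /=.
  by apply: filterS => l hl l0; apply: hl; rewrite lt_eqF.
rewrite -ler_pdivlMr //; apply: (cvgr_to_le lim).
near=> l.
have l0 : l < 0 by near: l; exact: nbhs_left_lt.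
have lr : - (r - t) <= l.
  by near: l; apply: nbhs_left_ge; rewrite oppr_lt0.
pose lam := - l / (r - t).
have lam1 : 0 <= lam <= 1.
  apply/andP; split; first by rewrite divr_ge0 // ?ltW // oppr_gt0.
  by rewrite ler_pdivrMr // mul1r lerNl.
have := conc r t lam Dr Dt lam1.
have -> : (1 - lam) * r + lam * t = l + r by rewrite /lam; field; rewrite gt_eqF.
have -> : (1 - lam) * phi r + lam * phi t = phi r + l * ((phi r - phi t) / (r - t)).
  by rewrite /lam; field; rewrite gt_eqF.
rewrite -lerBrDl => h0.
by rewrite /GRing.scale /= ler_ndivrMl.
Unshelve. all: by end_near. Qed.

(** The slope of a concave function from [t] to [s] is at least its slope from
    [t] to the farther point [r], hence at least its derivative at [r]. *)
Lemma desingularizing_chord (eta : \bar R) (phi : R -> R) (t s r : R) :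
  desingularizing eta phi -> 0 < t -> t <= s -> s <= r -> (r%:E < eta)%E ->
  derive1 phi r * (s - t) <= phi s - phi t.
Proof.
move=> hphi t0 ts sr rh.
have tg := desingularizing_tangent hphi t0 (le_trans ts sr) rh.
have [_ _ conc _ dphi] := hphi.
have r0 : 0 < r by exact: lt_le_trans (le_trans ts sr).
have Dt : [set s : R | 0 <= s /\ (s%:E < eta)%E] t.
  split; first exact: ltW.
  by apply: le_lt_trans rh; rewrite lee_fin (le_trans ts).
have Dr : [set s : R | 0 <= s /\ (s%:E < eta)%E] r by split => //; exact: ltW.
have [tr|tr] := eqVneq t r.
  have -> : s = t by apply/eqP; rewrite eq_le ts tr sr.
  by rewrite !subrr mulr0.
have rt0 : 0 < r - t by rewrite subr_gt0 lt_neqAle tr (le_trans ts).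
pose lam := (r - s) / (r - t).
have lam1 : 0 <= lam <= 1.
  apply/andP; split; first by rewrite divr_ge0 ?subr_ge0 // -subr_ge0 ltW.
  by rewrite ler_pdivrMr // mul1r lerD2l lerN2.
have := conc r t lam Dr Dt lam1.
have -> : (1 - lam) * r + lam * t = s by rewrite /lam; field; rewrite gt_eqF.
have h : (1 - lam) * (derive1 phi r * (r - t)) <= (1 - lam) * (phi r - phi t).
  by rewrite ler_wpM2l // subr_ge0; case/andP: lam1.
have -> : derive1 phi r * (s - t) = (1 - lam) * (derive1 phi r * (r - t)).
  by rewrite /lam; field; rewrite gt_eqF.
move: h; lra.
Qed.

End Desingularizing.

(** * Successful and rejected iterations *)

Section Run.
Context {R : realType} {X Y : normedModType R}.
Context {ipX : X -> X -> R} {ipY : Y -> Y -> R}.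
Context {p q : nat} {e : 'I_p -> X} {d : 'I_q -> Y}.
Hypotheses (heX : euclidean ipX e) (heY : euclidean ipY d).
Context {P : problem X Y}.
Hypothesis hP : standing_assumptions ipX P.
Hypothesis hM : embedded_submanifold 2 (pM P).
Context {A : parameters X} {it : iterates X Y}.
Hypothesis hgen : generated ipX ipY P A it.
Context {C : constants R}.
Hypothesis hC : valid_constants ipX ipY P A it C.

Local Notation M := (pM P).
Local Notation K := (pK P).
Local Notation f := (pf P).
Local Notation vt := (pvt P).
Local Notation h := (ph P).
Local Notation g := (pg P).
Local Notation dist := (tdist (ptn P) (pK P)).
Local Notation ipZ := (ipZ ipX ipY).
Local Notation adjJ := (adjJ ipX ipY P).
Local Notation adjG := (adjG ipX ipY P).
Local Notation x := (ix it).
Local Notation beta := (ibeta it).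
Local Notation eps := (ieps it).
Local Notation rho := (irho it).
Local Notation zeta := (izeta it).
Local Notation v := (iv it).
Local Notation z := (iz it).
Local Notation xi := (ixi it).
Local Notation I1 := (cond_I1 ipX ipY P it).
Local Notation rejected := (rejected ipX P A it).
Local Notation successful := (successful ipX ipY P A it).
Local Notation predk := (predk ipX P it).
Local Notation pvec := (pvec ipX ipY P it).
Local Notation Lpsi := (Lpsi C).
Local Notation L := (Lconst C).
Local Notation rhob := (rhobar C).
Local Notation G k := (Gmap P (x k) (v k)).
Local Notation gradf := (gradient ipX f).

Let ipXi := innerX heX.
Let ipZi := innerZ heX heY.

Lemma run_step k : I1 k /\ step5 P A it k \/ ~ I1 k /\ step67 ipX P A it k.
Proof.
have [_ /(_ k) [_ _ _ s5 s67]] := hgen.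
by have [i1|i1] := pselect (I1 k); [left|right]; split => //; auto.
Qed.

Lemma run_tangent k : tangent_space M (x k) (v k).
Proof. by have [_ /(_ k) [_ _ []]] := hgen. Qed.

Lemma x_mem k : M (x k).
Proof.
elim: k => [|k IH]; first by have [[[]]] := hgen.
have [[_ [_ -> //]]|[_ [_ _ hr hs]]] := run_step k.
have [/hr [-> //]|/hs [-> _ _]] := pselect (rejected k).
have [[[[rt _ _ _] _] _ _ _ _] _] := hgen.
by apply: rt; split; [exact: IH|exact: run_tangent].
Qed.

Lemma rho_gt0 k : 0 < rho k.
Proof.
have [[_ [rho0 _] [_ _ tau1 _] _ _] _] := hgen.
have tau0 : 0 < tau A by exact: lt_trans tau1.
elim: k => [//|k IH].
have [[_ [_ _ _ _ ->]]|[_ [_ _ hr hs]]] := run_step k.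
  by case: ifP => // _; exact: mulr_gt0.
have [/hr [_ _ -> //]|/hs [_ _ ->]] := pselect (rejected k).
by case: ifP => // _; exact: mulr_gt0.
Qed.

Lemma beta_gt0 k : 0 < beta k.
Proof.
have [[_ [_ /andP[bm0 bmb]] _ _ [_ [s20 _ s1]]] _] := hgen.
elim: k => [|k IH]; first exact: lt_trans bmb.
have [[_ [_ _ -> //]]|[_ [_ _ hr hs]]] := run_step k.
have [/hr [_ -> _]|/hs [_ -> _]] := pselect (rejected k).
  by rewrite mulr_gt0 // (lt_trans _ s1).
by case: ifP => // _; rewrite lt_max bm0 orbT.
Qed.

Lemma rhob_gt0 : 0 < rhob.
Proof. by have [_ [k0 /(_ k0 (leqnn _)) <-] _ _] := hC; exact: rho_gt0. Qed.

Lemma cu_gt0 : 0 < cu C.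
Proof. by have [[cl /andP[cl0 clu] _] _ _ _] := hC; exact: lt_le_trans clu. Qed.

Lemma dist_lip y y' : dist y - dist y' <= cu C * `|y - y'|.
Proof.
rewrite (le_trans (tdist_lip (ptn_norm hP) (K_nonempty hP) _ _)) //.
by have [[cl _ /(_ (y - y')) /andP[]]] := hC.
Qed.

Lemma Lpsi_ge0 : 0 <= Lpsi. Proof. exact: sqrtr_ge0. Qed.

Lemma lipschitz_sum_le (a b : R) (u : X) (y : Y) :
  a <= L_vt C * `|u| -> b <= cu C * `|y| ->
  a + rhob * b <= Lpsi * enorm ipZ (u, y).
Proof.
move=> ha hb; rewrite (enormZ_sqrt heX heY) /Lpsi -exprMn.
apply: le_trans (cauchy_schwarz2 _ _ _ _) => /=.
have := ler_wpM2l (ltW rhob_gt0) hb; lra.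
Qed.

Lemma model_point_gap k :
  psi P rhob (G k) - psi P rhob (z k) <= Lpsi * enorm ipZ (G k - z k).
Proof.
have [_ _ _ [X1 [X2 [X3 [U [_ _ /(_ k) [_ segU segX1 _ _] [[_ lipvt] _ _ _] _]]]]]] := hC.
have inX1 w : segment (x k + v k) (z k).1 w -> X1 w.
  by move=> /segU Uw; apply: segX1; right.
have X1G : X1 (G k).1.
  by apply: inX1; exists 0; rewrite lexx ler01 subr0 scale1r scale0r addr0.
have X1z : X1 (z k).1.
  by apply: inX1; exists 1; rewrite lexx ler01 subrr scale1r scale0r add0r.
have h1 : vt (G k).1 - vt (z k).1 <= L_vt C * `|(G k).1 - (z k).1|.
  by apply: le_trans (ler_norm _) _; exact: (lipvt ((G k).1, (z k).1)).
have h2 := dist_lip (G k).2 (z k).2.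
by have := lipschitz_sum_le h1 h2; rewrite /psi; lra.
Qed.

(** A subgradient is bounded by the Lipschitz constant [Lpsi] of [psi], seen by
    testing it in its own direction; the open set around the first component
    of [z k] leaves room for the test point. *)
Lemma xi_bound k : rho k = rhob -> enorm ipZ (xi k) <= Lpsi.
Proof.
move=> rk.
have [_ _ _ [X1 [X2 [X3 [U [_ _ /(_ k) [oU segU segX1 _ _] [[_ lipvt] _ _ _] _]]]]]] := hC.
have Uz : U k (z k).1.
  by apply: segU; exists 1; rewrite lexx ler01 subrr scale1r scale0r add0r.
have UX1 w : U k w -> X1 w by move=> Uw; apply: segX1; right.
have [t [t0 _ Ut _]] := near_segment (xi k).1 (open_nbhs_nbhs (conj oU Uz)).
have [_ /(_ k) [_ _ [_ sg _] _ _]] := hgen.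
rewrite rk in sg.
have := psi_subgradient heX heY hP (ltW rhob_gt0) sg (z k + t *: xi k).
rewrite (addrAC (z k)) subrr add0r (ipZr ipZi) -(enorm_sqr ipZi) => hs.
have h1 : vt ((z k).1 + t *: (xi k).1) - vt (z k).1 <= L_vt C * `|t *: (xi k).1|.
  apply: le_trans (ler_norm _) _.
  have := lipvt ((z k).1 + t *: (xi k).1, (z k).1) (conj (UX1 _ Ut) (UX1 _ Uz)).
  by rewrite /= (addrAC (z k).1) subrr add0r.
have := dist_lip ((z k).2 + t *: (xi k).2) (z k).2.
rewrite (addrAC (z k).2) subrr add0r => h2.
have := lipschitz_sum_le h1 h2.
rewrite -[(t *: (xi k).1, _)]/(t *: xi k) (enormZ ipZi) gtr0_norm // => h3.
have [->|xn0] := eqVneq (enorm ipZ (xi k)) 0; first exact: Lpsi_ge0.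
have xn : 0 < enorm ipZ (xi k) by rewrite lt_neqAle eq_sym xn0 enorm_ge0.
have : t * enorm ipZ (xi k) ^+ 2 <= Lpsi * (t * enorm ipZ (xi k)).
  by move: hs h3; rewrite /psi /=; lra.
by rewrite (mulrCA Lpsi) (ler_pM2l t0) expr2 (ler_pM2r xn).
Qed.

Lemma tangent_space_subspace k : linear_subspace (tangent_space M (x k)).
Proof. exact: (tangent_subspace heX hM (x_mem k)). Qed.

Lemma pvec_ip k w : tangent_space M (x k) w ->
  ipX (pvec k) w
  = ipX (gradf (x k) + zeta k + beta k *: v k + adjG (x k) (xi k)) w.
Proof.
move=> Tw; rewrite /Defs.pvec (projection_ip heX _ (tangent_space_subspace k) Tw).
by rewrite (gradient_ell heX).
Qed.

Lemma predkE k : predk k = psi P (rho k) (x k, g (x k)) - psi P (rho k) (G k)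
  - ipX (gradf (x k) + zeta k) (v k) - beta k / 2 * `|v k| ^+ 2.
Proof. by rewrite /Defs.predk /Theta_pen /Theta /Theta_hat /ell /psi /=; ring. Qed.

(** The inequality of [xi k] at [(x k, g (x k))] and stationarity up to
    [bmax A * `|v|] make the full proximal term a gain; half of it is already
    counted in the model, and replacing [z k] by [G k] costs twice
    [Lpsi * amax A * `|v| ^+ 2]. *)
Lemma pred_lower k : rho k = rhob -> cond_I2 ipX ipY P it k ->
  (beta k / 2 - 2 * amax A * Lpsi - bmax A) * `|v k| ^+ 2 <= predk k.
Proof.
move=> rk [hG hp].
have [_ /(_ k) [_ [/andP[a0 aA] /andP[b0 bA]] [_ sg _] _ _]] := hgen.
rewrite predkE rk in sg *.
have h1 := psi_subgradient heX heY hP (ltW rhob_gt0) sg (x k, g (x k)).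
have h2 := model_point_gap k.
have Gdec : (x k, g (x k)) - z k = (G k - z k) - (v k, 'd g (x k) (v k)).
  by rewrite /Gmap; congr pair; rewrite /= [in RHS]addrAC addrK.
have h3 : ipZ (xi k) ((x k, g (x k)) - z k)
   = ipZ (xi k) (G k - z k) - ipX (adjG (x k) (xi k)) (v k).
  by rewrite Gdec (ipBr ipZi) (adjGP heX heY).
have h4 : - (Lpsi * enorm ipZ (G k - z k)) <= ipZ (xi k) (G k - z k).
  rewrite lerNl -(ipNr ipZi) (le_trans (cauchy_schwarz ipZi _ _)) //.
  by rewrite (enormN ipZi) ler_wpM2r ?enorm_ge0 // xi_bound.
have h5 := pvec_ip (run_tangent k).
rewrite (ipDl ipXi) (ipDl ipXi (_ + _)) (ipZl ipXi) -(norm_sqr_ip heX) in h5.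
have h6 : ipX (pvec k) (v k) <= bmax A * `|v k| ^+ 2.
  rewrite (le_trans (ip_le_norm heX _ _)) // expr2 mulrA ler_wpM2r //.
  by rewrite (le_trans hp) // ler_wpM2r.
have h7 : enorm ipZ (G k - z k) <= amax A * `|v k| ^+ 2.
  by rewrite (le_trans hG) // ler_wpM2r // sqr_ge0.
have h8 := ler_wpM2l Lpsi_ge0 h7.
move: h1 h2 h3 h4 h5 h6 h8; set n2 := `|v k| ^+ 2.
move: (psi P rhob (G k)) (psi P rhob (z k)) => pG pz.
lra.
Qed.

(** The model linearizes [f], [g] and [h] on [[x, x + v]], and the retraction
    differs from [x + v] by [O(`|v| ^+ 2)]; [Lconst] adds the two errors. *)
Lemma step_expansion k :
  Theta_pen P rhob (retr A (x k) (v k))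
   - (ell ipX P (x k) (zeta k) (v k) + psi P rhob (G k)) <= L * `|v k| ^+ 2.
Proof.
have [[cl /andP[cl0 clu] hcl] _ [Mr0 /(_ k) hMr] [X1 [X2 [X3 [U [_ _ /(_ k) [_ _ segX1 segX2 segX3]
  [[Lvt0 lipvt] [Lf0 lipf] [Lh0 liph] [Lg0 lipg]]
  [[Lgf0 Lgg0] diffX3 lipgf lipgg]]]]]]] := hC.
set r := retr A (x k) (v k) in hMr segX1 segX2 *.
set xv := x k + v k in hMr segX1 segX2 *.
have segl : segment xv r xv.
  by exists 0; rewrite lexx ler01 subr0 scale1r scale0r addr0.
have segr : segment xv r r.
  by exists 1; rewrite lexx ler01 subrr scale1r scale0r add0r.
have X1l : X1 xv by apply: segX1; left.
have X1r : X1 r by apply: segX1; left.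
have X2l : X2 xv by exact: segX2.
have X2r : X2 r by exact: segX2.
have X3t t : 0 <= t -> t <= 1 -> X3 (x k + t *: v k).
  move=> t0 t1; apply: segX3; exists t; rewrite t0 t1; split => //.
  by rewrite [RHS]addrC convex_comb_shift.
have X30 : X3 (x k) by rewrite -[x k]addr0 -(scale0r (v k)); exact: X3t.
have tv t : 0 <= t -> `|x k + t *: v k - x k| = t * `|v k|.
  by move=> t0; rewrite (addrAC (x k)) subrr add0r normrZ ger0_norm.
have lip_le (c : R) (F : X -> R) : 0 <= c -> `|F r - F xv| <= c * `|r - xv| ->
    `|F r - F xv| <= c * Mretr C * `|v k| ^+ 2.
  by move=> c0 /le_trans; apply; rewrite -mulrA ler_wpM2l.
have hf : `|f r - f xv| <= L_f C * Mretr C * `|v k| ^+ 2.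
  by apply: lip_le => //; exact: (lipf (r, xv) (conj (conj X1r X2r) (conj X1l X2l))).
have hvt : `|vt r - vt xv| <= L_vt C * Mretr C * `|v k| ^+ 2.
  by apply: lip_le => //; exact: (lipvt (r, xv) (conj X1r X1l)).
have hh : `|h r - h xv| <= L_h C * Mretr C * `|v k| ^+ 2.
  by apply: lip_le => //; exact: (liph (r, xv) (conj (conj X1r X2r) (conj X1l X2l))).
have hg : `|g r - g xv| <= L_g C * Mretr C * `|v k| ^+ 2.
  have := lipg (r, xv) (conj (conj X1r X2r) (conj X1l X2l)) => /= /le_trans; apply.
  by rewrite -mulrA ler_wpM2l.
have df : f xv - f (x k) - ipX (gradf (x k)) (v k) <= L_gradf C / 2 * `|v k| ^+ 2.
  apply: (descent heX).
    by move=> t t0 t1; have [] := diffX3 _ (X3t t t0 t1).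
  move=> t t0 t1; rewrite -tv //.
  exact: (lipgf (x k + t *: v k, x k) (conj (X3t t t0 t1) X30)).
have dg : `|g xv - g (x k) - 'd g (x k) (v k)| <= L_gradg C / 2 * `|v k| ^+ 2.
  apply: (jacobian_remainder heX heY) => //.
    by move=> t t0 t1; have [] := diffX3 _ (X3t t t0 t1).
  move=> t t0 t1 u; rewrite -tv //.
  exact: (lipgg (x k + t *: v k) (x k) u (X3t t t0 t1) X30).
have [_ /(_ k) [sz _ _ _ _]] := hgen.
have hz := zeta_subgradient heX hP sz xv.
rewrite /xv (addrAC (x k)) subrr add0r -/xv in hz.
have hd : dist (g r) - dist (G k).2 <= cu C * (L_g C * Mretr C + L_gradg C / 2) * `|v k| ^+ 2.
  rewrite (le_trans (dist_lip _ _)) // -mulrA ler_wpM2l ?(ltW cu_gt0) //.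
  rewrite mulrDl /=.
  have -> : g r - (g (x k) + 'd g (x k) (v k))
     = (g r - g xv) + (g xv - g (x k) - 'd g (x k) (v k)).
    by rewrite addrA addrA subrK opprD addrA.
  by rewrite (le_trans (ler_normD _ _)) // lerD.
have hd' := ler_wpM2l (ltW rhob_gt0) hd.
move: (le_trans (ler_norm _) hf) (le_trans (ler_norm _) hvt).
move: hh; rewrite ler_norml => /andP[hh _].
rewrite /Theta_pen /Theta /ell /psi /Lconst (ipDl ipXi) /= -/xv.
move: hz df hd' hh; set n2 := `|v k| ^+ 2.
move: (dist (g r)) (dist _) => a b.
lra.
Qed.

Definition penalty k := Theta_pen P rhob (x k).

Lemma cond_DI2 k : ~ I1 k -> cond_D ipX P it k /\ cond_I2 ipX ipY P it k.
Proof. by move=> nI1; have [_ /(_ k) [_ _ [_ _ [//|]]]] := hgen. Qed.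

Lemma predk_gt0 k : ~ I1 k -> 0 < predk k.
Proof. by move=> /cond_DI2 [hD _]; rewrite subr_gt0. Qed.

Lemma v_neq0 k : ~ I1 k -> v k != 0.
Proof.
move=> /predk_gt0; rewrite predkE; apply: contraTneq => v0.
rewrite /Gmap v0 linear0 !addr0 (ip0r ipXi) normr0 expr0n /= mulr0 !subr0 subrr.
by rewrite ltxx.
Qed.

Definition beta_threshold : R :=
  Num.max (2 * (bmax A + 2 * amax A * Lpsi + gammabar A))
    ((2 * (1 - eta1 A) * (bmax A + 2 * amax A * Lpsi) + 2 * L) / (1 - eta1 A)).

(** The gain predicted by the model is at least [beta/2 - c] times [`|v|^2],
    with [c := 2 * amax * Lpsi + bmax], and
    exceeds the true gain by at most [L - beta/2] times [`|v|^2]; for large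
    [beta] both tests for success hold. *)
Lemma rejected_beta_small k : rho k = rhob -> ~ I1 k -> rejected k ->
  beta k < beta_threshold.
Proof.
move=> rk nI1 rej; rewrite ltNge; apply/negP; rewrite ge_max => /andP[b1 b2].
have [[_ _ [am0 bm0 _ _] [_ [e10 e12 e21]] [ga0 _]] _] := hgen.
have e1 : 0 < 1 - eta1 A by rewrite subr_gt0 (lt_trans e12).
have [hD hI2] := cond_DI2 nI1.
have pp := predk_gt0 nI1.
have pl := pred_lower rk hI2.
have n0 : 0 <= `|v k| ^+ 2 by rewrite sqr_ge0.
have := step_expansion k; set T := Theta_pen P rhob (retr _ _ _) => se.
have predE : predk k = Theta_pen P rhob (x k)
    - (ell ipX P (x k) (zeta k) (v k) + psi P rhob (G k)) - beta k / 2 * `|v k| ^+ 2.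
  by rewrite /Defs.predk rk /Theta_hat; ring.
case: rej => [|].
  rewrite /acc_ratio ltr_pdivrMr // /aredk rk -/T => ha.
  rewrite ler_pdivrMr // in b2.
  have h1 : (1 - eta1 A) * predk k < (L - beta k / 2) * `|v k| ^+ 2.
    by rewrite mulrBl mul1r; move: ha se predE; lra.
  have h2 : L * `|v k| ^+ 2 <= (1 - eta1 A) * predk k.
    apply: le_trans (ler_wpM2l (ltW e1) pl); rewrite [leRHS]mulrA ler_wpM2r //.
    by move: b2; lra.
  have := mulr_ge0 (ltW (beta_gt0 k)) n0; move: h1 h2; lra.
move=> /(le_lt_trans pl).
apply/negP; rewrite -leNgt ler_wpM2r //; move: b1; lra.
Qed.

(** Once [rho] is constant, [beta] grows only at rejected iterations, that is,
    from a value below the threshold, and then by the factor [sigma1]. *)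
Lemma beta_bounded : exists B, forall k, beta k <= B.
Proof.
have [_ [k0 hk0] _ _] := hC.
have [[_ [_ /andP[bm0 bmb]] _ _ [_ [s20 s21 s1]]] _] := hgen.
(* The sum dominates the values before [rho] settles. *)
pose B := Num.max (\sum_(j < k0.+1) beta j) (Num.max (betamin A) (sigma1 A * beta_threshold)).
have B1 : betamin A <= B by rewrite !le_max lexx !orbT.
have B2 : sigma1 A * beta_threshold <= B by rewrite !le_max lexx !orbT.
have bB j : (j <= k0)%N -> beta j <= B.
  rewrite -ltnS => jk; rewrite le_max; apply/orP; left.
  rewrite (bigD1 (Ordinal jk)) //= lerDl sumr_ge0 // => i _.
  exact: ltW (beta_gt0 i).
exists B => k; have [/bB //|/ltnW] := leqP k k0.
elim: k => [|k IH kk]; first by rewrite leqn0 => /eqP k00; apply: bB; rewrite k00.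
have [/bB //|k0k] := leqP k.+1 k0; rewrite ltnS in k0k.
have rk := hk0 k k0k.
have [[_ [_ _ -> _ _]]|[nI1 [_ _ hr hs]]] := run_step k; first exact: IH.
have [rj|/hs [_ -> _]] := pselect (rejected k).
  have [_ -> _] := hr rj; rewrite (le_trans _ B2) // ler_wpM2l //.
    by rewrite ltW // (lt_trans _ s1).
  exact: ltW (rejected_beta_small rk nI1 rj).
case: ifP => _; first exact: IH.
rewrite ge_max B1 andbT (le_trans _ (IH k0k)) // ler_piMl ?(ltW (beta_gt0 k)) //.
exact: ltW.
Qed.

Lemma x_unchanged k : ~ successful k -> x k.+1 = x k.
Proof.
move=> ns; have [[_ [_ -> //]]|[nI1 [_ _ hr _]]] := run_step k.
by have [/hr []//|nr] := pselect (rejected k); exfalso; exact: ns.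
Qed.

Lemma successful_step k : successful k -> x k.+1 = retr A (x k) (v k).
Proof.
move=> [nI1 nr]; have [[//]|[_ [_ _ _ hs]]] := run_step k.
by have [] := hs nr.
Qed.

Lemma penalty_decrease k : rho k = rhob -> successful k ->
  eta1 A * gammabar A * `|v k| ^+ 2 <= penalty k - penalty k.+1.
Proof.
move=> rk sk; have [nI1 nr] := sk.
have [[_ _ _ [_ [e10 _ _]] [ga0 _]] _] := hgen.
have pp := predk_gt0 nI1.
move: nr => /not_orP [/negP + /negP]; rewrite -!leNgt.
rewrite /acc_ratio ler_pdivlMr // /aredk rk => h1 h2.
rewrite /penalty (successful_step sk) (le_trans _ h1) // -mulrA ler_pM2l //.
Qed.

Lemma penalty_decrease_strict k : rho k = rhob -> successful k ->
  penalty k.+1 < penalty k.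
Proof.
move=> rk sk; rewrite -subr_gt0 (lt_le_trans _ (penalty_decrease rk sk)) //.
have [[_ _ _ [_ [e10 _ _]] [ga0 _]] _] := hgen.
rewrite mulr_gt0 ?(mulr_gt0 e10 ga0) // exprn_gt0 // normr_gt0.
by apply: v_neq0; case: sk.
Qed.

Lemma penalty_nonincreasing k0 : (forall k, (k0 <= k)%N -> rho k = rhob) ->
  forall k l, (k0 <= k)%N -> (k <= l)%N -> penalty l <= penalty k.
Proof.
move=> hk0 k l k0k; elim: l => [|l IH]; first by rewrite leqn0 => /eqP ->.
rewrite leq_eqVlt => /orP[/eqP -> //|]; rewrite ltnS => kl.
apply: le_trans (IH kl); have [sl|/x_unchanged] := pselect (successful l).
  exact: ltW (penalty_decrease_strict (hk0 l (leq_trans k0k kl)) sl).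
by rewrite /penalty => ->.
Qed.

Lemma step_length k : successful k ->
  `|x k.+1 - x k| <= `|v k| + Mretr C * `|v k| ^+ 2.
Proof.
move=> sk; rewrite (successful_step sk).
have [_ _ [_ /(_ k) hm] _] := hC.
have -> : retr A (x k) (v k) - x k = v k + (retr A (x k) (v k) - (x k + v k)).
  by rewrite [RHS]addrC opprD addrA subrK.
by rewrite (le_trans (ler_normD _ _)) // lerD2l.
Qed.

(** * Limits along ultrafilters *)

Lemma smooth_at_M xb : M xb -> exists W : set X, [/\ open W, W xb,
  (forall y, W y -> differentiable (f : X -> R^o) y),
  (forall y, W y -> differentiable g y) &
  (forall y, W y -> exists (U : set X) (L : R),
      nbhs y U /\ L.-lipschitz_(W `&` U) gradf) /\
  (forall y, W y -> exists (U : set X) (L : R),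
      nbhs y U /\ op_lipschitz_on L (W `&` U) (fun y => 'd g y))].
Proof.
move=> Mx; case: hP => _ _ _ [W [oW _ MW [df lf] [dg lg]]] _.
by exists W; split => //; exact: MW.
Qed.

Lemma f_continuous xb : M xb -> {for xb, continuous f}.
Proof.
move=> /smooth_at_M [W [_ Wx df _ _]].
exact: (differentiable_continuous (df _ Wx)).
Qed.

Lemma g_continuous xb : M xb -> {for xb, continuous g}.
Proof.
by move=> /smooth_at_M [W [_ Wx _ dg _]]; exact: differentiable_continuous (dg _ Wx).
Qed.

Lemma gradf_continuous xb : M xb -> {for xb, continuous gradf}.
Proof.
move=> /smooth_at_M [W [oW Wx _ _ [/(_ _ Wx) [U [l [nU lip]]] _]]].
have Ux : U xb by exact: nbhs_singleton nU.
have nOU : nbhs xb (W `&` U).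
  by apply: filterI => //; exact: open_nbhs_nbhs (conj oW Wx).
apply/cvgrPdist_le => ep ep0.
have l0 : 0 < `|l| + 1 by rewrite ltr_wpDl.
near=> y.
have Wy : (W `&` U) y by near: y.
rewrite (le_trans (lip (xb, y) (conj (conj Wx Ux) Wy))) //=.
have : `|xb - y| <= ep / (`|l| + 1).
  by near: y; apply: cvgr_dist_le => //; exact: divr_gt0.
rewrite ler_pdivlMr // => hy.
have := ler_norm l; have := normr_ge0 (xb - y); nra.
Unshelve. all: by end_near. Qed.

Lemma dg_continuous xb w : M xb -> {for xb, continuous (fun y => 'd g y w)}.
Proof.
move=> /smooth_at_M [W [oW Wx _ _ [_ /(_ _ Wx) [U [l [nU lip]]]]]].
have Ux : U xb by exact: nbhs_singleton nU.
have nOU : nbhs xb (W `&` U).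
  by apply: filterI => //; exact: open_nbhs_nbhs (conj oW Wx).
apply/cvgrPdist_le => ep ep0.
have l0 : 0 < `|l| * `|w| + 1 by rewrite ltr_wpDl // mulr_ge0.
near=> y.
have Wy : (W `&` U) y by near: y.
rewrite (le_trans (lip xb y w (conj Wx Ux) Wy)) //.
have : `|xb - y| <= ep / (`|l| * `|w| + 1).
  by near: y; apply: cvgr_dist_le => //; exact: divr_gt0.
rewrite ler_pdivlMr // => hy.
have := ler_wpM2r (normr_ge0 w) (ler_wpM2r (normr_ge0 (xb - y)) (ler_norm l)).
have := normr_ge0 (xb - y); lra.
Unshelve. all: by end_near. Qed.

Lemma dist_continuous : continuous (dist : Y -> R).
Proof.
move=> y; apply/cvgrPdist_le => ep ep0; near=> y'.
have : `|y - y'| <= ep / cu C.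
  by near: y'; apply: cvgr_dist_le => //; apply: divr_gt0 => //; exact: cu_gt0.
rewrite ler_pdivlMr ?cu_gt0 // mulrC => hy.
have h1 := dist_lip y y'; have := dist_lip y' y; rewrite (distrC y') => h2.
by rewrite ler_norml; apply/andP; split; lra.
Unshelve. all: by end_near. Qed.

Section Limits.
Context {T : Type} {F : set_system T} {FF : ProperFilter F}.
Context {s : T -> X} {xb : X}.
Hypotheses (sx : s @ F --> xb) (Mxb : M xb).

Lemma cvg_Theta_pen r : (fun k => Theta_pen P r (s k)) @ F --> Theta_pen P r xb.
Proof.
apply: cvgD; last first.
  apply: cvgM; first exact: cvg_cst.
  apply: (cvg_comp (g \o s) dist); last exact: dist_continuous.
  exact: (cvg_comp s g sx (g_continuous Mxb)).
apply: cvgB; last exact: (cvg_comp s h sx (convexf_continuous heX (h_convex hP) (x:=xb))).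
apply: cvgD; first exact: (cvg_comp s f sx (f_continuous Mxb)).
exact: (cvg_comp s vt sx (convexf_continuous heX (vt_convex hP) (x:=xb))).
Qed.

Lemma cvg_adjJ (u : T -> Y) ub : u @ F --> ub ->
  (fun k => adjJ (s k) (u k)) @ F --> adjJ xb ub.
Proof.
move=> uu; rewrite [X in _ --> X](basis_expansion heX).
apply: (cvg_coordinates heX) => i.
rewrite (adjJP heX heY).
rewrite (_ : (fun k => _) = fun k => ipY (u k) ('d g (s k) (e i))); last first.
  by apply/funext => k; rewrite (adjJP heX heY).
apply: (cvg_ip heY) => //.
exact: (cvg_comp s (fun y => 'd g y (e i)) sx (dg_continuous Mxb)).
Qed.

Lemma cvg_dg (u : T -> X) ub : u @ F --> ub ->
  (fun k => 'd g (s k) (u k)) @ F --> 'd g xb ub.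
Proof.
move=> uu.
rewrite (_ : (fun k => _) = fun k => \sum_i ipX (u k) (e i) *: 'd g (s k) (e i)); last first.
  apply/funext => k; rewrite {1}(basis_expansion heX (u k)) linear_sum.
  by apply: eq_bigr => i _; rewrite linearZ.
rewrite (basis_expansion heX ub) linear_sum.
apply: cvg_big => [|i _]; first exact: add_continuous.
rewrite linearZ; apply: cvgZ; first by apply: (cvg_ip heX) => //; exact: cvg_cst.
exact: (cvg_comp s (fun y => 'd g y (e i)) sx (dg_continuous Mxb)).
Qed.

End Limits.

Hypothesis hx : bounded_fun x.
Hypothesis hS : infinite_set [set k | successful k].

Definition successes : set_system nat := within [set k | successful k] \oo.

Lemma successes_proper : ProperFilter successes.
Proof.
apply: Build_ProperFilter_ex => B [N _ hN]; apply: contrapT => nB; apply: hS.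
apply: (@sub_finite_set _ _ `I_N); last exact: finite_II.
move=> k sk /=; rewrite ltnNge; apply/negP => Nk; apply: nB.
by exists k; exact: hN.
Qed.

Lemma successes_ge N : (\forall k \near successes, (N <= k)%N).
Proof. by exists N => // k /= Nk _. Qed.

Lemma successes_succ : \forall k \near successes, successful k.
Proof. by exists 0%N. Qed.

Lemma successes_oo : \oo `<=` successes.
Proof. by move=> B [N _ hN]; exists N => // k /= /hN. Qed.

Lemma ultra_x_cvg (U : set_system nat) : UltraFilter U ->
  exists2 xb, M xb & x @ U --> xb.
Proof.
move=> UU; have [B [_ hB]] := hx.
have [xb xx] : exists l : X, x @ U --> l.
  apply: (ultra_bounded_cvg heX (B := B + 1)) => //; apply: nearW => k.
  by apply: (hB (B + 1)) => //; rewrite ltrDl.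
exists xb => //; apply: (closed_cvg _ _ _ _ xx) => //; last by apply: nearW; exact: x_mem.
by case: hP.
Qed.

(** The penalty value is eventually nonincreasing and has a finite limit along
    an ultrafilter; all cluster points of the iterates then share this limit. *)
Lemma penalty_limit : exists Ts, penalty @ \oo --> Ts /\
  (forall xb (U : set_system nat), ProperFilter U -> \oo `<=` U -> M xb ->
     x @ U --> xb -> Theta_pen P rhob xb = Ts).
Proof.
have [_ [k0 hk0] _ _] := hC.
have [U [UU oU]] := ultraFilterLemma successes_proper.
have [xb Mxb xx] := ultra_x_cvg UU.
have Uoo : \oo `<=` U by move=> B /successes_oo; exact: oU.
have cU : penalty @ U --> Theta_pen P rhob xb by exact: (cvg_Theta_pen xx Mxb).
have ge k : (k0 <= k)%N -> Theta_pen P rhob xb <= penalty k.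
  move=> k0k; apply: (@cvgr_to_le _ U _ _ (fun j => penalty j)) => //.
  apply: Uoo; exists k => // j /= kj; exact: (penalty_nonincreasing hk0).
have coo : penalty @ \oo --> Theta_pen P rhob xb.
  apply/cvgrPdist_le => ep ep0.
  have /cvgrPdist_le/(_ _ ep0) hU := cU.
  have [j [j1 j2]] := filter_ex (filterI hU (Uoo _ (nbhs_infty_ge k0))).
  exists j => // i /= ji; have j3 := penalty_nonincreasing hk0 j2 ji.
  have j4 := ge i (leq_trans j2 ji).
  rewrite distrC ger0_norm ?subr_ge0 //; move: j1; rewrite distrC => /(le_trans (ler_norm _)).
  move: j3; rewrite /penalty; lra.
exists (Theta_pen P rhob xb); split => // xb' U' PU' oU' Mxb' xx'.
have c1 : penalty @ U' --> Theta_pen P rhob xb' by exact: (cvg_Theta_pen xx' Mxb').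
have c2 : penalty @ U' --> Theta_pen P rhob xb by move=> B /coo; exact: oU'.
exact: (@cvg_unique _ (@Rhausdorff R) (penalty @ U') _ _ _ c1 c2).
Qed.

(** The penalty values converge, so their decreases tend to [0], and these
    dominate [`|v k| ^+ 2]. *)
Lemma v_cvg0 : v @ successes --> (0 : X).
Proof.
have [_ [k0 hk0] _ _] := hC.
have [[_ _ _ [_ [e10 _ _]] [ga0 _]] _] := hgen.
have [Ts [pT _]] := penalty_limit.
have PS := successes_proper.
apply/cvgr0Pnorm_le => ep ep0.
pose a := eta1 A * gammabar A.
have a0 : 0 < a by exact: mulr_gt0.
have ae : 0 < a * ep ^+ 2 / 2 by rewrite divr_gt0 // mulr_gt0 // exprn_gt0.
have /cvgrPdist_le/(_ _ ae) [N1 _ hN1] := pT.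
exists (maxn k0 N1) => // k /=; rewrite geq_max => /andP[kk kN] sk.
have h1 := hN1 k kN; have h2 := hN1 k.+1 (leqW kN).
have h3 := penalty_decrease (hk0 k kk) sk.
rewrite -(@ler_pXn2r _ 2) ?nnegrE ?(ltW ep0) // -(ler_pM2l a0).
rewrite (le_trans h3) //.
move: h1 h2 => /=; rewrite !ler_norml => /andP[? ?] /andP[? ?]; lra.
Qed.

Lemma cvg_at_M (U : set_system nat) {PU : ProperFilter U} (F : X -> R) xb :
  {for xb, continuous F} -> x @ U --> xb -> (fun k => F (x k)) @ U --> F xb.
Proof. by move=> cF xx; exact: (cvg_comp x F xx cF). Qed.

(** Subgradients of [h] near [xb] are bounded: tested one unit
    against its own direction, [zeta k] has its norm compared with a local upper
    bound of [h]. *)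
Lemma ultra_zeta_cvg (U : set_system nat) xb : UltraFilter U -> x @ U --> xb ->
  exists2 zb, zeta @ U --> zb & forall y, h xb - ipX zb (y - xb) <= h y.
Proof.
move=> UU xx.
have sg k : forall y, h (x k) - ipX (zeta k) (y - x k) <= h y.
  by have [_ /(_ k) [s _ _ _ _]] := hgen; exact: (zeta_subgradient heX hP s).
have ch : {for xb, continuous h} by exact: (convexf_continuous heX (h_convex hP)).
have hh : (fun k => h (x k)) @ U --> h xb by exact: cvg_at_M.
have [B hB] := convexf_bounded_above heX (h_convex hP) xb 2.
have [zb zz] : exists l : X, zeta @ U --> l.
  apply: (ultra_bounded_cvg heX (B := `|B - h xb + 1|)) => //.
  have n1 : \forall k \near U, `|xb - x k| <= 1 by move/cvgrPdist_le : xx; exact.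
  have n2 : \forall k \near U, `|h xb - h (x k)| <= 1.
    by move/cvgrPdist_le : hh => /(_ 1 ltr01).
  apply: filterS2 n1 n2 => k k1 k2.
  apply: le_trans (ler_norm _).
  have [->|z0] := eqVneq (zeta k) 0.
    rewrite normr0; have := hB 0; rewrite normr0 addr0 => /(_ (ler0n _ _)); lra.
  have nz : 0 < `|zeta k| by rewrite normr_gt0.
  pose w := `|zeta k|^-1 *: zeta k.
  have w1 : `|w| = 1 by rewrite /w normrZ normfV normr_id mulVf // gt_eqF.
  have := sg k (x k - w).
  rewrite (addrAC (x k)) subrr add0r (ipNr ipXi) opprK /w (ipZr ipXi).
  rewrite -(norm_sqr_ip heX) expr2 mulrA mulVf ?gt_eqF // mul1r -/w => h1.
  have h2 : h (x k - w) <= B.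
    have -> : x k - w = xb + ((x k - xb) - w) by rewrite addrA (addrC xb) subrK.
    apply: hB; rewrite (le_trans (ler_normB _ _)) // w1 distrC.
    by rewrite (_ : 2 = 1 + 1) // lerD2r.
  move: k2; rewrite ler_norml => /andP[k2 k3]; lra.
exists zb => // y.
apply: (@cvg_to_le _ _ U _ (fun k => h (x k) - ipX (zeta k) (y - x k)) (fun=> h y)).
- apply: cvgB => //; apply: (cvg_ip heX) => //.
  by apply: cvgB => //; exact: cvg_cst.
- exact: cvg_cst.
- by apply: nearW => k; exact: sg.
Qed.

Lemma eventually_rho : \forall k \near successes, rho k = rhob.
Proof.
by have [_ [k0 hk0] _ _] := hC; exists k0 => // k /= kk _; exact: hk0.
Qed.

Lemma ultra_xi_cvg (U : set_system nat) : UltraFilter U -> successes `<=` U ->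
  exists xib : X * Y, xi @ U --> xib.
Proof.
move=> UU sU.
have nxi : \forall k \near U, enorm ipZ (xi k) <= Lpsi.
  by apply: sU; apply: filterS eventually_rho => k; exact: xi_bound.
have [l1 c1] : exists l : X, (fun k => (xi k).1) @ U --> l.
  apply: (ultra_bounded_cvg heX (B := Lpsi)) => //; apply: filterS nxi => k.
  exact/le_trans/(norm_fst_le heX heY).
have [l2 c2] : exists l : Y, (fun k => (xi k).2) @ U --> l.
  apply: (ultra_bounded_cvg heY (B := Lpsi)) => //; apply: filterS nxi => k.
  exact/le_trans/(norm_snd_le heX heY).
exists (l1, l2).
rewrite (_ : xi = fun k => ((xi k).1, (xi k).2)); last first.
  by apply/funext => k; case: (xi k).
exact: cvg_pair_points.
Qed.

Lemma succ_I2 : \forall k \near successes, cond_I2 ipX ipY P it k.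
Proof. by apply: filterS successes_succ => k [/cond_DI2 []]. Qed.

Lemma ultra_v_cvg0 (U : set_system nat) : successes `<=` U -> v @ U --> (0 : X).
Proof. by move=> sU B /v_cvg0; exact: sU. Qed.

Lemma ultra_z_cvg (U : set_system nat) xb : UltraFilter U -> successes `<=` U ->
  M xb -> x @ U --> xb -> z @ U --> (xb, g xb).
Proof.
move=> UU sU Mxb xx.
have vv := ultra_v_cvg0 sU.
have Gc : (fun k => G k) @ U --> (xb, g xb).
  apply: cvg_pair_points.
    by rewrite -[X in _ --> X]addr0; exact: cvgD.
  rewrite -[X in _ --> X]addr0; apply: cvgD.
    exact: (cvg_comp x g xx (g_continuous Mxb)).
  by rewrite -(linear0 ('d g xb)); exact: (cvg_dg xx Mxb vv).
have gap : (fun k => amax A * `|v k| ^+ 2) @ U --> (0 : R).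
  rewrite -(mulr0 (amax A)); apply: cvgM; first exact: cvg_cst.
  rewrite -[X in _ --> X](mulr0 (0 : R)) (_ : (fun k => _) = fun k => `|v k| * `|v k|) //.
  by have vn : (fun k => `|v k|) @ U --> (0 : R);
    [rewrite -(@normr0 R X); exact: cvg_norm|exact: cvgM].
have ngap : \forall k \near U, enorm ipZ (G k - z k) <= amax A * `|v k| ^+ 2.
  apply: sU; apply: filterS succ_I2 => k [hG _].
  have [_ /(_ k) [_ [/andP[_ aA] _] _ _ _]] := hgen.
  by rewrite (le_trans hG) // ler_wpM2r // sqr_ge0.
have d0 (N : X * Y -> R) : (forall u, 0 <= N u) -> (forall u, N u <= enorm ipZ u) ->
    (fun k => N (G k - z k)) @ U --> (0 : R).
  move=> N0 Nle; apply: (@squeeze_cvgr _ _ _ _ (fun=> 0) (fun k => amax A * `|v k| ^+ 2)) => //.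
    by apply: filterS ngap => k hk; rewrite N0 (le_trans (Nle _)).
  exact: cvg_cst.
have z1 : (fun k => (z k).1) @ U --> xb.
  rewrite (_ : (fun k => _) = fun k => (G k).1 - ((G k).1 - (z k).1)); last first.
    by apply/funext => k; rewrite opprB addrC subrK.
  rewrite -[X in _ --> X]subr0; apply: cvgB.
    by apply: (cvg_comp _ fst Gc); exact: cvg_fst.
  apply/cvgr0Pnorm_lt => ep ep0.
  have /cvgr0Pnorm_lt/(_ _ ep0) := d0 (fun u => `|u.1|) (fun u => normr_ge0 _) (norm_fst_le heX heY).
  by apply: filterS => k; rewrite normr_id.
have z2 : (fun k => (z k).2) @ U --> g xb.
  rewrite (_ : (fun k => _) = fun k => (G k).2 - ((G k).2 - (z k).2)); last first.
    by apply/funext => k; rewrite opprB addrC subrK.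
  rewrite -[X in _ --> X]subr0; apply: cvgB.
    by apply: (cvg_comp _ snd Gc); exact: cvg_snd.
  apply/cvgr0Pnorm_lt => ep ep0.
  have /cvgr0Pnorm_lt/(_ _ ep0) := d0 (fun u => `|u.2|) (fun u => normr_ge0 _) (norm_snd_le heX heY).
  by apply: filterS => k; rewrite normr_id.
rewrite (_ : z = fun k => ((z k).1, (z k).2)); last first.
  by apply/funext => k; case: (z k).
exact: cvg_pair_points.
Qed.

Context {Q : nat -> 'M[R]_(q, p)}.
Hypothesis hQ : forall k (u : X), 'd g (x k) u
  = synthesis d (Q k *m analysis_map ipX e u).

Local Notation w := (wseq ipX P it Q).
Local Notation Xi := (Xi ipX ipY P C e d (cbar A C)).
Local Notation dist0 := (dist0_subdiff (ipW ipX ipY (p := p) (q := q)) Xi).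

(** The matrix of the Jacobian at the limit point. *)
Definition Qlim xb : 'M[R]_(q, p) := \matrix_(i, j) ipY ('d g xb (e j)) (d i).

Lemma ultra_Q_cvg (U : set_system nat) xb : UltraFilter U -> M xb -> x @ U --> xb ->
  Q @ U --> Qlim xb.
Proof.
move=> UU Mxb xx.
have entry k i j : Q k i j = ipY ('d g (x k) (e j)) (d i).
  rewrite hQ; have on : forall i j, ipY (d i) (d j) = (i == j)%:R by case: heY => _ _ [].
  have onX : forall i j, ipX (e i) (e j) = (i == j)%:R by case: heX => _ _ [].
  rewrite /synthesis (ip_suml (innerY heY)) (bigD1 i) //= big1 => [|l li].
    rewrite (ipZl (innerY heY)) on eqxx mulr1 addr0 mxE (bigD1 j) //= big1 => [|l lj].
      by rewrite mxE onX eqxx mulr1 addr0.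
    by rewrite mxE onX eq_sym (negPf lj) mulr0.
  by rewrite (ipZl (innerY heY)) on (negPf li) mulr0.
move=> B [Bs nB sB].
have nk i j : \forall k \near U, Bs i j (Q k i j).
  have : (fun k => ipY ('d g (x k) (e j)) (d i)) @ U --> Qlim xb i j.
    rewrite mxE; apply: (cvg_ip heY); last exact: cvg_cst.
    exact: (cvg_comp x (fun y => 'd g y (e j)) xx (dg_continuous Mxb)).
  move=> hc; have hU : \forall k \near U, Bs i j (ipY ('d g (x k) (e j)) (d i)).
    exact: (hc _ (nB i j)).
  by apply: filterS hU => k; rewrite entry.
have : \forall k \near U, forall i j, Bs i j (Q k i j).
  by apply: filter_forall => i; apply: filter_forall => j; exact: nk.
by apply: filterS => k hk; apply: sB.
Qed.

(** At the limit of [w] along an ultrafilter of successful indices the step and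
    the coupling term vanish, and the conjugate takes its Fenchel-Young value. *)
Lemma ultra_w_cluster (U : set_system nat) (UU : UltraFilter U) (sU : successes `<=` U) :
  exists wb, [/\ w @ U --> wb, cluster (w @ \oo) wb &
    exists xb, [/\ M xb, x @ U --> xb & Xi wb = (Theta_pen P rhob xb)%:E] ].
Proof.
have [xb Mxb xx] := ultra_x_cvg UU.
have [zb zz hz] := ultra_zeta_cvg UU xx.
have [xib xixi] := ultra_xi_cvg UU sU.
have zcv := ultra_z_cvg UU sU Mxb xx.
have QQ := ultra_Q_cvg UU Mxb xx.
have vv := ultra_v_cvg0 sU.
have gg : (fun k => gradf (x k) + zeta k) @ U --> gradf xb + zb.
  by apply: cvgD => //; exact: (cvg_comp x gradf xx (gradf_continuous Mxb)).
pose wb : spaceW p q := (xb, 0, Qlim xb, xib, (xb, g xb), zb, gradf xb + zb).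
have ww : w @ U --> wb.
  apply: cvg_pair_points; last exact: gg.
  apply: cvg_pair_points; last exact: zz.
  apply: cvg_pair_points; last exact: zcv.
  apply: cvg_pair_points; last exact: xixi.
  apply: cvg_pair_points; last exact: QQ.
  exact: cvg_pair_points.
have ooU : \oo `<=` U by move=> B /successes_oo; exact: sU.
exists wb; split => //.
  move=> B1 B2 h1 h2.
  have : U ((w @^-1` B1) `&` (w @^-1` B2)) by apply: filterI; [exact: ooU|exact: ww].
  by move=> /filter_ex [k [? ?]]; exists (w k).
exists xb; split => //.
rewrite /wb (Xi_value heX) //; last by have [] := tangent_subspace heX hM Mxb.
congr EFin.
have -> : Hmap ipX P e d xb 0 (Qlim xb) = (xb, g xb).
  rewrite /Hmap !addr0 (_ : analysis_map ipX e 0 = 0) ?mulmx0; last first.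
    by apply/matrixP => i j; rewrite !mxE (ip0l ipXi).
  by rewrite /synthesis big1 ?addr0 // => i _; rewrite mxE scale0r.
rewrite subrr (ip0r ipZi) (ip0r ipXi) normr0 /Theta_pen /Theta /psi /=; ring.
Qed.

Definition potential k : R :=
  f (x k) - h (x k) + ipX (gradf (x k) + zeta k) (v k) + psi P rhob (z k)
  + ipZ (xi k) (G k - z k) + cbar A C * `|v k| ^+ 2.

Lemma Hmap_G k : Hmap ipX P e d (x k) (v k) (Q k) = G k.
Proof. by rewrite /Hmap -hQ. Qed.

Lemma Xi_wE k : Xi (w k) = (potential k)%:E.
Proof.
rewrite /wseq (Xi_value heX) ?Hmap_G //; [exact: x_mem|exact: run_tangent|].
by have [_ /(_ k) [s _ _ _ _]] := hgen; exact: (zeta_subgradient heX hP s).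
Qed.

(** The Taylor error [L] and the cost of replacing [z k] by [G k] are what the
    term [cbar * `|v| ^+ 2] of the potential compensates. *)
Lemma potential_ge k : rho k = rhob -> successful k -> penalty k.+1 <= potential k.
Proof.
move=> rk sk; have [nI1 _] := sk.
have [_ [hG _]] := cond_DI2 nI1.
have [_ /(_ k) [_ [/andP[_ aA] _] _ _ _]] := hgen.
have [[_ [_ /andP[bm0 _]] _ _ [_ [_ _ s1]]] _] := hgen.
have := step_expansion k; rewrite -(successful_step sk) -/(penalty k.+1) => h1.
have h2 := model_point_gap k.
have h3 : - (Lpsi * enorm ipZ (G k - z k)) <= ipZ (xi k) (G k - z k).
  rewrite lerNl -(ipNr ipZi) (le_trans (cauchy_schwarz ipZi _ _)) //.
  by rewrite (enormN ipZi) ler_wpM2r ?enorm_ge0 // xi_bound.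
have h4 : enorm ipZ (G k - z k) <= amax A * `|v k| ^+ 2.
  by rewrite (le_trans hG) // ler_wpM2r // sqr_ge0.
have h5 := ler_wpM2l Lpsi_ge0 h4.
have h6 : 0 <= betabar A C * `|v k| ^+ 2.
  by rewrite mulr_ge0 ?sqr_ge0 // mulr_ge0 ?exprn_ge0 // ltW // (lt_trans _ s1).
rewrite /potential /cbar.
move: h1; rewrite /ell; lra.
Qed.

(** Moving from [z k] to [G k] along the subgradient [xi k] of [psi] can only
    increase the value, and the model decreases the penalty value. *)
Lemma potential_le k : rho k = rhob -> successful k ->
  potential k <= penalty k + cbar A C * `|v k| ^+ 2.
Proof.
move=> rk [nI1 _]; have [hD _] := cond_DI2 nI1.
have [_ /(_ k) [_ _ [_ sg _] _ _]] := hgen.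
rewrite rk in sg.
have h1 := psi_subgradient heX heY hP (ltW rhob_gt0) sg (G k).
have h2 : 0 <= beta k / 2 * `|v k| ^+ 2.
  by rewrite mulr_ge0 ?sqr_ge0 // divr_ge0 // ltW // beta_gt0.
move: hD; rewrite /cond_D /Theta_hat rk -/(penalty k) /ell /potential; lra.
Qed.

(** Splitting [s = grad f + zeta + adjG xi] into its tangential part, of size
    [O(`|v|)] by the inexactness test, and its normal part [nu], the vector
    [- (nu + B, nu)] normal to the tangent bundle cancels [nu] in both the
    [x] and the [v] components of the subgradient of the potential. *)
Lemma ultra_subgradient_bound (U : set_system nat) : UltraFilter U ->
  successes `<=` U ->
  exists C1 : R, 0 < C1 /\ \forall k \near U, (dist0 (w k) <= (C1 * `|v k|)%:E)%E.
Proof.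
move=> UU sU.
have [xb Mxb xx] := ultra_x_cvg UU.
have [zb zz hz] := ultra_zeta_cvg UU xx.
have [xib xixi] := ultra_xi_cvg UU sU.
have vv := ultra_v_cvg0 sU.
have xi1 : (fun k => (xi k).1) @ U --> xib.1 by apply: (cvg_comp xi fst xixi); exact: cvg_fst.
have xi2 : (fun k => (xi k).2) @ U --> xib.2 by apply: (cvg_comp xi snd xixi); exact: cvg_snd.
pose s k := gradf (x k) + zeta k + adjG (x k) (xi k).
have ss : s @ U --> gradf xb + zb + adjG xb xib.
  apply: cvgD; first by apply: cvgD => //; exact: (cvg_comp x gradf xx (gradf_continuous Mxb)).
  by apply: cvgD => //; exact: (cvg_adjJ xx Mxb xi2).
set sb := gradf xb + zb + adjG xb xib in ss.
have [C0 [C00 hT]] := tangent_bundle_normal heX hM Mxb.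
have [Bb hBb] := beta_bounded.
have Bb0 : 0 < Bb by exact: lt_le_trans (beta_gt0 0) (hBb 0%N).
have [[_ _ [am0 bm0 _ _] _ _] _] := hgen.
(* [T1 * `|v k|] bounds the tangential part of [s k], and [Nu] its normal part. *)
pose T1 : R := bmax A + Bb.
have T10 : 0 < T1 by exact: addr_gt0.
pose Nu : R := `|sb| + 1 + T1.
have Nu0 : 0 < Nu by rewrite addr_gt0 // ltr_wpDl.
pose c2 : R := 2 * `|cbar A C|.
exists (T1 + C0 * Nu + (T1 + c2) + Lpsi + amax A + 1); split.
  have := mulr_ge0 C00 (ltW Nu0); have := Lpsi_ge0.
  have : 0 <= c2 by rewrite mulr_ge0.
  move: T10; lra.
have nT : U (x @^-1` _) := xx _ hT.
have ns : \forall k \near U, `|sb - s k| <= 1 by move/cvgrPdist_le : ss; exact.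
have nv : \forall k \near U, `|v k| <= 1 by move/cvgr0Pnorm_le : vv; exact.
have nr := sU _ eventually_rho.
have nS := sU _ successes_succ.
apply: (@filterS _ U _ _ _ _ (filterI nT (filterI ns (filterI nv (filterI nr nS)))))
  => k [/= hTk [sk [vk [rk Sk]]]].
have [nI1 _] := Sk.
have [_ [hG hp]] := cond_DI2 nI1.
have [_ /(_ k) [sz [/andP[_ aA] /andP[_ bA]] [Tv sg _] _ _]] := hgen.
have hz' := zeta_subgradient heX hP sz.
have Tsub := tangent_space_subspace k.
pose tau := pvec k - beta k *: v k.
have Ttau : tangent_space M (x k) tau.
  rewrite /tau addrC -scaleNr; apply: (proj2 Tsub) => //.
  by have [] := projectionP heX (gradient ipX (ell ipX P (x k) (zeta k)) (v k)
    + beta k *: v k + adjG (x k) (xi k)) Tsub.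
pose nu := s k - tau.
have Nnu : normal_vectors ipX M (x k) nu.
  move=> u Tu; rewrite /nu /tau !(ipBl ipXi) (pvec_ip Tu) /s.
  by rewrite !(ipDl ipXi) (ipZl ipXi); ring.
have tau_le : `|tau| <= T1 * `|v k|.
  rewrite /tau (le_trans (ler_normB _ _)) // mulrDl lerD //.
    by rewrite (le_trans hp) // ler_wpM2r.
  by rewrite normrZ gtr0_norm ?beta_gt0 // ler_wpM2r.
have nu_le : `|nu| <= Nu.
  rewrite /nu (le_trans (ler_normB _ _)) // lerD //.
    have -> : s k = sb - (sb - s k) by rewrite opprB addrC subrK.
    by rewrite (le_trans (ler_normB _ _)) // lerD2l.
  by rewrite (le_trans tau_le) // ler_piMr // ltW.
have [hnu [B [B_le hB]]] := hTk (x_mem k) _ _ Tv Nnu.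
have [W [_ Wx df dg _]] := smooth_at_M (x_mem k).
have hn : forall ep : R, 0 < ep -> \forall xv \near (x k, v k), tangent_bundle M xv ->
     ipX (- (nu + B)) (xv.1 - x k) + ipX (- nu) (xv.2 - v k)
       <= ep * (`|xv.1 - x k| + `|xv.2 - v k|).
  move=> ep ep0.
  have ep2 : 0 < ep / 2 by rewrite divr_gt0.
  have h1 := @near_fst _ _ (x k, v k) _ (hnu _ ep2).
  move: h1 (hB _ ep2); apply: filterS2 => xv h1 h2 Txv.
  have := h1 (proj1 Txv); have := h2 Txv.
  rewrite !ler_norml => /andP[g1 _] /andP[g2 _].
  rewrite !(ipNl ipXi) (ipDl ipXi).
  have := normr_ge0 (xv.2 - v k); have := normr_ge0 (xv.1 - x k); nra.
have rsg : forall z', psi P rhob (z k) + ipZ (xi k) (z' - z k) <= psi P rhob z'.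
  rewrite rk in sg; exact: (psi_subgradient heX heY hP (ltW rhob_gt0) sg).
have reg := @Xi_regular_subgradient R X Y ipX ipY p q e d heX heY P C (cbar A C) (x k) (v k)
  (Q k) (xi k) (z k) (zeta k) (gradf (x k) + zeta k) (- (nu + B)) (- nu)
  (x_mem k) Tv hz' (df _ Wx) (dg _ Wx) (hQ k) rsg hn.
rewrite -/(s k) in reg.
pose u : spaceW p q := (s k + - (nu + B), s k + (2 * cbar A C) *: v k + - nu,
  analysis_map ipY d (xi k).2 *m (analysis_map ipX e (v k))^T,
  Hmap ipX P e d (x k) (v k) (Q k) - z k, 0, 0, v k).
have lim : limiting_subdiff (ipW ipX ipY (p := p) (q := q)) Xi (w k) u.
  split; first by rewrite Xi_wE.
  by exists (fun=> w k), (fun=> u); split; try exact: cvg_cst.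
apply: (@le_trans _ _ (enorm (ipW ipX ipY (p := p) (q := q)) u)%:E).
  by apply: ereal_inf_lbound; exists u.
rewrite lee_fin (le_trans (enormW_le heX heY _ _ _ _ _ _ _)) //.
rewrite Hmap_G !normr0 (enorm0 ipZi) (enorm_outer heX heY).
have e1 : `|s k + - (nu + B)| <= (T1 + C0 * Nu) * `|v k|.
  have -> : s k + - (nu + B) = tau - B.
    by rewrite /nu opprD addrA opprB addrCA subrr addr0.
  rewrite (le_trans (ler_normB _ _)) // mulrDl lerD // (le_trans B_le) //.
  by rewrite ler_wpM2r // ler_wpM2l.
have e2 : `|s k + (2 * cbar A C) *: v k + - nu| <= (T1 + c2) * `|v k|.
  have -> : s k + (2 * cbar A C) *: v k + - nu = tau + (2 * cbar A C) *: v k.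
    by rewrite /nu opprB addrAC addrCA subrr addr0.
  rewrite (le_trans (ler_normD _ _)) // [leRHS]mulrDl lerD //.
  by rewrite normrZ normrM ger0_norm.
have e3 : `|(xi k).2| * `|v k| <= Lpsi * `|v k|.
  by rewrite ler_wpM2r // (le_trans (norm_snd_le heX heY _)) // xi_bound.
have e4 : enorm ipZ (G k - z k) <= amax A * `|v k|.
  rewrite (le_trans hG) // ler_pM ?sqr_ge0 //; last by rewrite expr2 ler_piMr.
  by have [_ /(_ k) [_ [/andP[/ltW]]]] := hgen.
move: e1 e2 e3 e4; lra.
Qed.

(** * The Kurdyka-Lojasiewicz inequality *)

(** What the final summation uses of a desingularizing function [phi] with
    derivative [D]. Unlike the Kurdyka-Lojasiewicz property at a point, it
    is stable under finite unions of index sets, by adding the functions. *)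
Definition KL_index_set (Ts : R) (B : set nat) : Prop :=
  exists (phi D : R -> R) (eta : R), [/\ 0 < eta,
    forall t, 0 < t -> t < eta -> 0 <= phi t,
    forall r, 0 < r -> r < eta -> 0 <= D r,
    forall t s r, 0 < t -> t <= s -> s <= r -> r < eta ->
      D r * (s - t) <= phi s - phi t
  & forall k, B k -> 0 < potential k - Ts -> potential k - Ts < eta ->
      1 <= D (potential k - Ts) * `|v k| ].

Lemma KL_index_setU Ts B1 B2 :
  KL_index_set Ts B1 -> KL_index_set Ts B2 -> KL_index_set Ts (B1 `|` B2).
Proof.
move=> [phi1 [D1 [eta1 [e1 p1 d1 c1 k1]]]] [phi2 [D2 [eta2 [e2 p2 d2 c2 k2]]]].
exists (fun t => phi1 t + phi2 t), (fun t => D1 t + D2 t), (Num.min eta1 eta2).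
split.
- by rewrite lt_min e1.
- by move=> t t0; rewrite lt_min => /andP[t1 t2]; rewrite addr_ge0 ?p1 ?p2.
- by move=> t t0; rewrite lt_min => /andP[t1 t2]; rewrite addr_ge0 ?d1 ?d2.
- move=> t s r t0 ts sr; rewrite lt_min => /andP[r1 r2].
  have := c1 t s r t0 ts sr r1; have := c2 t s r t0 ts sr r2; lra.
- move=> k Bk p0; rewrite lt_min => /andP[q1 q2]; rewrite mulrDl.
  have g1 : 0 <= D1 (potential k - Ts) * `|v k| by rewrite mulr_ge0 // d1.
  have g2 : 0 <= D2 (potential k - Ts) * `|v k| by rewrite mulr_ge0 // d2.
  case: Bk => [/k1 /(_ p0 q1)|/k2 /(_ p0 q2)]; lra.
Qed.

Hypothesis hKL : KL_property (ipW ipX ipY (p := p) (q := q)) Xi (cluster (w @ \oo)).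

(** Along each ultrafilter the points [w k] converge to a cluster point, where
    the inequality and the subgradient bound hold with their own constants;
    [ultrafilter_ideal] makes them uniform. *)
Lemma KL_successes Ts :
  (forall xb (U : set_system nat), ProperFilter U -> \oo `<=` U -> M xb ->
     x @ U --> xb -> Theta_pen P rhob xb = Ts) ->
  exists2 B, successes B & KL_index_set Ts B.
Proof.
move=> hTs; have PS := successes_proper.
apply: ultrafilter_ideal => [|U UU sU]; first exact: KL_index_setU.
have [wb [ww wcl [xb [Mxb xx Xib]]]] := ultra_w_cluster UU sU.
have Xiwb : Xi wb = Ts%:E.
  rewrite Xib (hTs xb U) // => B /successes_oo; exact: sU.
have [C1 [C10 hC1]] := ultra_subgradient_bound UU sU.
have [eta [Un [phi [eta0 nUn hphi hK]]]] := hKL wcl.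
have [eta' eta'0 heta] : exists2 eta' : R, 0 < eta' & (eta'%:E <= eta)%E.
  case: eta eta0 {hphi hK} => [r||] // r0; first by exists r.
  by exists 1 => //; rewrite leey.
have nw : \forall k \near U, Un (w k) by exact: (ww _ nUn).
exists [set k | Un (w k) /\ (dist0 (w k) <= (C1 * `|v k|)%:E)%E]; first exact: filterI.
have ltE r : r < eta' -> (r%:E < eta)%E.
  by move=> re; apply: lt_le_trans heta; rewrite lte_fin.
have [p0 _ _ _ dp] := hphi.
exists (fun t => C1 * phi t), (fun t => C1 * derive1 phi t), eta'; split => //.
- move=> t t0 te; rewrite mulr_ge0 ?(ltW C10) // p0 //; split; first exact: ltW.
  exact: ltE.
- move=> r r0 re; rewrite mulr_ge0 ?(ltW C10) // ltW //.
  by have [] := dp r r0 (ltE _ re).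
- move=> t s r t0 ts sr re; rewrite -mulrBr -mulrA ler_wpM2l ?(ltW C10) //.
  exact: desingularizing_chord hphi t0 ts sr (ltE _ re).
- move=> k [Uk dk] k0 ke.
  have := hK (w k) Uk; rewrite Xiwb Xi_wE lte_fin -subr_gt0 k0 => /(_ isT).
  have -> : ((potential k)%:E < Ts%:E + eta)%E.
    apply: lt_le_trans (leeD2l _ heta); rewrite -EFinD lte_fin; move: ke; lra.
  move=> /(_ isT); rewrite -EFinB /= => h1.
  have D0 : 0 <= derive1 phi (potential k - Ts).
    by rewrite ltW //; have [] := dp _ k0 (ltE _ ke).
  have := le_trans h1 (lee_wpmul2l _ dk); rewrite lee_fin => /(_ D0).
  by rewrite -EFinM lee_fin mulrA (mulrC _ C1).
Qed.

(** * Finite length *)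

(** The inequality between consecutive steps: the length of the step at a
    successful [k] is dominated by the mean of the previous one and of the
    decrease of the desingularized gap. *)
Lemma step_recursion Ts (phi D : R -> R) (eta : R) k' k :
  (forall t s r, 0 < t -> t <= s -> s <= r -> r < eta -> D r * (s - t) <= phi s - phi t) ->
  (forall r, 0 < r -> r < eta -> 0 <= D r) ->
  rho k' = rhob -> rho k = rhob -> successful k' -> successful k -> x k = x k'.+1 ->
  Ts < penalty k.+1 -> potential k' - Ts < eta ->
  (0 < potential k' - Ts -> 1 <= D (potential k' - Ts) * `|v k'|) ->
  2 * `|v k| <= `|v k'|
    + (phi (penalty k - Ts) - phi (penalty k.+1 - Ts)) / (eta1 A * gammabar A).
Proof.
move=> chord D0 rk' rk sk' sk xk tp reta kl.
have [[_ _ _ [_ [e10 _ _]] [ga0 _]] _] := hgen.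
set a := eta1 A * gammabar A; have a0 : 0 < a by exact: mulr_gt0.
have dec := penalty_decrease rk sk.
have lt := penalty_decrease_strict rk sk.
have ge := potential_ge rk' sk'.
have pk : penalty k'.+1 = penalty k by rewrite /penalty xk.
rewrite pk in ge.
have t0 : 0 < penalty k.+1 - Ts by rewrite subr_gt0.
have ts : penalty k.+1 - Ts <= penalty k - Ts by rewrite lerD2r ltW.
have sr : penalty k - Ts <= potential k' - Ts by rewrite lerD2r.
have r0 : 0 < potential k' - Ts by apply: lt_le_trans (le_trans ts sr).
have ch := chord _ _ _ t0 ts sr reta.
have kl' := kl r0.
rewrite -/a in dec.
set Dl := (_ - _) / a.
have st : (penalty k - Ts) - (penalty k.+1 - Ts) = penalty k - penalty k.+1 by ring.
have V0 := normr_ge0 (v k); have V'0 := normr_ge0 (v k').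
have h1 : a * `|v k| ^+ 2 <= `|v k'| * (a * Dl).
  rewrite (le_trans dec) // [a * Dl]mulrC divfK ?gt_eqF //.
  rewrite (le_trans _ (ler_wpM2l V'0 ch)) // st mulrA (mulrC `|v k'|).
  by rewrite ler_peMl // subr_ge0 ltW.
have Dl0 : 0 <= Dl.
  rewrite divr_ge0 ?(ltW a0) // (le_trans _ ch) // mulr_ge0 ?D0 //.
  by rewrite subr_ge0.
have h2 : `|v k| ^+ 2 <= `|v k'| * Dl.
  by rewrite -(ler_pM2l a0) (le_trans h1) // mulrCA.
(* The geometric mean of [`|v k'|] and [Dl] is at most their arithmetic mean. *)
have h3 : 0 <= (`|v k'| - Dl) ^+ 2 by exact: sqr_ge0.
rewrite -(@ler_pXn2r _ 2) ?nnegrE ?(addr_ge0 V'0 Dl0) ?mulr_ge0 //.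
have -> : (2 * `|v k|) ^+ 2 = 4 * `|v k| ^+ 2 by ring.
have -> : (`|v k'| + Dl) ^+ 2 = (`|v k'| - Dl) ^+ 2 + 4 * (`|v k'| * Dl) by ring.
by move: h2 h3; lra.
Qed.

(** In the sum of the recursion over consecutive successful iterations, the
    length [`|v k'|] on the right absorbs one of the two copies of the previous
    left side, and the rest telescopes. The invariant therefore carries the
    length at the last successful iteration. *)
Lemma finite_length : exists B, forall n, \sum_(0 <= k < n) `|x k.+1 - x k| <= B.
Proof.
have [_ [k0 hk0] [Mr0 _] _] := hC.
have [[_ _ _ [_ [e10 _ _]] [ga0 _]] _] := hgen.
pose a := eta1 A * gammabar A; have a0 : 0 < a by exact: mulr_gt0.
have PS := successes_proper.
have [Ts [pT hTs]] := penalty_limit.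
have [B nB [phi [D [eta [eta0 phi0 D0 chord klB]]]]] := KL_successes hTs.
have exS N : exists2 k, (N <= k)%N & successful k.
  have [k [k1 k2]] := @filter_ex _ _ PS _ (filterI (successes_ge N) successes_succ).
  by exists k.
have pge k : (k0 <= k)%N -> Ts <= penalty k.
  move=> kk; apply: (cvgr_to_le pT); exists k => // m /= km.
  exact: penalty_nonincreasing hk0 _ _ kk km.
have pgt k : (k0 <= k)%N -> Ts < penalty k.
  move=> kk; have [l kl sl] := exS k.
  have k0l := leq_trans kk kl.
  apply: lt_le_trans (penalty_nonincreasing hk0 kk kl).
  apply: le_lt_trans (penalty_decrease_strict (hk0 _ k0l) sl).
  exact: pge (leqW k0l).
(* With this bound [cbar * `|v k| ^+ 2 <= eta / 4], so that the potential stays in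
   the range where [phi] desingularizes. *)
pose c := `|cbar A C| + 1; have c0 : 0 < c by rewrite ltr_wpDl.
have small : 0 < Num.min 1 (eta / 4 / c) by rewrite lt_min ltr01 !divr_gt0.
have nv : \forall k \near successes, `|v k| <= Num.min 1 (eta / 4 / c).
  by move/cvgr0Pnorm_le : v_cvg0; exact.
have npT : \forall k \near \oo, `|Ts - penalty k| <= eta / 4.
  by move/cvgrPdist_le : pT; apply; rewrite divr_gt0.
have [N1 _ hN1] := filterI nB nv.
have [N2 _ hN2] := npT.
pose K0 := maxn k0 (maxn N1 N2).
have hv k : (K0 <= k)%N -> successful k -> `|v k| <= 1.
  rewrite !geq_max => /and3P[_ n1 _] sk.
  by have [_] := hN1 k n1 sk; rewrite le_min => /andP[].
have hr k : (K0 <= k)%N -> rho k = rhob.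
  by rewrite !geq_max => /and3P[? _ _]; exact: hk0.
have hpot k : (K0 <= k)%N -> successful k -> potential k - Ts < eta.
  move=> Kk sk; have := potential_le (hr _ Kk) sk.
  have v1 := hv _ Kk sk.
  move: Kk; rewrite !geq_max => /and3P[_ n1 n2].
  have [_] := hN1 k n1 sk; rewrite le_min => /andP[_].
  rewrite ler_pdivlMr // => v2.
  have := hN2 k n2 => /=; rewrite ler_norml => /andP[v3 _].
  have := ler_norm (cbar A C); have := normr_ge0 (v k); have := normr_ge0 (cbar A C).
  rewrite /c in v2 => g1 g2 g3 g4.
  have : cbar A C * `|v k| ^+ 2 <= eta / 4 by nra.
  lra.
have hkl k : (K0 <= k)%N -> successful k -> 0 < potential k - Ts ->
    1 <= D (potential k - Ts) * `|v k|.
  move=> Kk sk p0; apply: klB => //; last exact: hpot.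
  move: Kk; rewrite !geq_max => /and3P[_ n1 _].
  by have [] := hN1 k n1 sk.
have rec k' k : (K0 <= k')%N -> (K0 <= k)%N -> successful k' -> successful k ->
    x k = x k'.+1 -> 2 * `|v k| <= `|v k'|
      + (phi (penalty k - Ts) - phi (penalty k.+1 - Ts)) / a.
  move=> Kk' Kk sk' sk xk.
  apply: (step_recursion chord D0) => //; [exact: hr|exact: hr| |exact: hpot|exact: hkl].
  by apply/pgt/leqW; move: Kk; rewrite geq_max => /andP[].
have hpen k : (K0 <= k)%N -> penalty k - Ts < eta.
  rewrite !geq_max => /and3P[_ _ n2].
  have := hN2 k n2 => /=; rewrite ler_norml => /andP[]; lra.
have hpen0 k : (K0 <= k)%N -> 0 < penalty k - Ts.
  by rewrite !geq_max => /and3P[n2 _ _]; rewrite subr_gt0 pgt.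
pose V i := if `[< successful i >] then `|v i| else 0.
have [k1 Kk1 sk1] := exS K0.
pose c1 := `|v k1| + phi (penalty k1.+1 - Ts) / a.
have inv k : (k1.+1 <= k)%N -> exists k', [/\ successful k', (K0 <= k')%N, x k = x k'.+1 &
    \sum_(k1.+1 <= i < k) V i + `|v k'| + phi (penalty k - Ts) / a <= c1].
  elim: k => // k IH; rewrite leq_eqVlt => /orP[/eqP <-|].
    by exists k1; split => //; rewrite big_geq // add0r.
  rewrite ltnS => k1k; have [k' [sk' Kk' xk le]] := IH k1k.
  have Kk : (K0 <= k)%N by exact: leq_trans Kk1 (ltnW k1k).
  rewrite big_nat_recr //=; have [sk|nsk] := pselect (successful k).
    have -> : V k = `|v k| by rewrite /V asboolT.
    exists k; split => //; have := rec _ _ Kk' Kk sk' sk xk.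
    rewrite mulrBl; move: le; lra.
  have -> : V k = 0 by rewrite /V asboolF.
  exists k'; split => //; first by rewrite x_unchanged.
  by rewrite addr0 /penalty x_unchanged.
have phia k : (K0 <= k)%N -> 0 <= phi (penalty k - Ts) / a.
  by move=> Kk; rewrite divr_ge0 ?(ltW a0) // phi0 ?hpen0 ?hpen.
have bV k : (k1.+1 <= k)%N -> \sum_(k1.+1 <= i < k) V i <= c1.
  move=> k1k; have [k' [_ _ _]] := inv k k1k.
  have := normr_ge0 (v k'); have := phia k (leq_trans Kk1 (ltnW k1k)); lra.
have stepV k : (K0 <= k)%N -> `|x k.+1 - x k| <= (1 + Mretr C) * V k.
  move=> Kk; have [sk|nsk] := pselect (successful k); last first.
    have -> : V k = 0 by rewrite /V asboolF.
    by rewrite x_unchanged // subrr normr0 mulr0.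
  have -> : V k = `|v k| by rewrite /V asboolT.
  rewrite (le_trans (step_length sk)) // mulrDl mul1r lerD2l ler_wpM2l ?(ltW Mr0) //.
  by rewrite expr2 ler_piMl // hv.
have c10 : 0 <= c1 by have := bV k1.+1 (leqnn _); rewrite big_geq.
exists (\sum_(0 <= k < k1.+1) `|x k.+1 - x k| + (1 + Mretr C) * c1) => n.
have [nk|kn] := leqP n k1.+1.
  rewrite (@le_trans _ _ (\sum_(0 <= k < k1.+1) `|x k.+1 - x k|)) //.
    by rewrite [leRHS](big_cat_nat (n := n)) //= lerDl sumr_ge0.
  by rewrite lerDl mulr_ge0 // addr_ge0 // ltW.
rewrite (big_cat_nat (n := k1.+1)) //= ?(ltnW kn) // lerD2l.
rewrite (le_trans _ (ler_wpM2l _ (bV n (ltnW kn)))) ?addr_ge0 ?(ltW Mr0) //.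
rewrite mulr_sumr ler_sum_nat // => i /andP[ki _]; apply: stepV.
exact: leq_trans Kk1 (ltnW ki).
Qed.

Lemma summable_steps : (\sum_(0 <= k <oo) (`|x k.+1 - x k|)%:E < +oo)%E.
Proof.
have [B hB] := finite_length.
apply: (@le_lt_trans _ _ B%:E); last by rewrite ltry.
apply: lime_le; first by apply: is_cvg_nneseries => n _ _; rewrite lee_fin.
by apply: nearW => n; rewrite sumEFin lee_fin.
Qed.

(** The partial sums of the lengths are convergent and dominate the distances
    of the iterates, so that a limit along an ultrafilter is a limit. *)
Lemma cvg_x : exists2 xb, M xb & x @ \oo --> xb.
Proof.
have [B hB] := finite_length.
have [U [UU oU]] := ultraFilterLemma (eventually_filter : ProperFilter \oo).
have [xb Mxb xx] := ultra_x_cvg UU.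
exists xb => //.
pose s n := \sum_(0 <= k < n) `|x k.+1 - x k|.
have cs : cvgn s.
  apply: nondecreasing_is_cvgn.
    by apply: nondecreasing_series => n _ _; exact: normr_ge0.
  by exists B => _ /= [n _ <-]; exact: hB.
have tri m n : (m <= n)%N -> `|x n - x m| <= s n - s m.
  move=> mn; rewrite /s (big_cat_nat (n := m)) //= addrAC subrr add0r.
  by rewrite -telescope_sumr // ler_norm_sum.
apply/cvgrPdist_le => ep ep0.
have ep2 : 0 < ep / 2 by rewrite divr_gt0.
have [N _ hN] : \forall n \near \oo, `|limn s - s n| <= ep / 4.
  by move/cvgrPdist_le : cs; apply; rewrite divr_gt0.
exists N => // n /= Nn.
have UN : U [set m | (n <= m)%N] by apply: oU; exists n.
have Ux : U [set m | `|xb - x m| <= ep / 2] by move/cvgrPdist_le : xx; exact.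
have [m [/= nm xm]] := @filter_ex _ _ _ _ (filterI UN Ux).
have h1 : s m - s n <= ep / 2.
  have := hN _ Nn; have := hN _ (leq_trans Nn nm).
  by rewrite /= !ler_norml => /andP[? ?] /andP[? ?]; lra.
have := ler_distD (x m) xb (x n); have := tri _ _ nm; move: xm h1.
lra.
Qed.

(** * The limit point is stationary *)

(** Along late successful iterations the penalty parameter is left unchanged,
    so its test has failed; as [beta k * `|v k|] tends to [0], only the
    reciprocal of the constraint violation can have made it fail. *)
Lemma violation_le : \forall k \near successes, dist (z k).2 <= beta k * `|v k|.
Proof.
have [_ [k0 hk0] _ _] := hC.
have [[_ _ [_ _ tau1 _] _ _] _] := hgen.
have [Bb hBb] := beta_bounded.
have Bb0 : 0 < Bb by exact: lt_le_trans (beta_gt0 0) (hBb 0%N).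
have nv : \forall k \near successes, `|v k| < (rhob * Bb)^-1.
  by move/cvgr0Pnorm_lt : v_cvg0; apply; rewrite invr_gt0 mulr_gt0 // rhob_gt0.
apply: (filterS3 _ _ (successes_ge k0) successes_succ nv) => k kk sk hv.
have [nI1 nr] := sk.
have vn0 : 0 < `|v k| by rewrite normr_gt0; exact: v_neq0.
have bv0 : 0 < beta k * `|v k| by rewrite mulr_gt0 ?beta_gt0.
have rk : rho k = rhob by exact: hk0.
have nt : ~ rho_test P it k.
  have [[//]|[_ [_ _ _ hs]]] := run_step k.
  have [_ _] := hs nr; rewrite (hk0 k.+1 (leqW kk)) rk; case: asboolP => // _ /eqP.
  by rewrite lt_eqF // ltr_pMl // rhob_gt0.
have [d0|d0] := eqVneq (dist (z k).2) 0; first by rewrite d0 ltW.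
have dp : 0 < dist (z k).2 by rewrite lt_neqAle eq_sym d0 (dist_ge0 hP).
rewrite leNgt; apply/negP => hd; apply: nt.
rewrite /rho_test !inver (gt_eqF (beta_gt0 k)) (gt_eqF vn0) (gt_eqF dp).
rewrite -EFinM -invfM gt_max !lte_fin rk.
rewrite ltf_pV2 ?posrE // hd andbT invf_pgt ?posrE ?rhob_gt0 //.
rewrite (@le_lt_trans _ _ (Bb * `|v k|)) ?ler_wpM2r //.
by rewrite mulrC -ltr_pdivlMr // -invfM.
Qed.

Section Limit.
Context {xb : X}.
Hypotheses (Mxb : M xb) (xx : x @ \oo --> xb).
Context {U : set_system nat} {UU : UltraFilter U}.
Hypothesis sU : successes `<=` U.

Let xU : x @ U --> xb.
Proof. by move=> B /xx /successes_oo; exact: sU. Qed.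

Lemma limit_feasible : K (g xb).
Proof.
have [[cl /andP[cl0 _] hcl] _ _ _] := hC.
apply: (tdist_eq0_mem (ptn_norm hP) (K_nonempty hP) cl0).
- by move=> y; case/andP: (hcl y).
- by case: hP => _ [].
have [Bb hBb] := beta_bounded.
apply/eqP; rewrite eq_le (dist_ge0 hP) andbT.
have nz := ultra_z_cvg UU sU Mxb xU.
apply: (@cvg_to_le _ _ U _ (fun k => dist (z k).2) (fun k => Bb * `|v k|)).
- have z2 : (fun k => (z k).2) @ U --> g xb.
    by apply: (cvg_comp z snd nz); exact: cvg_snd.
  exact: (cvg_comp _ dist z2 (@dist_continuous _)).
- rewrite -(mulr0 Bb); apply: cvgM; first exact: cvg_cst.
  by rewrite -(@normr0 R X); apply: cvg_norm; exact: ultra_v_cvg0.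
- apply: sU; apply: filterS violation_le => k /le_trans; apply.
  by rewrite ler_wpM2r.
Qed.

(** The limits [xib] and [zb] of the multipliers are subgradients at the limit
    point, since [z k] tends to [(xb, g xb)]; the optimality residuals [tau]
    vanish in the limit, which leaves a normal vector by closedness of the normal
    bundle. Restricting the inequality of [xib] to the two factors separates a
    subgradient of [vartheta] from a normal vector of [K], where the distance
    vanishes. *)
Lemma limit_stationary : stationary ipX ipY P xb.
Proof.
have Kg := limit_feasible.
split => //.
have [zb zz _] := ultra_zeta_cvg UU xU.
have [xib xixi] := ultra_xi_cvg UU sU.
have zcv := ultra_z_cvg UU sU Mxb xU.
have vv := ultra_v_cvg0 sU.
have xi1 : (fun k => (xi k).1) @ U --> xib.1 by apply: (cvg_comp xi fst xixi); exact: cvg_fst.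
have xi2 : (fun k => (xi k).2) @ U --> xib.2 by apply: (cvg_comp xi snd xixi); exact: cvg_snd.
have z1 : (fun k => (z k).1) @ U --> xb by apply: (cvg_comp z fst zcv); exact: cvg_fst.
have z2 : (fun k => (z k).2) @ U --> g xb by apply: (cvg_comp z snd zcv); exact: cvg_snd.
have dg0 : dist (g xb) = 0 by exact: (tdist_eq0 (ptn_norm hP) (K_nonempty hP)).
have cpsi : (fun k => psi P rhob (z k)) @ U --> psi P rhob (xb, g xb).
  apply: cvgD.
    exact: (cvg_comp _ vt z1 (convexf_continuous heX (vt_convex hP) (x:=xb))).
  by apply: cvgM; [exact: cvg_cst|exact: (cvg_comp _ dist z2 (@dist_continuous _))].
have sg w : vt xb + (ipX xib.1 (w.1 - xb) + ipY xib.2 (w.2 - g xb)) <= psi P rhob w.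
  have -> : vt xb = psi P rhob (xb, g xb) by rewrite /psi /= dg0 mulr0 addr0.
  apply: (@cvg_to_le _ _ U _ (fun k => psi P rhob (z k) + ipZ (xi k) (w - z k))
    (fun=> psi P rhob w)); last 1 first.
  - apply: sU; apply: filterS eventually_rho => k rk.
    have [_ /(_ k) [_ _ [_ sg _] _ _]] := hgen; rewrite rk in sg.
    exact: (psi_subgradient heX heY hP (ltW rhob_gt0) sg).
  - apply: cvgD => //.
    apply: (@cvg_ipZ _ _ _ _ _ _ _ _ _ heX heY _ U _ xi (fun k => w - z k) xib (w - (xb, g xb))) => //.
    by apply: cvgB => //; exact: cvg_cst.
  - exact: cvg_cst.
pose sb := gradf xb + zb + adjG xb xib.
have [Bb hBb] := beta_bounded.
exists xib.2; split.
  split => // y' Ky; have := sg (xb, y').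
  rewrite /psi /= subrr (ip0r ipXi) (tdist_eq0 (ptn_norm hP) (K_nonempty hP) Ky).
  lra.
exists xib.1, zb, (- sb); split.
- apply: convex_subgradient_subdiff => y.
  have := sg (y, g xb); rewrite /psi /= subrr (ip0r (innerY heY)) dg0; lra.
- have ch : {for xb, continuous (fun u => - h u)}.
    by apply: continuousN; exact: (convexf_continuous heX (h_convex hP) (x:=xb)).
  apply: (subdiff_closed _ ch xU zz).
  by apply: nearW => k; have [_ /(_ k) []] := hgen.
- suff ns : normal_vectors ipX M xb sb.
    by move=> u Tu; rewrite (ipNl ipXi) ns ?oppr0.
  pose s k := gradf (x k) + zeta k + adjG (x k) (xi k).
  pose tau k := pvec k - beta k *: v k.
  apply: (normal_vectors_closed heX (s := s) (tau := tau) _ hM Mxb xU) => //.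
  + apply: cvgD; first by apply: cvgD => //; exact: (cvg_comp x gradf xU (gradf_continuous Mxb)).
    by apply: cvgD => //; exact: (cvg_adjJ xU Mxb xi2).
  + have T0 : (fun k => (bmax A + Bb) * `|v k|) @ U --> (0 : R).
      rewrite -(mulr0 (bmax A + Bb)); apply: cvgM; first exact: cvg_cst.
      by rewrite -(@normr0 R X); exact: cvg_norm.
    have nt : \forall k \near U, `|tau k| <= (bmax A + Bb) * `|v k|.
      apply: sU; apply: filterS succ_I2 => k [_ hp].
      have [_ /(_ k) [_ [_ /andP[_ bA]] _ _ _]] := hgen.
      rewrite /tau (le_trans (ler_normB _ _)) // mulrDl lerD //.
        by rewrite (le_trans hp) // ler_wpM2r.
      by rewrite normrZ gtr0_norm ?beta_gt0 // ler_wpM2r.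
    apply/cvgr0Pnorm_le => ep ep0.
    have /cvgr0Pnorm_le/(_ _ ep0) := T0.
    apply: filterS2 nt => k h1 h2; rewrite (le_trans h1) // (le_trans (ler_norm _)) //.
  + apply: nearW => k; split; first exact: x_mem.
    move=> w Tw; rewrite /tau (ipBl ipXi) (pvec_ip Tw) /s !(ipDl ipXi) (ipZl ipXi).
    ring.
- have -> : gradf xb + xib.1 + zb + adjJ xb xib.2 = sb.
    by rewrite /sb /Defs.adjG addrA (addrAC (gradf xb) zb).
  by rewrite subrr.
Qed.

End Limit.

Lemma cvg_stationary : exists2 xb, x @ \oo --> xb & stationary ipX ipY P xb.
Proof.
have [xb Mxb xx] := cvg_x.
have [U [UU sU]] := ultraFilterLemma successes_proper.
by exists xb => //; exact: (limit_stationary Mxb xx sU).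
Qed.

End Run.

Theorem theorem5p2 (R : realType) (X Y : normedModType R)
    (ipX : {dot X for idfun}) (ipY : {dot Y for idfun})
    (hX : forall u : X, `|u| = enorm ipX u)
    (hY : forall y : Y, `|y| = enorm ipY y)
    (p q : nat) (e : 'I_p -> X) (d : 'I_q -> Y)
    (he : orthonormal_basis ipX e) (hd : orthonormal_basis ipY d)
    (P : problem X Y) (hP : standing_assumptions ipX P)
    (hM : embedded_submanifold 2 (pM P))
    (A : parameters X) (it : iterates X Y)
    (hgen : generated ipX ipY P A it)
    (hx : bounded_fun (ix it))
    (hrho : bounded_fun (irho it : nat -> R^o))
    (hS : infinite_set [set k | successful ipX ipY P A it k])
    (C : constants R) (hC : valid_constants ipX ipY P A it C)
    (Q : nat -> 'M[R]_(q, p))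
    (hQ : forall k (v : X), 'd (pg P) (ix it k) v
            = synthesis d (Q k *m analysis_map ipX e v))
    (hKL : KL_property (ipW ipX ipY (p := p) (q := q))
             (Xi ipX ipY P C e d (cbar A C))
             (cluster (wseq ipX P it Q @ \oo))) :
  (\sum_(0 <= k <oo) (`|ix it k.+1 - ix it k|)%:E < +oo)%E /\
  exists xbar : X, ix it @ \oo --> xbar /\ stationary ipX ipY P xbar.
Proof.
have ipXi : inner_product (ipX : X -> X -> R) by exact: dot_inner_product.
have ipYi : inner_product (ipY : Y -> Y -> R) by exact: dot_inner_product.
have heX : euclidean (ipX : X -> X -> R) e by split.
have heY : euclidean (ipY : Y -> Y -> R) d by split.
split; first exact: (summable_steps heX heY hP hM hgen hC hx hS hQ hKL).
have [xb xx sxb] := cvg_stationary heX heY hP hM hgen hC hx hS hQ hKL.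
by exists xb.
Qed.
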